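(* There exists a pair of self-adjoint operators $A,B$ in a complex, separable Hilbert space such that $X=(A-B)\in\mathcal{I}_2$, $\sigma(B)$ is an interval (of positive length), and for a.e. $\lambda\in\sigma(B)$ the nontangential limit $$\lim_{z\to\lambda,\ z\in\mathbb{C}_+}\det\nolimits_2\big(I+X(B-zI)^{-1}\big)$$ does not exist.
   Context: $\mathcal{I}_1$ is the trace class and $\mathcal{I}_2$ the Hilbert--Schmidt class. $\mathbb{C}_+=\{z\in\mathbb{C}\mid \operatorname{Im}(z)>0\}$. For $C\in\mathcal{I}_1$ one sets $\det_2(I+C)=\det(I+C)e^{-\operatorname{Tr}(C)}$, with $\det$ the Fredholm determinant; the map $C\mapsto\det_2(I+C)$ extends uniquely and continuously to $C\in\mathcal{I}_2$, and this extension is the modified (regularized) determinant $\det_2$. The nontangential limit at $\lambda\in\mathbb{R}$ is the (finite) limit as $z\to\lambda$ with $z$ restricted to cones $\{z\in\mathbb{C}_+\mid |\operatorname{Re}(z)-\lambda|<c\operatorname{Im}(z)\}$, $c>0$. *)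

(* Defs.v *)
From HB Require Import structures.
From mathcomp Require Import all_boot all_order all_algebra.
From mathcomp Require Import all_classical all_reals all_analysis.
From mathcomp Require Import complex sesquilinear.

Set Implicit Arguments.
Unset Strict Implicit.
Unset Printing Implicit Defensive.

Import Order.TTheory GRing.Theory Num.Theory numFieldNormedType.Exports.

Local Open Scope classical_set_scope.
Local Open Scope ring_scope.

(* The topology on R[i] is that of R[i]^o, hence the casts to R[i]^o below. *)

(* The inner product is linear in its first argument and conjugate-linear in
   the second one. *)
Record hilbert_space (R : realType) := HilbertSpace {
  hcarrier :> completeNormedModType R[i];
  inner : {dot hcarrier for Num.conj};
  inner_norm : forall u : hcarrier, inner u u = `|u| ^+ 2
}.

Definition separable (T : topologicalType) : Prop :=
  exists2 D : set T, countable D & dense D.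

Section Operators.
Context (R : realType) (H : hilbert_space R).

(* Only the values of the map on dom are meaningful. *)
Record operator := Operator {
  dom : set H;
  oapp :> H -> H;
  dom0 : dom 0;
  dom_linear : forall (a : R[i]) (u v : H),
    dom u -> dom v -> dom (a *: u + v);
  oapp_linear : forall (a : R[i]) (u v : H),
    dom u -> dom v -> oapp (a *: u + v) = a *: oapp u + oapp v
}.

Definition graph (A : operator) : set (H * H) :=
  [set p | dom A p.1 /\ A p.1 = p.2].

(* When dom A is dense this is the graph of the adjoint of A. *)
Definition adjoint_graph (A : operator) : set (H * H) :=
  [set p | forall u, dom A u -> inner H (A u) p.1 = inner H u p.2].

Definition self_adjoint (A : operator) : Prop :=
  dense (dom A) /\ adjoint_graph A = graph A.

(* (A - z)^-1, with junk values where A - z is not bijective. *)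
Definition resolvent (A : operator) (z : R[i]) (v : H) : H :=
  xget 0 [set u | dom A u /\ A u - z *: u = v].

Definition resolvent_set (A : operator) : set R[i] :=
  [set z | (forall v, exists! u, dom A u /\ A u - z *: u = v) /\
           continuous (resolvent A z)].

Definition spectrum (A : operator) : set R[i] := ~` resolvent_set A.

(* X is the everywhere defined operator A - B; for unbounded A and B this
   means that A = B + X with the same domain. *)
Definition is_difference (A B : operator) (X : H -> H) : Prop :=
  dom A = dom B /\ forall u, dom A u -> X u = A u - B u.

(* Null vectors are allowed in the sequence, so that a finite-dimensional
   space also has a basis indexed by nat. *)
Definition orthonormal_seq (e : nat -> H) : Prop :=
  forall i j, inner H (e i) (e j) = ((i == j) && (e i != 0))%:R.

Definition orthonormal_basis (e : nat -> H) : Prop :=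
  orthonormal_seq e /\ forall u, (forall n, inner H u (e n) = 0) -> u = 0.

(* A fixed orthonormal basis; the Hilbert-Schmidt norm, the trace and the
   determinant defined from it do not depend on the choice. *)
Definition hbasis : nat -> H := xget (fun=> 0) [set e | orthonormal_basis e].

Definition hs_norm2 (C : H -> H) : \bar R :=
  (\sum_(0 <= n <oo) ((complex.Re `|C (hbasis n)|) ^+ 2)%:E)%E.

Definition hilbert_schmidt (C : H -> H) : Prop :=
  [/\ linear C, continuous C & (hs_norm2 C < +oo)%E].

(* Singular value expansion C = \sum_n mu_n <., g_n> f_n, \sum_n mu_n < oo. *)
Definition trace_class (C : H -> H) : Prop :=
  exists (mu : nat -> R) (f g : nat -> H),
  [/\ forall n, 0 <= mu n,
      (\sum_(0 <= n <oo) (mu n)%:E < +oo)%E,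
      orthonormal_seq f, orthonormal_seq g
    & forall u,
        series (fun n => (real_complex R (mu n) * inner H u (g n)) *: f n)
          @ \oo --> C u].

Definition trace (C : H -> H) : R[i] :=
  limn (series (fun n => inner H (C (hbasis n)) (hbasis n)) : nat -> R[i]^o).

Definition principal_minor (C : H -> H) (N : nat) (S : {set 'I_N}) : R[i] :=
  \det (\matrix_(i < #|S|, j < #|S|)
          inner H (C (hbasis (enum_val j))) (hbasis (enum_val i))).

(* Tr (Lambda^k C): the diagonal matrix elements of Lambda^k C in the basis of
   the e_(i_1) /\ ... /\ e_(i_k), i_1 < ... < i_k, are the principal minors of
   order k. *)
Definition trace_exterior (C : H -> H) (k : nat) : R[i] :=
  limn ((fun N => \sum_(S : {set 'I_N} | #|S| == k) principal_minor C S)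
        : nat -> R[i]^o).

(* The Fredholm determinant det(I + C) = \sum_k Tr (Lambda^k C). *)
Definition det1p (C : H -> H) : R[i] :=
  limn (series (trace_exterior C) : nat -> R[i]^o).

Definition cexp (z : R[i]) : R[i] :=
  Complex (expR (complex.Re z) * cos (complex.Im z))
          (expR (complex.Re z) * sin (complex.Im z)).

Definition hs_nbhs (C : H -> H) : set_system (H -> H) :=
  filter_from [set eps : R | 0 < eps]
    (fun eps => [set D | (hs_norm2 (fun u => D u - C u)%R < (eps ^+ 2)%:E)%E]).

(* det_2(I + C): the extension by continuity, for the Hilbert-Schmidt norm, of
   det(I + C) e^(- Tr C) from the trace class to the Hilbert-Schmidt class. *)
Definition det2_1p (C : H -> H) : R[i] :=
  lim ((fun D => det1p D * cexp (- trace D) : R[i]^o)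
         @ within trace_class (hs_nbhs C)).

End Operators.

Definition cone (R : realType) (x c : R) : set R[i] :=
  [set z | 0 < complex.Im z /\ `|complex.Re z - x| < c * complex.Im z].

Definition nontangential_limit (R : realType) (F : R[i] -> R[i]) (x : R)
    (l : R[i]) : Prop :=
  forall c : R, 0 < c ->
    (F : R[i]^o -> R[i]^o) z
      @[z --> within (cone x c) (nbhs (real_complex R x : R[i]^o))]
      --> (l : R[i]^o).

(* Main.v *)
Require Import Defs.
From HB Require Import structures.
From mathcomp Require Import all_boot all_order all_algebra.
From mathcomp Require Import all_classical all_reals all_analysis.
From mathcomp Require Import complex sesquilinear spectral ring lra.

Set Implicit Arguments.
Unset Strict Implicit.
Unset Printing Implicit Defensive.

Import Order.TTheory GRing.Theory Num.Theory numFieldNormedType.Exports.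

Local Open Scope classical_set_scope.
Local Open Scope ring_scope.

(* On l^2, in the basis (e_n) that defines traces and determinants, take B, X
   and A = B + X diagonal with eigenvalues b_n, x_n and b_n + x_n. With
   w_n = x_n / (b_n - z), the function of the theorem is
   F z = \prod_n (1 + w_n) e^(-w_n).

   The eigenvalues come in stages. A stage consists of r copies of the grid of
   step 1/N in [0, 1], all moved by x = 1/(10 N). At z = p + i x over a grid
   point p, the factor of p has modulus |1 + i| = sqrt 2 and the other grid
   points reduce the product by a bounded factor close to 1, so that the stage
   contributes at least (5/4)^r, whereas its contribution r (N + 1) x^2 to the
   square of the Hilbert-Schmidt norm tends to 0 with 1/N. So r can be chosen to
   beat the product of the previous stages, which is bounded below as long as
   lambda stays away from their points, and then N can be chosen so that the
   stage does not affect the values of F considered before. The neighbourhoods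
   to be avoided have measure at most 2^-k at stage k, hence almost every lambda
   avoids them infinitely often, and F is unbounded in a cone at lambda.

   The modified determinant is a limit over all trace class operators D near
   C = X (B - z)^-1. For D with singular values mu_m, the sum of the moduli of
   all principal minors of its truncated matrix is at most e^(sum mu_m), by the
   Cauchy-Schwarz inequality |det Q|^2 <= det P det R for the blocks of a
   positive semidefinite matrix [[P, Q], [Q^*, R]]; hence
   det (I + D) e^(-Tr D) is the limit of its finite sections. In finite
   dimension, 1 + T = (1 + C)(1 + K) with K = (1 + C)^-1 (T - C), and det_2(1 + K)
   is close to 1 when the Hilbert-Schmidt norm of K is small, by triangularization. *)

(** * Principal minors and positive semidefinite matrices *)

Section PrincipalMinors.
Variable C : comNzRingType.

Lemma det_1D_mul m n (A : 'M[C]_(m, n)) (B : 'M[C]_(n, m)) :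
  \det (1%:M + A *m B) = \det (1%:M + B *m A).
Proof.
pose L := block_mx 1%:M A 0 (1%:M : 'M[C]_n) : 'M[C]_(m + n).
pose K := block_mx (1%:M : 'M[C]_m) (- A) B (1%:M : 'M[C]_n).
have detL : \det L = 1 by rewrite det_ublock !det1 mulr1.
have eKL : K *m L = block_mx 1%:M 0 B (1%:M + B *m A).
  rewrite mulmx_block !mulmx1 !mulmx0 !addr0 mul1mx subrr.
  by rewrite [B *m A + _]addrC.
have eLK : L *m K = block_mx (1%:M + A *m B) 0 B 1%:M.
  by rewrite mulmx_block !mul1mx !mulmx1 !mul0mx !add0r addNr.
have := det_mulmx K L; rewrite eKL det_lblock det1 mul1r => ->.
have := det_mulmx L K; rewrite eLK det_lblock det1 mulr1 => ->.
by rewrite mulrC.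
Qed.

Definition pminor n (M : 'M[C]_n) (S : {set 'I_n}) : C :=
  \det (mxsub (@enum_val _ (mem S)) (@enum_val _ (mem S)) M).

Definition selmx n (S : {set 'I_n}) : 'M[C]_(#|S|, n) :=
  \matrix_(a, i) ((enum_val a == i)%:R).

Lemma selmx_mul n p (S : {set 'I_n}) (M : 'M[C]_(n, p)) :
  selmx S *m M = rowsub (@enum_val _ (mem S)) M.
Proof.
apply/matrixP => a j; rewrite !mxE (bigD1 (enum_val a)) //= mxE eqxx mul1r.
by rewrite big1 ?addr0 // => i /negPf ni; rewrite mxE eq_sym ni mul0r.
Qed.

Lemma mul_selmx_tr n p (S : {set 'I_n}) (M : 'M[C]_(p, n)) :
  M *m (selmx S)^T = colsub (@enum_val _ (mem S)) M.
Proof.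
apply/matrixP => i a; rewrite !mxE (bigD1 (enum_val a)) //= !mxE eqxx mulr1.
by rewrite big1 ?addr0 // => j /negPf nj; rewrite !mxE eq_sym nj mulr0.
Qed.

Lemma pminorE n (M : 'M[C]_n) S :
  pminor M S = \det (selmx S *m M *m (selmx S)^T).
Proof.
rewrite selmx_mul mul_selmx_tr; congr (\det _).
by apply/matrixP => i j; rewrite !mxE.
Qed.

Lemma selmxK n (S : {set 'I_n}) : selmx S *m (selmx S)^T = 1%:M.
Proof.
rewrite mul_selmx_tr; apply/matrixP => i j; rewrite !mxE.
by rewrite (inj_eq enum_val_inj).
Qed.

Lemma tr_selmxK n (S : {set 'I_n}) (i j : 'I_n) :
  ((selmx S)^T *m selmx S) i j = ((i == j) && (i \in S))%:R.
Proof.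
rewrite mxE; case: (boolP (i \in S)) => iS; last first.
  rewrite andbF big1 // => a _; rewrite !mxE.
  case: eqP => [ai|]; last by rewrite mul0r.
  by have := enum_valP a; rewrite ai (negPf iS).
rewrite (bigD1 (enum_rank_in iS i)) //= !mxE enum_rankK_in // eqxx mul1r.
rewrite andbT big1 ?addr0 // => a na; rewrite !mxE.
case: eqP => [ai|]; last by rewrite mul0r.
by move: na; rewrite -{1}(enum_valK_in iS a) ai eqxx.
Qed.

(* Multilinearity in the rows reduces to the matrices whose rows outside S are
   those of the identity; such a matrix is 1 + J^T (J M - J) with J the
   selection matrix of S, and [det_1D_mul] turns its determinant into that of
   J M J^T. *)
Lemma det_1D_pminor n (M : 'M[C]_n) :
  \det (1%:M + M) = \sum_(S : {set 'I_n}) pminor M S.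
Proof.
have -> : \det (1%:M + M) = \sum_(S : {set 'I_n})
    \det (\matrix_(i, j) (if i \in S then M i j else (i == j)%:R)).
  rewrite /determinant exchange_big /=; apply: eq_bigr => s _.
  rewrite -big_distrr /=; congr (_ * _).
  under eq_bigr do rewrite !mxE addrC.
  rewrite bigA_distr; apply: eq_bigr => S _; apply: eq_bigr => i _.
  by rewrite !mxE; case: ifP.
apply: eq_bigr => S _; set J := selmx S.
have -> : \matrix_(i, j) (if i \in S then M i j else (i == j)%:R) =
    1%:M + J^T *m (J *m M - J).
  rewrite mulmxBr mulmxA; apply/matrixP => i j; rewrite !mxE.
  have -> : \sum_k (J^T *m J) i k * M k j = if i \in S then M i j else 0.
    rewrite (bigD1 i) //= tr_selmxK eqxx /= big1 ?addr0 => [|k /negPf ki].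
      by case: (i \in S); rewrite ?mul1r ?mul0r.
    by rewrite tr_selmxK eq_sym ki mul0r.
  have := tr_selmxK S i j; rewrite mxE => ->.
  case: (i \in S); last by rewrite andbF !subr0 addr0.
  by rewrite andbT addrCA subrr addr0.
by rewrite det_1D_mul mulmxBl selmxK addrC subrK pminorE.
Qed.

End PrincipalMinors.

Section Schur.
Variable C : numClosedFieldType.
Local Open Scope sesquilinear_scope.

Lemma sqnorm_rowE n (x : 'rV[C]_n) :
  (x *m x^t*) 0 0 = \sum_j `|x 0 j| ^+ 2.
Proof. by rewrite mxE; apply: eq_bigr => j _; rewrite !mxE normCK. Qed.

Lemma sqnorm_mxE m n (A : 'M[C]_(m, n)) :
  \tr (A *m A^t*) = \sum_i \sum_j `|A i j| ^+ 2.
Proof.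
rewrite /mxtrace; apply: eq_bigr => i _; rewrite mxE.
by apply: eq_bigr => j _; rewrite !mxE normCK.
Qed.

Lemma row_form n (U M : 'M[C]_n) i :
  (U *m M *m U^t*) i i = (row i U *m M *m (row i U)^t*) 0 0.
Proof.
rewrite -row_mul !mxE; apply: eq_bigr => k _.
by rewrite !mxE; congr (_ * _); rewrite mxE.
Qed.

Lemma schur_diag n (M : 'M[C]_n) : exists2 U : 'M[C]_n, U \is unitarymx &
  let T := U *m M *m U^t* in
  [/\ forall c, \det (c%:M - M) = \prod_i (c - T i i),
      \tr M = \sum_i T i i
    & \sum_i `|T i i| ^+ 2 <= \sum_i \sum_j `|M i j| ^+ 2].
Proof.
move: M; have [->|n_gt0] := posnP n => M.
  exists 1%:M; first by rewrite qualifE /= trmx1 map_mx1 mulmx1.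
  split; first by move=> c; rewrite det_mx00 big_ord0.
  - by rewrite /mxtrace !big_ord0.
  - by rewrite !big_ord0.
have [U Uu Ut] := Schur M n_gt0; exists U => //=.
set T := U *m M *m U^t*.
have UU : U *m U^t* = 1%:M by apply/unitarymxP.
have UU' : U^t* *m U = 1%:M by apply/mulmx1C.
have trigT : is_trig_mx T by move: Ut; rewrite /similar_to /= conjymx.
have trconj (A B : 'M[C]_n) : \tr (U *m A *m U^t*) = \tr A.
  by rewrite mxtrace_mulC mulmxA UU' mul1mx.
split.
- move=> c; have -> : \det (c%:M - M) = \det (c%:M - T).
    have -> : c%:M - T = U *m (c%:M - M) *m U^t*.
      by rewrite mulmxBr mulmxBl mul_mx_scalar -scalemxAl UU scalemx1.
    rewrite !det_mulmx mulrAC -det_mulmx UU det1 mul1r //.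
  rewrite det_trig; first by apply: eq_bigr => i _; rewrite 3!mxE eqxx.
  apply/is_trig_mxP => i j ij; rewrite [LHS]mxE [X in _ + X]mxE.
  rewrite (is_trig_mxP trigT) // [X in X - _]mxE subr0.
  by rewrite -val_eqE /= ltn_eqF.
- by rewrite -(trconj M 0).
have <- : \sum_i \sum_j `|T i j| ^+ 2 = \sum_i \sum_j `|M i j| ^+ 2.
  rewrite -!sqnorm_mxE -[RHS](trconj _ 0); congr (\tr _).
  rewrite /T !trmx_mul !map_mxM !mulmxA trmxCK.
  by rewrite -[U *m M *m _ *m U]mulmxA UU' mulmx1.
apply: ler_sum => i _; rewrite (bigD1 i) //= lerDl.
by apply: sumr_ge0 => j _; rewrite exprn_ge0.
Qed.

Lemma det_1D_schur n (M : 'M[C]_n) : exists t : 'I_n -> C,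
  [/\ \det (1%:M + M) = \prod_i (1 + t i), \tr M = \sum_i t i
    & \sum_i `|t i| ^+ 2 <= \sum_i \sum_j `|M i j| ^+ 2].
Proof.
have [U _ /= [dM tM sM]] := schur_diag M.
exists (fun i => (U *m M *m U^t*) i i); split => //.
have := dM (-1).
have -> : (-1)%:M - M = - (1%:M + M).
  by rewrite opprD; congr (_ - _); apply/matrixP => i j; rewrite !mxE mulNrn.
rewrite -scaleN1r detZ.
under eq_bigr do rewrite -opprD -mulN1r.
rewrite big_split /= prodr_const card_ord => /mulfI -> //.
by rewrite expf_neq0 // oppr_eq0 oner_eq0.
Qed.

Definition psdmx n (P : 'M[C]_n) :=
  forall x : 'rV_n, 0 <= (x *m P *m x^t*) 0 0.

Lemma det_1D_psd n (P : 'M[C]_n) : psdmx P -> exists t : 'I_n -> C,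
  [/\ forall i, 0 <= t i, \det (1%:M + P) = \prod_i (1 + t i)
    & \tr P = \sum_i t i].
Proof.
move=> psdP; have [U Uu /= [dM tM _]] := schur_diag P.
exists (fun i => (U *m P *m U^t*) i i); split => //.
  by move=> i; rewrite row_form.
have := dM (-1).
have -> : (-1)%:M - P = - (1%:M + P).
  by rewrite opprD; congr (_ - _); apply/matrixP => i j; rewrite !mxE mulNrn.
rewrite -scaleN1r detZ.
under eq_bigr do rewrite -opprD -mulN1r.
rewrite big_split /= prodr_const card_ord => /mulfI -> //.
by rewrite expf_neq0 // oppr_eq0 oner_eq0.
Qed.

Lemma det_schur n (M : 'M[C]_n) : exists t : 'I_n -> C,
  \det M = \prod_i t i /\
  forall i, exists2 v : 'rV_n, v != 0 & v *m M = t i *: v.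
Proof.
have [U Uu /= [dM _ _]] := schur_diag M.
exists (fun i => (U *m M *m U^t*) i i); split.
  have := dM 0.
  have -> : 0%:M - M = -1 *: M by rewrite raddf0 sub0r scaleN1r.
  rewrite detZ.
  under eq_bigr do rewrite sub0r -mulN1r.
  rewrite big_split /= prodr_const card_ord => /mulfI -> //.
  by rewrite expf_neq0 // oppr_eq0 oner_eq0.
move=> i; set t := (_ i i).
have /eqP/det0P[v v0 vM] : \det (t%:M - M) = 0.
  by rewrite dM (bigD1 i) //= subrr mul0r.
exists v => //; apply/esym/eqP; rewrite -subr_eq0 -mul_mx_scalar -mulmxBr.
exact/eqP.
Qed.

Lemma psdmx_det_ge0 n (P : 'M[C]_n) : psdmx P -> 0 <= \det P.
Proof.
move=> psdP; have [t [-> tP]] := det_schur P.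
apply: prodr_ge0 => i _; have [v v0 vP] := tP i.
have := psdP v; rewrite vP -scalemxAl mxE pmulr_lge0 // sqnorm_rowE.
rewrite lt_def sumr_ge0 ?andbT; last by move=> j _; rewrite exprn_ge0.
apply: contra v0 => /eqP/psumr_eq0P v0; apply/eqP/rowP => j; rewrite mxE.
by apply/eqP; rewrite -normr_eq0 -sqrf_eq0 v0 // => k _; rewrite exprn_ge0.
Qed.

(* Positive semidefiniteness of the block matrix [[P, Q], [Q^*, R]]. *)
Definition psdblock n (P Q R : 'M[C]_n) := forall x y : 'rV_n,
  0 <= (x *m P *m x^t*) 0 0 + (x *m Q *m y^t*) 0 0
       + (y *m Q^t* *m x^t*) 0 0 + (y *m R *m y^t*) 0 0.

Lemma psdblock_l n (P Q R : 'M[C]_n) : psdblock P Q R -> psdmx P.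
Proof.
move=> psd x; have := psd x 0.
by rewrite !mul0mx trmx0 map_mx0 mulmx0 !mxE !addr0.
Qed.

Lemma psdblock_r n (P Q R : 'M[C]_n) : psdblock P Q R -> psdmx R.
Proof.
move=> psd y; have := psd 0 y.
by rewrite !mul0mx trmx0 map_mx0 mulmx0 mxE !add0r.
Qed.

Lemma form_conj n (M : 'M[C]_n) (x y : 'rV_n) :
  (y *m M^t* *m x^t*) 0 0 = ((x *m M *m y^t*) 0 0)^*.
Proof.
have -> : y *m M^t* *m x^t* = (x *m M *m y^t*)^t*.
  by rewrite !trmx_mul !map_mxM trmxCK mulmxA.
by rewrite !mxE.
Qed.

(* Every eigenvalue of P Q^-* R Q^-1 is at least 1. *)
Lemma psdblock_det n (P Q R : 'M[C]_n) : psdblock P Q R ->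
  `|\det Q| ^+ 2 <= \det P * \det R.
Proof.
move=> psd.
have [Q0|Q0] := eqVneq (\det Q) 0.
  rewrite Q0 normr0 expr0n /= mulr_ge0 //; apply: psdmx_det_ge0.
    exact: psdblock_l psd.
  exact: psdblock_r psd.
have Qu : Q \in unitmx by rewrite unitmxE unitfE.
have Qsu : Q^t* \in unitmx.
  by rewrite unitmxE det_map_mx det_tr unitfE conjC_eq0.
pose N := P *m invmx (Q^t*) *m R *m invmx Q.
have detQs : \det (Q^t*) = (\det Q)^* by rewrite det_map_mx det_tr.
have detN : \det N * `|\det Q| ^+ 2 = \det P * \det R.
  rewrite /N !det_mulmx !det_inv detQs normCK.
  have Q0' : (\det Q)^* != 0 by rewrite conjC_eq0.
  by field; rewrite Q0 Q0'.
rewrite -detN ler_peMl ?exprn_ge0 //.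
have [t [-> tP]] := det_schur N.
apply: (big_ind (fun x => 1 <= x)) => [//|x1 x2 h1 h2|i _].
  exact: mulr_ege1.
have [v v0 vN] := tP i.
set y := v *m P *m invmx (Q^t*).
have yQ : y *m Q^t* = v *m P by rewrite mulmxKV.
have yR : y *m R = t i *: (v *m Q).
  rewrite scalemxAl -vN /N !mulmxA -/y mulmxKV //.
pose a := (v *m P *m v^t*) 0 0.
have a0 : 0 <= a by apply: (psdblock_l psd).
have vQy : (v *m Q *m y^t*) 0 0 = a.
  apply: (inv_inj (@conjCK C)); rewrite -form_conj yQ -/a.
  by apply/esym/CrealP; rewrite realE a0.
have {}a0 : 0 < a.
  rewrite lt_def a0 andbT; apply/eqP => aE.
  pose w := v *m Q; pose b := (w *m w^t*) 0 0; pose g := (w *m R *m w^t*) 0 0.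
  have g0 : 0 <= g by apply: (psdblock_r psd).
  have b0 : 0 < b.
    rewrite /b sqnorm_rowE lt_def sumr_ge0 ?andbT; last first.
      by move=> j _; rewrite exprn_ge0.
    apply: contra v0 => /eqP/psumr_eq0P w0.
    have : w = 0.
      apply/rowP => j; rewrite [RHS]mxE.
      by apply/eqP; rewrite -normr_eq0 -sqrf_eq0 w0 // => k _; rewrite exprn_ge0.
    by rewrite /w => /(congr1 (mulmx^~ (invmx Q))); rewrite mulmxK // mul0mx => ->.
  pose s := (g + 1) / (2 * b).
  have s0 : 0 <= s by rewrite divr_ge0 ?addr_ge0 ?mulr_ge0 // ltW.
  have sr : s^* = s by apply/CrealP; rewrite realE s0.
  have := psd (- s *: v) w.
  have Z00 c (M : 'M[C]_1) : (c *: M) 0 0 = c * M 0 0 by rewrite mxE.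
  have tZ c (u : 'rV[C]_n) : (c *: u)^t* = c^* *: u^t*.
    by apply/matrixP => k l; rewrite !mxE rmorphM.
  rewrite form_conj -!scalemxAl -/w tZ -scalemxAr.
  rewrite 3!Z00 -/a aE -/b -/g !mulr0 add0r.
  rewrite rmorphM rmorphN /= sr.
  have -> : b^* = b by apply/CrealP; rewrite realE ltW.
  have -> : - s * b + - s * b + g = -1.
    by rewrite /s; field; rewrite gt_eqF.
  by rewrite oppr_ge0 ler10.
have := psd (- v) y; rewrite form_conj.
have tN (u : 'rV[C]_n) : (- u)^t* = - u^t*.
  by apply/matrixP => k l; rewrite !mxE rmorphN.
rewrite !mulNmx tN mulmxN opprK.
have N00 (M : 'M[C]_1) : (- M) 0 0 = - M 0 0 by rewrite mxE.
have Z00 c (M : 'M[C]_1) : (c *: M) 0 0 = c * M 0 0 by rewrite mxE.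
rewrite N00 vQy -/a yR -scalemxAl Z00 vQy rmorphN /=.
have -> : a^* = a by apply/CrealP; rewrite realE ltW.
have -> : a - a - a + t i * a = (t i - 1) * a by ring.
by rewrite pmulr_lge0 // subr_ge0.
Qed.

Lemma psdblock_sub n (P Q R : 'M[C]_n) :
  psdblock P Q R -> forall S : {set 'I_n}, let J := selmx C S in
  psdblock (J *m P *m J^T) (J *m Q *m J^T) (J *m R *m J^T).
Proof.
move=> psd S J x y; have := psd (x *m J) (y *m J).
have JE : J ^ Num.conj = J.
  by apply/matrixP => i j; rewrite !mxE rmorph_nat.
have JTE : J^T ^ Num.conj = J^T by apply/matrixP => i j; rewrite !mxE rmorph_nat.
by rewrite !trmx_mul !map_mxM !trmxK !mulmxA JE !JTE.
Qed.

Lemma sum_norm_pminor n (P Q R : 'M[C]_n) : psdblock P Q R ->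
  \sum_(S : {set 'I_n}) `|pminor Q S|
    <= (\det (1%:M + P) + \det (1%:M + R)) / 2.
Proof.
move=> psd; rewrite !det_1D_pminor -big_split /= mulr_suml.
apply: ler_sum => S _; have psdS := @psdblock_sub _ _ _ _ psd S.
have := psdblock_det psdS; rewrite -!pminorE => le.
have p0 : 0 <= pminor P S by rewrite pminorE; apply/psdmx_det_ge0/psdblock_l/psdS.
have r0 : 0 <= pminor R S by rewrite pminorE; apply/psdmx_det_ge0/psdblock_r/psdS.
rewrite -(ler_pXn2r (_ : 0 < 2)%N) ?nnegrE ?divr_ge0 ?addr_ge0 //.
apply: le_trans le _; rewrite -subr_ge0.
set p := pminor P S in p0 *; set r := pminor R S in r0 *.
have -> : ((p + r) / 2) ^+ 2 - p * r = ((p - r) / 2) ^+ 2.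
  by field.
apply: real_exprn_even_ge0 => //.
by rewrite realM ?realV ?realB ?realn // realE ?p0 ?r0.
Qed.

End Schur.

(** * Complex moduli and limits *)

Section Modulus.
Context (R : realType).
Local Notation rc := (real_complex R).
Implicit Types (z w : R[i]) (x : R).

Definition cmod z : R := complex.Re `|z|.

Lemma cmodE z : `|z| = rc (cmod z).
Proof. by rewrite /cmod normc_def. Qed.

Lemma cmod_sqr z : cmod z ^+ 2 = complex.Re z ^+ 2 + complex.Im z ^+ 2.
Proof.
by rewrite /cmod normc_def /= sqr_sqrtr // addr_ge0 // sqr_ge0.
Qed.

Lemma cmod_ge0 z : 0 <= cmod z.
Proof. by rewrite -ler0c -cmodE. Qed.

Lemma cmodM z w : cmod (z * w) = cmod z * cmod w.
Proof. by apply: complexI; rewrite rmorphM /= -!cmodE normrM. Qed.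

Lemma cmodD z w : cmod (z + w) <= cmod z + cmod w.
Proof. by rewrite -lecR rmorphD /= -!cmodE ler_normD. Qed.

Lemma cmodN z : cmod (- z) = cmod z.
Proof. by apply: complexI; rewrite -!cmodE normrN. Qed.

Lemma cmodB z w : cmod (z - w) <= cmod z + cmod w.
Proof. by rewrite -(cmodN w) cmodD. Qed.

Lemma cmodC z w : cmod (z - w) = cmod (w - z).
Proof. by rewrite -opprB cmodN. Qed.

Lemma cmodBB z w : cmod z - cmod w <= cmod (z - w).
Proof. by rewrite lerBlDr (le_trans _ (cmodD _ _)) // subrK. Qed.

Lemma cmodV z : cmod z^-1 = (cmod z)^-1.
Proof. by apply: complexI; rewrite -!cmodE normfV cmodE fmorphV. Qed.

Lemma cmod0 : cmod 0 = 0 :> R.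
Proof. by apply: complexI; rewrite -cmodE normr0. Qed.

Lemma cmod1 : cmod 1 = 1 :> R.
Proof. by apply: complexI; rewrite -cmodE normr1. Qed.

Lemma cmod_eq0 z : (cmod z == 0) = (z == 0).
Proof. by rewrite -(inj_eq (@complexI _)) -cmodE normr_eq0. Qed.

Lemma cmod_gt0 z : (0 < cmod z) = (z != 0).
Proof. by rewrite lt_def cmod_ge0 andbT cmod_eq0. Qed.

Lemma cmod_rc x : cmod (rc x) = `|x|.
Proof. by rewrite /cmod normc_def /= expr0n /= addr0 sqrtr_sqr. Qed.

Lemma cmod_conj z : cmod z^* = cmod z.
Proof. by apply: complexI; rewrite -!cmodE norm_conjC. Qed.

Lemma cmod_sum I (r : seq I) (P : pred I) (F : I -> R[i]) :
  cmod (\sum_(i <- r | P i) F i) <= \sum_(i <- r | P i) cmod (F i).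
Proof.
elim/big_rec2: _ => [|i a b _ le]; first by rewrite cmod0.
by rewrite (le_trans (cmodD _ _)) // lerD2l.
Qed.

Lemma cmod_prod I (r : seq I) (P : pred I) (F : I -> R[i]) :
  cmod (\prod_(i <- r | P i) F i) = \prod_(i <- r | P i) cmod (F i).
Proof.
by elim/big_rec2: _ => [|i a b _ le]; rewrite ?cmod1 // cmodM le.
Qed.

Lemma Re_le_cmod z : `|complex.Re z| <= cmod z.
Proof. by rewrite -lecR -cmodE normc_ge_Re. Qed.

Lemma Im_le_cmod z : `|complex.Im z| <= cmod z.
Proof.
rewrite -(ler_pXn2r (_ : 0 < 2)%N) ?nnegrE ?cmod_ge0 //.
by rewrite real_normK ?num_real // cmod_sqr lerDr sqr_ge0.
Qed.

Lemma cmod_le_ReIm z : cmod z <= `|complex.Re z| + `|complex.Im z|.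
Proof.
rewrite {1}(complexE z) (le_trans (cmodD _ _)) // cmodM !cmod_rc.
rewrite lerD2l; have -> : cmod 'i%C = 1; last by rewrite mul1r.
by rewrite /cmod normc_def /= expr0n expr1n add0r sqrtr1.
Qed.

Lemma ReD z w : complex.Re (z + w) = complex.Re z + complex.Re w.
Proof. by case: z w => [? ?] [? ?]. Qed.

Lemma ltc_eq (e : R[i]) : 0 < e -> exists2 d : R, 0 < d & e = rc d.
Proof.
move=> e0; exists (complex.Re e); last first.
  by rewrite RRe_real // realE ltW.
by move: e0; rewrite ltcE => /andP[_].
Qed.

End Modulus.

Section Norm.
Context (R : realType) (V : normedModType R[i]).
Local Notation rc := (real_complex R).
Implicit Types (u v : V) (a : R[i]).

Definition nrm u : R := complex.Re `|u|.

Lemma nrmE u : `|u| = rc (nrm u).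
Proof. by rewrite /nrm RRe_real // realE normr_ge0. Qed.

Lemma nrm_ge0 u : 0 <= nrm u.
Proof. by rewrite -ler0c -nrmE. Qed.

Lemma nrmD u v : nrm (u + v) <= nrm u + nrm v.
Proof. by rewrite -lecR rmorphD /= -!nrmE ler_normD. Qed.

Lemma nrmN u : nrm (- u) = nrm u.
Proof. by apply: complexI; rewrite -!nrmE normrN. Qed.

Lemma nrmC u v : nrm (u - v) = nrm (v - u).
Proof. by rewrite -opprB nrmN. Qed.

Lemma nrmZ a u : nrm (a *: u) = cmod a * nrm u.
Proof. by apply: complexI; rewrite rmorphM /= -!nrmE -cmodE normrZ. Qed.

Lemma nrm0 : nrm 0 = 0.
Proof. by apply: complexI; rewrite -nrmE normr0. Qed.

Lemma nrm_eq0 u : (nrm u == 0) = (u == 0).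
Proof. by rewrite -(inj_eq (@complexI _)) -nrmE normr_eq0. Qed.

Lemma nrm_sum I (r : seq I) (P : pred I) (F : I -> V) :
  nrm (\sum_(i <- r | P i) F i) <= \sum_(i <- r | P i) nrm (F i).
Proof.
elim/big_rec2: _ => [|i a b _ le]; first by rewrite nrm0.
by rewrite (le_trans (nrmD _ _)) // lerD2l.
Qed.

Lemma cvg_nrmP T (F : set_system T) {FF : Filter F} (f : T -> V) (l : V) :
  f @ F --> l <-> forall d : R, 0 < d -> \forall t \near F, nrm (l - f t) < d.
Proof.
split=> [/cvgrPdist_lt fl d d0|fl].
  have := fl (rc d); rewrite ltcR => /(_ d0); apply: filterS => t.
  by rewrite nrmE ltcR.
apply/cvgrPdist_lt => e /ltc_eq[d d0 ->]; have := fl d d0.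
by apply: filterS => t; rewrite nrmE ltcR.
Qed.

Lemma nrm_continuous u : nrm x @[x --> u] --> nrm u.
Proof.
apply/cvgrPdist_lt => e e0.
have /cvg_nrmP/(_ e e0) : x @[x --> u] --> u by exact: cvg_id.
apply: filterS => x; apply: le_lt_trans.
have sub_le v w : nrm v - nrm w <= nrm (v - w).
  by rewrite lerBlDr (le_trans _ (nrmD _ _)) // subrK.
by rewrite ler_norml sub_le andbT lerNl opprB nrmC.
Qed.

End Norm.

Lemma cvg_cmodP (R : realType) T (F : set_system T) {FF : Filter F}
    (f : T -> R[i]) (l : R[i]) :
  (f : T -> R[i]^o) @ F --> (l : R[i]^o) <->
  forall d : R, 0 < d -> \forall t \near F, cmod (l - f t) < d.
Proof. exact: (@cvg_nrmP R R[i]^o). Qed.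

Lemma cvg_cmod (R : realType) T (F : set_system T) {FF : Filter F}
    (f : T -> R[i]) (l : R[i]) :
  (f : T -> R[i]^o) @ F --> (l : R[i]^o) -> cmod (f t) @[t --> F] --> cmod l.
Proof.
move=> fl; apply: (@cvg_comp _ _ _ (f : T -> R[i]^o) (@cmod R) F _ _ fl).
exact: (@nrm_continuous R R[i]^o).
Qed.

Lemma complex_cvg (R : realType) (u : nat -> R[i]) :
  cvgn (fun n => complex.Re (u n)) -> cvgn (fun n => complex.Im (u n)) ->
  cvgn (u : nat -> R[i]^o).
Proof.
move=> /cvg_ex[a ua] /cvg_ex[b ub]; apply/cvg_ex; exists (Complex a b).
apply/cvg_cmodP => d d0.
move/cvgrPdist_lt/(_ _ (divr_gt0 d0 (@ltr0n R 2))): ua => ua.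
move/cvgrPdist_lt/(_ _ (divr_gt0 d0 (@ltr0n R 2))): ub => ub.
near=> n; rewrite (le_lt_trans (cmod_le_ReIm _)) //.
rewrite [ltRHS](splitr d) ltrD //.
  have -> : complex.Re (Complex a b - u n) = a - complex.Re (u n).
    by case: (u n).
  by near: n.
have -> : complex.Im (Complex a b - u n) = b - complex.Im (u n).
  by case: (u n).
by near: n.
Unshelve. all: by end_near. Qed.

Lemma complex_cvg_dominated (R : realType) (u : nat -> R[i]) (A : nat -> R) :
  cvgn A -> (forall m n, (m <= n)%N -> cmod (u n - u m) <= A n - A m) ->
  cvgn (u : nat -> R[i]^o).
Proof.
move=> cA uA.
have ndA : nondecreasing_seq A.
  by move=> m n /uA le; rewrite -subr_ge0 (le_trans _ le) ?cmod_ge0.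
have leA n : A n <= limn A by apply: nondecreasing_cvgn_le.
have cau (f : R[i] -> R) : (forall z w, `|f z - f w| <= cmod (z - w)) ->
    cvgn (fun n => f (u n)).
  move=> fl; have fA m n : (m <= n)%N -> `|f (u n) - f (u m)| <= A n - A m.
    by move=> /uA; exact: le_trans.
  have -> : (fun n => f (u n)) = (A \+ (fun n => f (u n))) \- A.
    by apply/funext => n /=; rewrite addrAC subrr add0r.
  apply: is_cvgB => //; apply: nondecreasing_is_cvgn.
    move=> m n mn /=; have := fA _ _ mn; rewrite ler_norml => /andP[+ _].
    by lra.
  exists (limn A + (f (u 0%N) + (limn A - A 0%N))) => _ [n _ <-] /=.
  have := fA 0%N n (leq0n n); rewrite ler_norml => /andP[_].
  by have := leA n; lra.
apply: complex_cvg; apply: cau => z w.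
  by have := Re_le_cmod (z - w); case: z w => [? ?] [? ?].
by have := Im_le_cmod (z - w); case: z w => [? ?] [? ?].
Qed.

Section ComplexLimits.
Context (R : realType) (T : Type) (F : set_system T) {FF : Filter F}.
Implicit Types (f g : T -> R[i]) (a b : R[i]).

Lemma cvgcD f g a b :
  (f : T -> R[i]^o) @ F --> (a : R[i]^o) ->
  (g : T -> R[i]^o) @ F --> (b : R[i]^o) ->
  ((fun t => f t + g t) : T -> R[i]^o) @ F --> (a + b : R[i]^o).
Proof. exact: (@cvgD R[i] R[i]^o T F FF f g a b). Qed.

Lemma cvgcN f a :
  (f : T -> R[i]^o) @ F --> (a : R[i]^o) ->
  ((fun t => - f t) : T -> R[i]^o) @ F --> (- a : R[i]^o).
Proof. exact: (@cvgN R[i] R[i]^o T F FF f a). Qed.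

Lemma cvgcB f g a b :
  (f : T -> R[i]^o) @ F --> (a : R[i]^o) ->
  (g : T -> R[i]^o) @ F --> (b : R[i]^o) ->
  ((fun t => f t - g t) : T -> R[i]^o) @ F --> (a - b : R[i]^o).
Proof. exact: (@cvgB R[i] R[i]^o T F FF f g a b). Qed.

Lemma cvgcM f g a b :
  (f : T -> R[i]^o) @ F --> (a : R[i]^o) ->
  (g : T -> R[i]^o) @ F --> (b : R[i]^o) ->
  ((fun t => f t * g t) : T -> R[i]^o) @ F --> (a * b : R[i]^o).
Proof. exact: (@cvgM R[i] T F FF f g a b). Qed.

Lemma cvgc_cst a : ((fun=> a) : T -> R[i]^o) @ F --> (a : R[i]^o).
Proof. exact: (@cvg_cst R[i]^o). Qed.

Lemma cvgc_sum I (r : seq I) (h : I -> T -> R[i]) (l : I -> R[i]) :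
  (forall k, (h k : T -> R[i]^o) @ F --> (l k : R[i]^o)) ->
  ((fun t => \sum_(k <- r) h k t) : T -> R[i]^o) @ F
    --> (\sum_(k <- r) l k : R[i]^o).
Proof.
move=> hl; elim: r => [|k r IH].
  rewrite big_nil; have -> : (fun t => \sum_(k <- [::]) h k t) = (fun=> 0).
    by apply/funext => t; rewrite big_nil.
  exact: cvgc_cst.
rewrite big_cons; have -> : (fun t => \sum_(j <- k :: r) h j t) =
    (fun t => h k t + \sum_(j <- r) h j t).
  by apply/funext => t; rewrite big_cons.
exact: (cvgcD (hl k) IH).
Qed.

End ComplexLimits.
Arguments cvgc_cst {R T F FF} a.

Lemma cvgc_unique (R : realType) T (F : set_system T) {FF : ProperFilter F}
    (f : T -> R[i]) (a b : R[i]) :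
  (f : T -> R[i]^o) @ F --> (a : R[i]^o) ->
  (f : T -> R[i]^o) @ F --> (b : R[i]^o) -> a = b.
Proof. exact: (cvg_unique (@norm_hausdorff _ R[i]^o)). Qed.

(** * Finite sections of an infinite matrix *)

Section NestedMinors.
Context (R : realType).
Variable d : nat -> nat -> R[i].

Definition trunc_mx N : 'M[R[i]]_N := \matrix_(i, j) d i j.

Definition seq_minor (s : seq nat) : R[i] :=
  \det (\matrix_(i < size s, j < size s) d (nth 0 s i) (nth 0 s j)).

Definition set_seq N (S : {set 'I_N}) : seq nat := map val (enum S).

Lemma pminor_seq N (S : {set 'I_N}) :
  pminor (trunc_mx N) S = seq_minor (set_seq S).
Proof.
rewrite /pminor /seq_minor; set s := set_seq S.
have es : #|S| = size s by rewrite size_map -cardE.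
have castE m n (f : nat -> nat -> R[i]) : m = n ->
    \det (\matrix_(i < m, j < m) f i j) = \det (\matrix_(i < n, j < n) f i j).
  by move=> ->.
rewrite -(castE _ _ (fun i j => d (nth 0 s i) (nth 0 s j)) es).
congr (\det _); apply/matrixP => i j; rewrite !mxE.
have nthE (k : 'I_#|S|) : nth 0%N s k = enum_val k.
  have lt : (k < size (enum S))%N by rewrite -cardE.
  by rewrite (nth_map (enum_val k)) // -enum_val_nth.
by rewrite !nthE.
Qed.

Lemma set_seq_sorted N (S : {set 'I_N}) : sorted ltn (set_seq S).
Proof.
rewrite (@subseq_sorted _ _ ltn_trans _ (map val (enum 'I_N))) //.
  apply: map_subseq; rewrite [X in subseq _ X]enumT; exact: filter_subseq.
by rewrite val_enum_ord iota_ltn_sorted.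
Qed.

Lemma set_seq_widen N (S : {set 'I_N}) :
  set_seq (widen_ord (leqnSn N) @: S) = set_seq S.
Proof.
apply: (irr_sorted_eq ltn_trans ltnn); rewrite ?set_seq_sorted // => k.
apply/mapP/mapP => -[j]; rewrite mem_enum => jS ->.
  case/imsetP: jS => l lS ->; exists l => //.
  by rewrite mem_enum.
by exists (widen_ord (leqnSn N) j) => //; rewrite mem_enum imset_f.
Qed.

Lemma big_set_ordS (V : nmodType) N (phi : seq nat -> V) :
  \sum_(S : {set 'I_N.+1}) phi (set_seq S) =
  \sum_(S : {set 'I_N}) phi (set_seq S) +
  \sum_(S : {set 'I_N.+1} | ord_max \in S) phi (set_seq S).
Proof.
rewrite (bigID (fun S : {set 'I_N.+1} => ord_max \in S)) /= addrC; congr (_ + _).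
set f := widen_ord (leqnSn N).
have f_inj : injective f by move=> i j /(congr1 val) /= /val_inj.
have f_max i : f i != ord_max by rewrite -val_eqE /= ltn_eqF.
rewrite (reindex_onto (fun S : {set 'I_N} => f @: S) (fun T => f @^-1: T)) /=.
  apply: eq_big => S; last by rewrite set_seq_widen.
  have -> : ord_max \notin f @: S.
    by apply/imsetP => -[i _ /eqP]; rewrite eq_sym (negPf (f_max i)).
  apply/eqP/setP => i; rewrite inE; apply/imsetP/idP => [[j jS /f_inj ->] //|iS].
  by exists i.
move=> T maxT; apply/setP => i; apply/imsetP/idP => [[j]|iT].
  by rewrite inE => jT ->.
have iN : (i < N)%N.
  rewrite ltn_neqAle -ltnS ltn_ord andbT; apply: contra maxT => /eqP iN.
  by have -> : ord_max = i by apply: val_inj; rewrite /= iN.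
exists (Ordinal iN); last exact: val_inj.
by rewrite inE; have -> : f (Ordinal iN) = i by exact: val_inj.
Qed.

Definition abs_minors N : R :=
  \sum_(S : {set 'I_N}) cmod (pminor (trunc_mx N) S).

Definition minors_of_order k N : R[i] :=
  \sum_(S : {set 'I_N} | #|S| == k) pminor (trunc_mx N) S.

Let ordk k s := if size s == k then seq_minor s else 0.

Lemma minors_of_orderE k N :
  minors_of_order k N = \sum_(S : {set 'I_N}) ordk k (set_seq S).
Proof.
rewrite /minors_of_order big_mkcond; apply: eq_bigr => S _.
by rewrite /ordk size_map -cardE pminor_seq.
Qed.

Lemma abs_minorsE N :
  abs_minors N = \sum_(S : {set 'I_N}) cmod (seq_minor (set_seq S)).
Proof. by apply: eq_bigr => S _; rewrite pminor_seq. Qed.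

Lemma minors_of_order_diff K m n : (m <= n)%N ->
  \sum_(k < K) cmod (minors_of_order k n - minors_of_order k m)
    <= abs_minors n - abs_minors m.
Proof.
have refl i : \sum_(k < K) cmod (minors_of_order k i - minors_of_order k i)
    <= abs_minors i - abs_minors i.
  by rewrite subrr big1 // => k _; rewrite subrr cmod0.
elim: n => [|n IH]; first by rewrite leqn0 => /eqP ->.
rewrite leq_eqVlt => /predU1P[->|]; first exact: refl.
rewrite ltnS => /IH {}IH.
have -> : abs_minors n.+1 - abs_minors m =
    (abs_minors n.+1 - abs_minors n) + (abs_minors n - abs_minors m).
  by rewrite addrA subrK.
have step : \sum_(k < K) cmod (minors_of_order k n.+1 - minors_of_order k n)
    <= abs_minors n.+1 - abs_minors n.
  rewrite !abs_minorsE (big_set_ordS n (fun s => cmod (seq_minor s))) addrAC subrr add0r.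
  apply: le_trans (_ : \sum_(k < K) \sum_(S : {set 'I_n.+1} | ord_max \in S)
      cmod (ordk k (set_seq S)) <= _).
    apply: ler_sum => k _; rewrite !minors_of_orderE (big_set_ordS n (ordk k)) addrAC subrr.
    by rewrite add0r cmod_sum.
  rewrite exchange_big /=; apply: ler_sum => S _.
  case: (ltnP (size (set_seq S)) K) => szK.
    rewrite (bigD1 (Ordinal szK)) //= /ordk eqxx big1 ?addr0 // => k.
    by rewrite -val_eqE /= eq_sym => /negPf ->; rewrite cmod0.
  rewrite big1 ?cmod_ge0 // => k _; rewrite /ordk.
  by rewrite gtn_eqF ?cmod0 // (leq_trans _ szK).
apply: le_trans (lerD step IH); rewrite -big_split /=; apply: ler_sum => k _.
by rewrite (le_trans _ (cmodD _ _)) // addrA subrK.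
Qed.

Lemma det_1D_trunc K N : (N < K)%N ->
  \det (1%:M + trunc_mx N) = \sum_(k < K) minors_of_order k N.
Proof.
move=> NK; rewrite det_1D_pminor /minors_of_order.
rewrite (exchange_big_dep xpredT) //=; apply: eq_bigr => S _.
have SK : (#|S| < K)%N.
  by rewrite (leq_ltn_trans _ NK) // -[leqRHS]card_ord max_card.
by rewrite (big_pred1 (Ordinal SK)) // => k; rewrite -val_eqE /= eq_sym.
Qed.

Lemma abs_minors_cvg (K : R) : (forall N, abs_minors N <= K) -> cvgn abs_minors.
Proof.
move=> absK; apply: nondecreasing_is_cvgn; last by exists K => _ [n _ <-].
move=> m n /(minors_of_order_diff 0); rewrite big_ord0.
by rewrite subr_ge0.
Qed.

Lemma minors_of_order_cvg k (K : R) : (forall N, abs_minors N <= K) ->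
  cvgn (minors_of_order k : nat -> R[i]^o).
Proof.
move=> /abs_minors_cvg cA.
apply: complex_cvg_dominated cA _ => m n /(minors_of_order_diff k.+1).
rewrite big_ord_recr /= => /(le_trans _); apply.
by rewrite lerDr sumr_ge0 // => j _; rewrite cmod_ge0.
Qed.

Lemma minors_of_order1 N : minors_of_order 1 N = \sum_(k < N) d k k.
Proof.
rewrite /minors_of_order (big_cards1 _ (pminor (trunc_mx N))).
apply: eq_bigr => k _; rewrite pminor_seq /set_seq enum_set1.
by rewrite /seq_minor det_mx11 mxE.
Qed.

(* Tannery's theorem for the expansion of det(1 + M_N) by order of minors. *)
Lemma det_1D_trunc_cvg (K : R) : (forall N, abs_minors N <= K) ->
  exists2 L : R[i],
    ((fun N => \det (1%:M + trunc_mx N)) : nat -> R[i]^o) @ \oo --> (L : R[i]^o) &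
    (series (fun k => limn (minors_of_order k : nat -> R[i]^o)) : nat -> R[i]^o)
      @ \oo --> (L : R[i]^o).
Proof.
move=> absK.
have cA := abs_minors_cvg absK.
have cE k := @minors_of_order_cvg k _ absK.
have dd m n : (m <= n)%N ->
    cmod (\det (1%:M + trunc_mx n) - \det (1%:M + trunc_mx m))
      <= abs_minors n - abs_minors m.
  move=> mn; apply: le_trans (minors_of_order_diff n.+1 mn).
  by rewrite !(@det_1D_trunc n.+1) ?ltnS // -sumrB cmod_sum.
have cD := complex_cvg_dominated cA dd.
exists (limn ((fun N => \det (1%:M + trunc_mx N)) : nat -> R[i]^o)) => //.
set L := limn _; pose te k := limn (minors_of_order k : nat -> R[i]^o).
pose Ai := limn abs_minors.
have lim_cmod (u : nat -> R[i]) (l b : R[i]) (m : nat) (c : R) :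
    (u : nat -> R[i]^o) @ \oo --> (l : R[i]^o) ->
    (forall n, (m <= n)%N -> cmod (u n - b) <= abs_minors n - c) ->
    cmod (l - b) <= Ai - c.
  move=> ul ub.
  have h1 : (fun n => cmod (u n - b)) @ \oo --> cmod (l - b).
    exact: cvg_cmod (cvgcB ul (cvgc_cst b)).
  have h2 : (fun n => abs_minors n - c) @ \oo --> Ai - c.
    by apply: cvgB => //; exact: cvg_cst.
  apply: (ler_cvg_to h1 h2); near=> n; apply: ub; near: n.
  exact: nbhs_infty_ge.
have teB m k : (m < k)%N ->
    cmod (series te k - \det (1%:M + trunc_mx m)) <= Ai - abs_minors m.
  move=> mk; apply: (lim_cmod (fun n => \sum_(0 <= j < k) minors_of_order j n) _ _ m).
    have -> : series te k = \sum_(0 <= j < k) te j by [].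
    by apply: (cvgc_sum _ (h := fun j => minors_of_order j)) => j; exact: cE.
  move=> n mn; rewrite big_mkord (@det_1D_trunc k) // -sumrB.
  exact: le_trans (cmod_sum _ _ _) (minors_of_order_diff _ mn).
have LB m : cmod (L - \det (1%:M + trunc_mx m)) <= Ai - abs_minors m.
  by apply: lim_cmod (cD) _ => n; exact: dd.
apply/cvg_cmodP => e e0.
have /cvgrPdist_lt/(_ _ (divr_gt0 e0 (@ltr0n R 2))) := cA.
move=> [m _ mA]; exists m.+1 => //= k mk.
have {mA} := mA m (leqnn m); rewrite -/Ai => Am.
have -> : L - series te k = (L - \det (1%:M + trunc_mx m))
    - (series te k - \det (1%:M + trunc_mx m)).
  by rewrite opprB addrA subrK.
rewrite (le_lt_trans (cmodB _ _)) // [ltRHS]splitr.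
rewrite (le_lt_trans (lerD (LB m) (teB m k mk))) //.
by move: Am; rewrite ltr_norml => /andP[_]; lra.
Unshelve. all: by end_near. Qed.

End NestedMinors.

(** * Hilbert spaces *)

Lemma cauchy_dominated (R : realType) (V : completeNormedModType R[i])
    (s : nat -> V) (A : nat -> R) :
  cvgn A -> (forall m n, (m <= n)%N -> nrm (s n - s m) ^+ 2 <= A n - A m) ->
  cvgn s.
Proof.
move=> cA sA; apply: cauchy_cvg; apply: cauchy_exP => eps /ltc_eq[e e0 ->].
have /cvgrPdist_lt/(_ _ (exprn_gt0 2 (divr_gt0 e0 (@ltr0n R 2)))) := cA.
move=> [m _ mA]; exists (s m); exists m => //= n mn.
rewrite -ball_normE /= nrmE ltcR nrmC.
rewrite -(ltr_pXn2r (_ : 0 < 2)%N) ?nnegrE ?nrm_ge0 ?ltW //.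
apply: le_lt_trans (sA _ _ mn) _.
have := mA m (leqnn m); have := mA n mn => /=.
rewrite !ltr_norml => /andP[h1 h2] /andP[h3 h4].
apply: lt_le_trans (_ : (e / 2) ^+ 2 + (e / 2) ^+ 2 <= _); first by lra.
rewrite [in leRHS](splitr e); have := sqr_ge0 (e / 2); nra.
Qed.

Section Hilbert.
Context (R : realType) (H : hilbert_space R).
Local Notation rc := (real_complex R).
Local Notation "<< u , v >>" := (inner H u v).
Implicit Types (u v w : H) (a : R[i]).

Lemma inD u v w : <<u + v, w>> = <<u, w>> + <<v, w>>.
Proof. exact: linearDl. Qed.

Lemma inZ a u w : <<a *: u, w>> = a * <<u, w>>.
Proof. exact: linearZl_LR. Qed.

Lemma inN u w : <<- u, w>> = - <<u, w>>.
Proof. exact: linearNl. Qed.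

Lemma inB u v w : <<u - v, w>> = <<u, w>> - <<v, w>>.
Proof. by rewrite inD inN. Qed.

Lemma in0 w : <<0, w>> = 0.
Proof. exact: linear0l. Qed.

Lemma in_conj u v : <<u, v>> = (<<v, u>>)^*.
Proof. by rewrite hermC /= expr0 mul1r. Qed.

Lemma in_sum I (r : seq I) (P : pred I) (F : I -> H) w :
  <<\sum_(i <- r | P i) F i, w>> = \sum_(i <- r | P i) <<F i, w>>.
Proof. by elim/big_rec2: _ => [|i a b _ <-]; rewrite ?in0 // inD. Qed.

Lemma inDr u v w : <<w, u + v>> = <<w, u>> + <<w, v>>.
Proof. by rewrite in_conj inD rmorphD /= -!in_conj. Qed.

Lemma inBr u v w : <<w, u - v>> = <<w, u>> - <<w, v>>.
Proof. by rewrite in_conj inB rmorphB /= -!in_conj. Qed.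

Lemma inZr a u w : <<w, a *: u>> = a^* * <<w, u>>.
Proof. by rewrite in_conj inZ rmorphM /= -in_conj. Qed.

Lemma in0r w : <<w, 0>> = 0.
Proof. by rewrite in_conj in0 rmorph0. Qed.

Lemma in_sumr I (r : seq I) (P : pred I) (F : I -> H) w :
  <<w, \sum_(i <- r | P i) F i>> = \sum_(i <- r | P i) <<w, F i>>.
Proof. by elim/big_rec2: _ => [|i a b _ <-]; rewrite ?in0r // inDr. Qed.

Lemma in_sqr u : <<u, u>> = rc (nrm u ^+ 2).
Proof. by rewrite inner_norm nrmE rmorphXn. Qed.

Lemma mul_conj_sqr a : a * a^* = rc (cmod a ^+ 2).
Proof. by rewrite -normCK cmodE rmorphXn. Qed.

Lemma conj_rc (x : R) : (rc x)^* = rc x.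
Proof. by apply: conj_Creal; rewrite /= complex_real. Qed.

Lemma cauchy_schwarz u v : cmod <<u, v>> <= nrm u * nrm v.
Proof.
have [->|v0] := eqVneq v 0; first by rewrite in0r cmod0 nrm0 mulr0.
have nv0 : 0 < nrm v by rewrite lt_def nrm_eq0 v0 nrm_ge0.
rewrite -(ler_pXn2r (_ : 0 < 2)%N) ?nnegrE ?cmod_ge0 ?mulr_ge0 ?nrm_ge0 //.
pose w := <<v, v>> *: u - <<u, v>> *: v.
have wE : <<w, w>> = rc (nrm v ^+ 2 * ((nrm u * nrm v) ^+ 2 - cmod <<u, v>> ^+ 2)).
  have wu : <<w, u>> = rc (nrm v ^+ 2) * rc (nrm u ^+ 2) - rc (cmod <<u, v>> ^+ 2).
    by rewrite inB !inZ !in_sqr [<<v, u>>]in_conj mul_conj_sqr.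
  have wv : <<w, v>> = 0 by rewrite inB !inZ mulrC subrr.
  rewrite {2}/w inBr !inZr wu wv mulr0 subr0 in_sqr conj_rc.
  by rewrite -rmorphM -rmorphB -rmorphM /= exprMn [_ ^+ 2 * nrm v ^+ 2]mulrC.
have := sqr_ge0 (nrm w); rewrite -ler0c -in_sqr wE ler0c pmulr_rge0 ?exprn_gt0 //.
by rewrite subr_ge0.
Qed.

Lemma in_cvg T (F : set_system T) {FF : Filter F} (f : T -> H) u v :
  f @ F --> u -> ((fun t => <<f t, v>>) : T -> R[i]^o) @ F --> (<<u, v>> : R[i]^o).
Proof.
move=> /cvg_nrmP fu; apply/cvg_cmodP => e e0.
have v1 : 0 < nrm v + 1 by rewrite ltr_wpDl ?nrm_ge0.
have := fu (e / (nrm v + 1)); rewrite divr_gt0 // => /(_ isT).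
apply: filterS => t; rewrite ltr_pdivlMr // => lt.
rewrite -inB (le_lt_trans (cauchy_schwarz _ _)) // (le_lt_trans _ lt) //.
by rewrite ler_wpM2l ?nrm_ge0 // lerDl.
Qed.

Section Orthonormal.
Variable e : nat -> H.
Hypothesis eo : orthonormal_seq e.

Definition nonnull n : R[i] := (e n != 0)%:R.

Lemma eo_diag n : <<e n, e n>> = nonnull n.
Proof. by rewrite eo eqxx. Qed.

Lemma eo_off m n : m != n -> <<e m, e n>> = 0.
Proof. by rewrite eo => /negPf ->. Qed.

Lemma in_nonnull u n : <<u, e n>> * nonnull n = <<u, e n>>.
Proof.
rewrite /nonnull; case: eqP => [->|_]; last by rewrite mulr1.
by rewrite in0r mul0r.
Qed.

Lemma coef_sum (a : nat -> R[i]) (r : seq nat) m : uniq r ->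
  <<\sum_(n <- r) a n *: e n, e m>> = (m \in r)%:R * a m * nonnull m.
Proof.
move=> ur; rewrite in_sum; have [mr|mr] := boolP (m \in r).
  rewrite (bigD1_seq m) //= inZ eo_diag big1 ?addr0 ?mul1r // => n nm.
  by rewrite inZ eo_off ?mulr0.
rewrite !mul0r big1_seq // => n /andP[_ nr]; rewrite inZ eo_off ?mulr0 //.
by apply: contraNneq mr => <-.
Qed.

Lemma nrm_sum_sqr (a : nat -> R[i]) (r : seq nat) : uniq r ->
  nrm (\sum_(n <- r) a n *: e n) ^+ 2 <= \sum_(n <- r) cmod (a n) ^+ 2.
Proof.
move=> ur; rewrite -lecR -in_sqr in_sumr rmorph_sum /= big_seq [leRHS]big_seq.
apply: ler_sum => n nr; rewrite inZr coef_sum // nr mul1r mulrA.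
rewrite [_^* * _]mulrC mul_conj_sqr /nonnull.
by case: (e n != 0); rewrite ?mulr1 // mulr0 ler0c sqr_ge0.
Qed.

Lemma bessel_seq u (r : seq nat) : uniq r ->
  \sum_(n <- r) cmod <<u, e n>> ^+ 2 <= nrm u ^+ 2.
Proof.
move=> ur; set w := \sum_(n <- r) <<u, e n>> *: e n.
set s := \sum_(n <- r) _.
have uw : <<u, w>> = rc s.
  rewrite in_sumr rmorph_sum /=; apply: eq_bigr => n _.
  by rewrite inZr mulrC mul_conj_sqr.
have ww : <<w, w>> = rc s.
  rewrite {2}/w in_sumr rmorph_sum /= !big_seq; apply: eq_bigr => n nr.
  rewrite inZr coef_sum // nr mul1r in_nonnull mulrC.
  by rewrite mul_conj_sqr.
have wu : <<w, u>> = rc s by rewrite in_conj uw conj_rc.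
have := sqr_ge0 (nrm (u - w)); rewrite -ler0c -in_sqr inB !inBr uw ww wu in_sqr.
by rewrite subrr subr0 -rmorphB ler0c subr_ge0.
Qed.

Lemma bessel u N : \sum_(n < N) cmod <<u, e n>> ^+ 2 <= nrm u ^+ 2.
Proof.
rewrite -(big_mkord xpredT (fun n => cmod <<u, e n>> ^+ 2)).
by rewrite bessel_seq // iota_uniq.
Qed.

Definition square_summable (a : nat -> R[i]) :=
  exists K : R, forall N, \sum_(n < N) cmod (a n) ^+ 2 <= K.

Lemma riesz_fischer (a : nat -> R[i]) : square_summable a ->
  cvgn (series (fun n => a n *: e n)).
Proof.
move=> [K aK]; pose A N := \sum_(0 <= n < N) cmod (a n) ^+ 2.
have dA m n : (m <= n)%N -> A n - A m = \sum_(m <= k < n) cmod (a k) ^+ 2.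
  by move=> mn; rewrite /A (big_cat_nat (leq0n m) mn) //= addrAC subrr add0r.
apply: (@cauchy_dominated _ _ _ A).
  apply: nondecreasing_is_cvgn.
    move=> m n mn; rewrite -subr_ge0 dA //; apply: sumr_ge0 => k _.
    exact: sqr_ge0.
  by exists K => _ [n _ <-]; rewrite /A big_mkord.
move=> m n mn; rewrite dA // /series /= (big_cat_nat (leq0n m) mn) //= addrAC subrr add0r.
by rewrite nrm_sum_sqr // iota_uniq.
Qed.

Definition mkvec (a : nat -> R[i]) : H := limn (series (fun n => a n *: e n)).

Lemma coef_mkvec (a : nat -> R[i]) m : square_summable a -> <<mkvec a, e m>> = a m * nonnull m.
Proof.
move=> sa.
have c : ((fun n => <<series (fun k => a k *: e k) n, e m>>) : nat -> R[i]^o) @ \oo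
    --> (<<mkvec a, e m>> : R[i]^o) by exact: in_cvg (riesz_fischer sa).
have c' : ((fun n => <<series (fun k => a k *: e k) n, e m>>) : nat -> R[i]^o) @ \oo
    --> (a m * nonnull m : R[i]^o).
  apply/cvg_cmodP => d d0; exists m.+1 => // n /= mn.
  rewrite coef_sum ?iota_uniq // mem_index_iota mn mul1r subrr cmod0 //.
exact: (cvgc_unique c c').
Qed.

Lemma nrm_mkvec (a : nat -> R[i]) (K : R) : 0 <= K ->
  (forall N, \sum_(n < N) cmod (a n) ^+ 2 <= K ^+ 2) -> nrm (mkvec a) <= K.
Proof.
move=> K0 aK; have sa : square_summable a by exists (K ^+ 2).
have c := cvg_comp _ _ (riesz_fischer sa) (@nrm_continuous _ _ _).
apply: (cvgr_to_le c); near=> N; rewrite /= -(ler_pXn2r (_ : 0 < 2)%N) ?nnegrE ?nrm_ge0 //.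
apply: le_trans (aK N); rewrite -(big_mkord xpredT (fun n => cmod (a n) ^+ 2)).
by rewrite nrm_sum_sqr // iota_uniq.
Unshelve. all: by end_near. Qed.

End Orthonormal.
End Hilbert.

(** * Diagonal operators *)

Section Diagonal.
Context (R : realType) (H : hilbert_space R) (e : nat -> H).
Hypothesis eb : orthonormal_basis e.
Local Notation rc := (real_complex R).
Local Notation "<< u , v >>" := (inner H u v).
Implicit Types (u v w : H) (a : R[i]) (d : nat -> R[i]) (M : R).

Let eo : orthonormal_seq e := eb.1.

Lemma hilb_ext u v : (forall n, <<u, e n>> = <<v, e n>>) -> u = v.
Proof.
by move=> uv; apply/eqP; rewrite -subr_eq0; apply/eqP/eb.2 => n; rewrite inB uv subrr.
Qed.

Lemma square_summable_diag d M u : (forall n, cmod (d n) <= M) ->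
  forall N, \sum_(n < N) cmod (d n * <<u, e n>>) ^+ 2 <= (M * nrm u) ^+ 2.
Proof.
move=> dM N; have M0 : 0 <= M by rewrite (le_trans (cmod_ge0 _) (dM 0)).
rewrite exprMn (le_trans _ (ler_wpM2l (sqr_ge0 M) (bessel eo u N))) // mulr_sumr.
apply: ler_sum => n _; rewrite cmodM exprMn ler_wpM2r ?sqr_ge0 //.
by rewrite ler_pXn2r ?nnegrE ?cmod_ge0.
Qed.

Lemma expansion u : series (fun n => <<u, e n>> *: e n) @ \oo --> u.
Proof.
have sa : square_summable (fun n => <<u, e n>>).
  by exists (nrm u ^+ 2) => N; exact: bessel.
have uE : u = mkvec e (fun n => <<u, e n>>).
  by apply: hilb_ext => n; rewrite coef_mkvec // in_nonnull.
by rewrite [X in _ --> X]uE; exact: riesz_fischer.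
Qed.

Lemma in_expansion u v :
  (series (fun n => <<u, e n>> * (<<v, e n>>)^*) : nat -> R[i]^o) @ \oo
    --> (<<u, v>> : R[i]^o).
Proof.
have -> : series (fun n => <<u, e n>> * (<<v, e n>>)^*) =
    (fun N => <<series (fun n => <<u, e n>> *: e n) N, v>>).
  apply/funext => N; rewrite /series /= in_sum; apply: eq_bigr => n _.
  by rewrite inZ -in_conj.
by apply: in_cvg; exact: expansion.
Qed.

Definition diag d u : H := mkvec e (fun n => d n * <<u, e n>>).

Definition bounded_seq d := exists M, forall n, cmod (d n) <= M.

Lemma coef_diag d u m : bounded_seq d -> <<diag d u, e m>> = d m * <<u, e m>>.
Proof.
move=> [M dM]; rewrite coef_mkvec //; first by rewrite -mulrA in_nonnull.
by exists ((M * nrm u) ^+ 2); exact: square_summable_diag.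
Qed.

Lemma diag_linear d a u v : bounded_seq d ->
  diag d (a *: u + v) = a *: diag d u + diag d v.
Proof.
move=> bd; apply: hilb_ext => n.
by rewrite coef_diag // !inD !inZ !coef_diag // mulrDr mulrCA.
Qed.

Lemma diagB d u v : bounded_seq d -> diag d (u - v) = diag d u - diag d v.
Proof.
move=> bd; apply: hilb_ext => n.
by rewrite coef_diag // !inB !coef_diag // mulrBr.
Qed.

Lemma nrm_diag d M u : (forall n, cmod (d n) <= M) ->
  nrm (diag d u) <= M * nrm u.
Proof.
move=> dM; have M0 : 0 <= M by rewrite (le_trans (cmod_ge0 _) (dM 0)).
apply: nrm_mkvec => //; first by rewrite mulr_ge0 // nrm_ge0.
exact: square_summable_diag.
Qed.

Lemma diag_continuous d : bounded_seq d -> continuous (diag d).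
Proof.
move=> bd u; have [M dM] := bd.
have M0 : 0 <= M by rewrite (le_trans (cmod_ge0 _) (dM 0)).
have M1 : 0 < M + 1 by rewrite ltr_wpDl.
apply/cvg_nrmP => x x0.
have /cvg_nrmP/(_ _ (divr_gt0 x0 M1)) : v @[v --> u] --> u by exact: cvg_id.
apply: filterS => v; rewrite ltr_pdivlMr // => lt.
rewrite -diagB // (le_lt_trans (nrm_diag _ dM)) // (le_lt_trans _ lt) //.
by rewrite mulrC ler_wpM2l ?nrm_ge0 // lerDl.
Qed.

Lemma diag_e d n : bounded_seq d -> diag d (e n) = d n *: e n.
Proof.
move=> bd; apply: hilb_ext => m; rewrite coef_diag // inZ.
by have [->//|nm] := eqVneq n m; rewrite eo_off // !mulr0.
Qed.

Lemma bounded_seqM c d : bounded_seq c -> bounded_seq d ->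
  bounded_seq (fun n => c n * d n).
Proof.
move=> [M cM] [N dN]; exists (M * N) => n.
by rewrite cmodM ler_pM ?cmod_ge0.
Qed.

Lemma diag_comp c d u : bounded_seq c -> bounded_seq d ->
  diag c (diag d u) = diag (fun n => c n * d n) u.
Proof.
move=> bc bd; apply: hilb_ext => n; rewrite !coef_diag //; first by rewrite mulrA.
exact: bounded_seqM.
Qed.

Lemma diag_sym d u v : bounded_seq d -> (forall n, (d n)^* = d n) ->
  <<diag d u, v>> = <<u, diag d v>>.
Proof.
move=> bd dr; have c1 := @in_expansion (diag d u) v.
have c2 := @in_expansion u (diag d v).
have sE : series (fun n => <<diag d u, e n>> * (<<v, e n>>)^*) =
    series (fun n => <<u, e n>> * (<<diag d v, e n>>)^*).
  apply/funext => N; apply: eq_bigr => n _.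
  by rewrite !coef_diag // rmorphM /= dr mulrCA mulrA.
by rewrite sE in c1; exact: (cvgc_unique c1 c2).
Qed.

Lemma inner_ext u v : (forall w, <<w, u>> = <<w, v>>) -> u = v.
Proof.
move=> uv; apply/eqP; rewrite -subr_eq0 -nrm_eq0.
have : <<u - v, u - v>> = 0 by rewrite inBr uv subrr.
by rewrite in_sqr => /eqP; rewrite -(inj_eq (@complexI _)) rmorphXn expf_eq0 /= => /eqP[->].
Qed.

Section DiagonalOperator.
Variables (d : nat -> R[i]) (bd : bounded_seq d).

Definition diag_op : operator H :=
  @Operator R H [set: H] (diag d) I (fun _ _ _ _ _ => I)
    (fun a u v _ _ => diag_linear a u v bd).

Lemma diag_self_adjoint : (forall n, (d n)^* = d n) -> self_adjoint diag_op.
Proof.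
move=> dr; split.
  by move=> O [x Ox] _; exists x.
apply/seteqP; split => [[v w] vw|[v w] [_ /= <-] u _].
  have {}vw : forall u, <<diag d u, v>> = <<u, w>> := fun u => vw u I.
  by split=> //; apply: inner_ext => u; rewrite -diag_sym // vw.
exact: diag_sym.
Qed.

Lemma resolvent_uniq z : (forall n, d n - z != 0) ->
  bounded_seq (fun n => (d n - z)^-1) ->
  forall v, unique (fun u => dom diag_op u /\ diag_op u - z *: u = v)
    (diag (fun n => (d n - z)^-1) v).
Proof.
move=> dz bi v; split=> [|u [_ <-]].
  split=> //; apply: hilb_ext => n; rewrite inB inZ /= !coef_diag //.
  by rewrite -mulrBl mulrA divff ?mul1r.
apply: hilb_ext => n; rewrite coef_diag // inB inZ /= coef_diag // -mulrBl.
by rewrite mulKf.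
Qed.

Lemma resolvent_diag z : (forall n, d n - z != 0) ->
  bounded_seq (fun n => (d n - z)^-1) ->
  resolvent diag_op z = diag (fun n => (d n - z)^-1).
Proof.
move=> dz bi; apply/funext => v; rewrite /resolvent.
have [uv uniq_v] := resolvent_uniq dz bi v.
by case: xgetP => [u _ /uniq_v ->//|/(_ _) h]; case: (h _ uv).
Qed.

Lemma diag_resolvent_set z : (forall n, d n - z != 0) ->
  bounded_seq (fun n => (d n - z)^-1) -> resolvent_set diag_op z.
Proof.
move=> dz bi; split; last by rewrite resolvent_diag //; exact: diag_continuous.
by move=> v; exists (diag (fun n => (d n - z)^-1) v); exact: resolvent_uniq.
Qed.

(* z is an approximate eigenvalue. *)
Lemma diag_spectrum z :
  (forall x : R, 0 < x -> exists n, e n != 0 /\ cmod (d n - z) < x) ->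
  spectrum diag_op z.
Proof.
move=> dense_d [bij cont]; set T := resolvent diag_op z.
have TP v : diag d (T v) - z *: T v = v.
  have [u [uv _]] := bij v; rewrite /T /resolvent.
  by case: xgetP => [w _ [_ ->//]|/(_ u)]; case.
have TK u : T (diag d u - z *: u) = u.
  have [w [_ wu]] := bij (diag d u - z *: u).
  by rewrite -[RHS](wu u) //; apply/esym/wu; split; last exact: TP.
have T0 : T 0 = 0.
  have := TK 0; rewrite scaler0 subr0.
  have -> // : diag d 0 = 0.
  by apply: hilb_ext => n; rewrite coef_diag // !in0 mulr0.
have /cvg_nrmP/(_ 1 ltr01) := cont 0; rewrite -/T T0.
move=> /nbhs_ballP[_ /ltc_eq[r r0 ->] /= hr].
have [n [en0 dn]] := dense_d (r / 2) (divr_gt0 r0 (@ltr0n R 2)).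
have ne : nrm (e n) = 1.
  apply/eqP; rewrite -(@eqrXn2 _ 2) ?nrm_ge0 // expr1n.
  by rewrite -(inj_eq (@complexI _)) -in_sqr eo eqxx en0.
pose u := (rc 2) *: e n.
have Tu : T ((d n - z) *: u) = u.
  rewrite -[RHS]TK; congr T; rewrite /u scalerBl; congr (_ - _).
  rewrite -[_ *: e n in RHS]addr0 diag_linear // diag_e //.
  rewrite (_ : diag d 0 = 0) ?addr0 ?scalerA 1?mulrC //.
  by apply: hilb_ext => m; rewrite coef_diag // !in0 mulr0.
have := hr ((d n - z) *: u); rewrite Tu -ball_normE /= sub0r.
rewrite !sub0r !nrmN nrmE ltcR nrmN !nrmZ ne cmod_rc normr_nat mulr1.
move=> /(_ _) lt; have : 2 < 1 :> R by apply: lt; move: dn; lra.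
by rewrite ltrn1.
Qed.

End DiagonalOperator.
End Diagonal.

(** * Elementary bounds *)

Section ExponentialBounds.
Context (R : realType).
Implicit Types (a b x : R) (z w : R[i]).

Lemma expR_le_quad a : `|a| <= 2^-1 -> `|expR a - 1 - a| <= 2 * a ^+ 2.
Proof.
rewrite ler_norml => /andP[a1 a2].
have h1 := expR_ge1Dx a; have h2 := expR_ge1Dx (- a).
have e0 := expR_gt0 a.
have : expR a * (1 - a) <= 1.
  by rewrite -[leRHS](expRxMexpNx_1 a) ler_wpM2l // ltW.
move=> h3; rewrite ger0_norm; last by lra.
have h4 : (1 + a + 2 * a ^+ 2) * (1 - a) >= 1 by nra.
have : expR a * (1 - a) <= (1 + a + 2 * a ^+ 2) * (1 - a) by lra.
by rewrite ler_pM2r; lra.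
Qed.

Lemma expR_le2 a : a <= 2^-1 -> expR a <= 2.
Proof.
move=> a1; have h2 := expR_ge1Dx (- a); have e0 := expR_gt0 a.
have : expR a * (1 - a) <= 1.
  by rewrite -[leRHS](expRxMexpNx_1 a) ler_wpM2l // ltW.
by nra.
Qed.

Lemma norm_sin_le x : `|sin x| <= `|x|.
Proof.
wlog x0 : x / 0 <= x.
  move=> h; have [/h//|/ltW x0] := lerP 0 x.
  by rewrite -normrN -sinN -[leRHS]normrN h // oppr_ge0.
have hd y : y \in `]0, x[ -> is_derive y 1 sin (cos y).
  by move=> _; exact: is_derive_sin.
have hc : {within `[0, x], continuous (@sin R)}.
  by apply: continuous_subspaceT => y; exact: continuous_sin.
have [c _] := MVT_segment x0 hd hc; rewrite sin0 !subr0 => ->.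
by rewrite normrM ler_piMl // cos_max.
Qed.

Lemma cos_le_quad x : `|cos x - 1| <= x ^+ 2 / 2.
Proof.
have -> : cos x - 1 = - 2 * sin (x / 2) ^+ 2.
  rewrite {1}[x](_ : x = (x / 2) *+ 2); last by rewrite mulr2n -splitr.
  rewrite cos_mulr2n cos2sin2; ring.
have := norm_sin_le (x / 2); set s := sin _.
rewrite -(@ler_pXn2r _ 2) ?nnegrE // !real_normK ?num_real // => h.
rewrite normrM normrN normr_nat normrX real_normK ?num_real //.
move: h; rewrite expr_div_n; have -> : (2 : R) ^+ 2 = 4 by ring.
lra.
Qed.

Lemma sin_le_quad x : `|sin x - x| <= x ^+ 2.
Proof.
wlog x0 : x / 0 <= x.
  move=> h; have [/h//|/ltW x0] := lerP 0 x.
  have := h (- x); rewrite oppr_ge0 sinN sqrrN opprK addrC distrC.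
  exact.
have hd y : y \in `]0, x[ -> is_derive y 1 (fun t => sin t - t) (cos y - 1).
  by move=> _; exact: is_deriveB.
have hc : {within `[0, x], continuous (fun t : R => sin t - t)}.
  apply: continuous_subspaceT => y.
  by apply: cvgB; [exact: continuous_sin|exact: cvg_id].
have [c] := MVT_segment x0 hd hc; rewrite in_itv /= => /andP[c0 cx].
rewrite sin0 !subr0 => ->.
rewrite normrM [`|x|]ger0_norm // expr2 ler_wpM2r //.
have -> : cos c - 1 = - 2 * sin (c / 2) ^+ 2.
  rewrite {1}[c](_ : c = (c / 2) *+ 2); last by rewrite mulr2n -splitr.
  rewrite cos_mulr2n cos2sin2; ring.
have := norm_sin_le (c / 2); have := sin_max (c / 2); set s := sin _.
rewrite [`|c / 2|]ger0_norm ?divr_ge0 // => h1 h2.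
rewrite normrM normrN normr_nat normrX.
have := normr_ge0 s; nra.
Qed.

Lemma cexpD z w : cexp (z + w) = cexp z * cexp w.
Proof.
case: z w => [a b] [c d]; rewrite /cexp /= expRD cosD sinD.
by apply/eqP; rewrite eq_complex /=; apply/andP; split; apply/eqP; ring.
Qed.

Lemma cexp0 : cexp 0 = 1 :> R[i].
Proof. by rewrite /cexp /= expR0 cos0 sin0 mulr1 mulr0. Qed.

Lemma cexp_sum I (r : seq I) (P : pred I) (F : I -> R[i]) :
  cexp (\sum_(k <- r | P k) F k) = \prod_(k <- r | P k) cexp (F k).
Proof. by elim/big_rec2: _ => [|k a b _ <-]; rewrite ?cexp0 // cexpD. Qed.

Lemma cmod_cexp z : cmod (cexp z) = expR (complex.Re z).
Proof.
apply/eqP; rewrite -(@eqrXn2 _ 2) ?cmod_ge0 ?expR_ge0 // cmod_sqr /=.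
by rewrite !exprMn -mulrDr cos2Dsin2 mulr1.
Qed.

Lemma cexp_quad w : cmod w <= 2^-1 -> cmod (cexp w - 1 - w) <= 4 * cmod w ^+ 2.
Proof.
move=> w1; have hR := le_trans (Re_le_cmod w) w1.
have hI := le_trans (Im_le_cmod w) w1.
apply: le_trans (cmod_le_ReIm _) _; rewrite cmod_sqr.
case: w {w1} hR hI => a b /= ha hb.
have h1 := expR_le_quad ha; have h2 := cos_le_quad b; have h3 := sin_le_quad b.
have h4 := norm_sin_le b.
have h5 : expR a <= 2 by apply: expR_le2; apply: le_trans (ler_norm _) ha.
have e0 := expR_ge0 a.
have -> : expR a * cos b - 1 - a = (expR a - 1 - a) + expR a * (cos b - 1) by ring.
have -> : expR a * sin b - 0 - b = (expR a - 1 - a) * sin b + a * sin b + (sin b - b).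
  by ring.
have g1 : `|expR a * (cos b - 1)| <= b ^+ 2.
  by rewrite normrM (ger0_norm e0); have := normr_ge0 (cos b - 1); nra.
have ab2 : `|a| * `|b| <= (a ^+ 2 + b ^+ 2) / 2.
  rewrite -[a ^+ 2]real_normK ?num_real // -[b ^+ 2]real_normK ?num_real //.
  by have := sqr_ge0 (`|a| - `|b|); nra.
have g2 : `|a * sin b| <= (a ^+ 2 + b ^+ 2) / 2.
  by rewrite normrM (le_trans _ ab2) // ler_wpM2l.
have sb : `|sin b| <= 1 by exact: sin_max.
have g3 : `|(expR a - 1 - a) * sin b| <= 2 * a ^+ 2 * 2^-1.
  by rewrite normrM ler_pM // (le_trans h4).
have t1 := ler_normD (expR a - 1 - a) (expR a * (cos b - 1)).
have t2 := ler_normD ((expR a - 1 - a) * sin b + a * sin b) (sin b - b).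
have t3 := ler_normD ((expR a - 1 - a) * sin b) (a * sin b).
have := sqr_ge0 a; have := sqr_ge0 b; lra.
Qed.

Lemma cexp_lin w : cmod w <= 2^-1 -> cmod (cexp w - 1) <= 3 * cmod w.
Proof.
move=> w1; have h := cexp_quad w1.
have -> : cexp w - 1 = (cexp w - 1 - w) + w by rewrite subrK.
apply: le_trans (cmodD _ _) _.
have := ler_wpM2l (cmod_ge0 w) w1; rewrite expr2 in h.
have := cmod_ge0 w; lra.
Qed.

Lemma regularized_factor w : cmod w <= 2^-1 ->
  cmod ((1 + w) * cexp (- w) - 1) <= 7 * cmod w ^+ 2.
Proof.
move=> w1; have w1' : cmod (- w) <= 2^-1 by rewrite cmodN.
have := cexp_quad w1'; rewrite cmodN opprK.
set r := (X in cmod X); move=> hr.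
have -> : (1 + w) * cexp (- w) - 1 = (1 + w) * r - w * w by rewrite /r; ring.
apply: le_trans (cmodB _ _) _; rewrite !cmodM.
have h1 := cmodD 1 w; rewrite cmod1 in h1.
have := cmod_ge0 r; have := cmod_ge0 w; have := cmod_ge0 (1 + w).
have : cmod (1 + w) * cmod r <= 3 / 2 * (4 * cmod w ^+ 2).
  by rewrite ler_pM ?cmod_ge0 //; lra.
have := sqr_ge0 (cmod w); rewrite expr2; lra.
Qed.

Lemma prod_near1 I (r : seq I) (P : pred I) (F : I -> R[i]) :
  cmod (\prod_(k <- r | P k) F k - 1)
    <= expR (\sum_(k <- r | P k) cmod (F k - 1)) - 1.
Proof.
elim/big_rec2: _ => [|k s p _ IH]; first by rewrite subrr cmod0 expR0 subrr.
rewrite expRD; set f := F k.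
have -> : f * p - 1 = (f - 1) * (p - 1) + (f - 1) + (p - 1) by ring.
apply: le_trans (cmodD _ _) _; apply: le_trans (lerD (cmodD _ _) (lexx _)) _.
rewrite cmodM; have h := expR_ge1Dx (cmod (f - 1)).
have := cmod_ge0 (f - 1); have := cmod_ge0 (p - 1).
set x := cmod (f - 1) in h *; set y := cmod (p - 1) in IH *.
set E := expR x in h *; set G := expR _ in IH * => y0 x0.
have : (1 + x) * (1 + y) <= E * G by rewrite ler_pM //; lra.
by lra.
Qed.

Lemma expR_le_lin a : 0 <= a -> a <= 2^-1 -> expR a - 1 <= 2 * a.
Proof.
move=> a0 a1; have := @expR_le_quad a; rewrite ger0_norm // => /(_ a1).
by rewrite ler_norml => /andP[_]; nra.
Qed.

End ExponentialBounds.

(** * Determinants of trace class perturbations of the identity *)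

Section ComplexProducts.
Context (R : realType) (T : Type) (F : set_system T) {FF : Filter F}.

Lemma cvgr_sum I (r : seq I) (h : I -> T -> R) (l : I -> R) :
  (forall k, h k @ F --> l k) ->
  (fun t => \sum_(k <- r) h k t) @ F --> \sum_(k <- r) l k.
Proof.
move=> hl; elim: r => [|k r IH].
  rewrite big_nil; have -> : (fun t => \sum_(k <- [::]) h k t) = (fun=> 0).
    by apply/funext => t; rewrite big_nil.
  exact: cvg_cst.
rewrite big_cons; have -> : (fun t => \sum_(j <- k :: r) h j t) =
    (fun t => h k t + \sum_(j <- r) h j t).
  by apply/funext => t; rewrite big_cons.
exact: (cvgD (hl k) IH).
Qed.

Lemma cvgc_prod I (r : seq I) (h : I -> T -> R[i]) (l : I -> R[i]) :
  (forall k, (h k : T -> R[i]^o) @ F --> (l k : R[i]^o)) ->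
  ((fun t => \prod_(k <- r) h k t) : T -> R[i]^o) @ F
    --> (\prod_(k <- r) l k : R[i]^o).
Proof.
move=> hl; elim: r => [|k r IH].
  rewrite big_nil; have -> : (fun t => \prod_(k <- [::]) h k t) = (fun=> 1).
    by apply/funext => t; rewrite big_nil.
  exact: cvgc_cst.
rewrite big_cons; have -> : (fun t => \prod_(j <- k :: r) h j t) =
    (fun t => h k t * \prod_(j <- r) h j t).
  by apply/funext => t; rewrite big_cons.
exact: (cvgcM (hl k) IH).
Qed.

Lemma cvgc_det n (A : T -> 'M[R[i]]_n) (L : 'M[R[i]]_n) :
  (forall k l, ((fun t => A t k l) : T -> R[i]^o) @ F --> (L k l : R[i]^o)) ->
  ((fun t => \det (A t)) : T -> R[i]^o) @ F --> (\det L : R[i]^o).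
Proof.
move=> AL; apply: (cvgc_sum _ (h := fun s t => _) (l := fun s => _)) => s.
apply: (cvgcM (f := fun=> _)); first exact: cvgc_cst.
by apply: (cvgc_prod _ (h := fun k t => A t k _) (l := fun k => L k _)) => k.
Qed.

Lemma cvg_cexp (f : T -> R[i]) (l : R[i]) :
  (f : T -> R[i]^o) @ F --> (l : R[i]^o) ->
  ((fun t => cexp (f t)) : T -> R[i]^o) @ F --> (cexp l : R[i]^o).
Proof.
move=> /cvg_cmodP fl; apply/cvg_cmodP => d d0.
have E0 : 0 < cmod (cexp l) by rewrite cmod_cexp expR_gt0.
have d1 : 0 < Num.min 2^-1 (d / (4 * cmod (cexp l))).
  by rewrite lt_min invr_gt0 ltr0n divr_gt0 // mulr_gt0.
apply: filterS (fl _ d1) => t; rewrite lt_min => /andP[h1 h2].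
have -> : cexp l - cexp (f t) = - (cexp l * (cexp (f t - l) - 1)).
  by rewrite mulrBr -cexpD [l + _]addrC subrK mulr1 opprB.
rewrite cmodN cmodM; rewrite cmodC in h1 h2.
have := cexp_lin (ltW h1); rewrite ltr_pdivlMr ?mulr_gt0 // in h2.
have := cmod_ge0 (f t - l); nra.
Qed.

End ComplexProducts.

Section FactoredMinors.
Context (R : realType).
Local Notation rc := (real_complex R).
Local Open Scope sesquilinear_scope.

Lemma psdblock_factor n m (F G : 'M[R[i]]_(n, m)) (delta : 'rV[R[i]]_m) :
  (forall k, 0 <= delta 0 k) ->
  let D := diag_mx delta in
  psdblock (F *m D *m F^t*) (F *m D *m G^t*) (G *m D *m G^t*).
Proof.
move=> d0 D x y; pose z := x *m F + y *m G.
have DE : D^t* = D.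
  apply/matrixP => k l; rewrite !mxE eq_sym; case: eqP => [->|_]; last by rewrite !mulr0n rmorph0.
  by rewrite !mulr1n; apply: conj_Creal; rewrite realE d0.
have -> : (x *m (F *m D *m F^t*) *m x^t*) 0 0 + (x *m (F *m D *m G^t*) *m y^t*) 0 0
     + (y *m (F *m D *m G^t*)^t* *m x^t*) 0 0 + (y *m (G *m D *m G^t*) *m y^t*) 0 0
     = (z *m D *m z^t*) 0 0.
  have -> : z^t* = F^t* *m x^t* + G^t* *m y^t*.
    by rewrite /z linearD /= map_mxD !trmx_mul !map_mxM.
  have -> : (F *m D *m G^t*)^t* = G *m D *m F^t*.
    by rewrite !trmx_mul !map_mxM trmxCK DE mulmxA.
  rewrite /z !mulmxDl !mulmxDr !mulmxA.
  rewrite [in RHS]mxE [in X in _ = X + _]mxE [in X in _ = _ + X]mxE.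
  by rewrite -!addrA.
rewrite mul_mx_diag mxE; apply: sumr_ge0 => k _; rewrite !mxE.
rewrite mulrAC -normCK mulr_ge0 // exprn_ge0 //.
Qed.

Lemma det_1D_psd_le n (P : 'M[R[i]]_n) (s : R) :
  psdmx P -> \tr P <= rc s -> \det (1%:M + P) <= rc (expR s).
Proof.
move=> /det_1D_psd[t [t0 -> ->]].
have tE k : t k = rc (complex.Re (t k)) by rewrite RRe_real // realE t0.
have t0' k : 0 <= complex.Re (t k) by rewrite -ler0c -tE.
rewrite (eq_bigr _ (fun k _ => tE k)) -rmorph_sum lecR => ts.
under eq_bigr do rewrite tE -(rmorph1 rc) -rmorphD.
rewrite -rmorph_prod lecR (le_trans (_ : _ <= expR (\sum_k complex.Re (t k)))) //; last first.
  by rewrite ler_expR.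
rewrite expR_sum; apply: ler_prod => k _.
by rewrite expR_ge1Dx addr_ge0.
Qed.

Lemma trace_factor_le n m (F : 'M[R[i]]_(n, m)) (mu : 'I_m -> R) :
  (forall k, 0 <= mu k) -> (forall k, \sum_i cmod (F i k) ^+ 2 <= 1) ->
  \tr (F *m diag_mx (\row_k rc (mu k)) *m F^t*) <= rc (\sum_k mu k).
Proof.
move=> mu0 F1; rewrite mul_mx_diag.
have -> : \tr (\matrix_(i, j) (F i j * (\row_k rc (mu k)) 0 j) *m F^t*) =
    rc (\sum_k mu k * \sum_i cmod (F i k) ^+ 2).
  rewrite /mxtrace rmorph_sum /=.
  under eq_bigr do rewrite mxE.
  rewrite exchange_big /=; apply: eq_bigr => k _.
  rewrite rmorphM rmorph_sum /= mulr_sumr; apply: eq_bigr => j _.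
  by rewrite !mxE mulrAC mul_conj_sqr mulrC.
by rewrite lecR; apply: ler_sum => k _; rewrite ler_piMr.
Qed.

Lemma sum_pminor_factor n m (F G : 'M[R[i]]_(n, m)) (mu : 'I_m -> R) :
  (forall k, 0 <= mu k) -> (forall k, \sum_i cmod (F i k) ^+ 2 <= 1) ->
  (forall k, \sum_i cmod (G i k) ^+ 2 <= 1) ->
  \sum_(S : {set 'I_n}) cmod (pminor (F *m diag_mx (\row_k rc (mu k)) *m G^t*) S)
    <= expR (\sum_k mu k).
Proof.
move=> mu0 F1 G1; have psd : psdblock _ _ _ := @psdblock_factor _ _ F G
  (\row_k rc (mu k)) (fun k => ltac:(by rewrite mxE ler0c)).
have := sum_norm_pminor psd.
under eq_bigr do rewrite cmodE.
rewrite -rmorph_sum -lecR => /le_trans; apply.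
have hP := det_1D_psd_le (psdblock_l psd) (trace_factor_le mu0 F1).
have hR := det_1D_psd_le (psdblock_r psd) (trace_factor_le mu0 G1).
rewrite ler_pdivrMr ?ltr0n // (le_trans (lerD hP hR)) //.
by rewrite mulr_natr mulr2n.
Qed.

End FactoredMinors.

Section TraceClass.
Context (R : realType) (H : hilbert_space R).
Local Notation rc := (real_complex R).
Local Notation "<< u , v >>" := (inner H u v).
Local Notation e := (hbasis H).
Local Open Scope sesquilinear_scope.
Hypothesis eo : orthonormal_seq e.

Definition matcoef (D : H -> H) (i j : nat) : R[i] := <<D (e j), e i>>.

Lemma orthonormal_nrm_le1 (f : nat -> H) m : orthonormal_seq f -> nrm (f m) <= 1.
Proof.
move=> fo; rewrite -(@ler_pXn2r _ 2) ?nnegrE ?nrm_ge0 // expr1n.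
rewrite -lecR -in_sqr fo eqxx /=; by case: (f m != 0).
Qed.

Lemma trace_class_minors (D : H -> H) : trace_class D ->
  exists K : R, forall N, abs_minors (matcoef D) N <= K.
Proof.
move=> [mu [f [g [mu0 smu fo go Dlim]]]].
pose s := fine (\sum_(0 <= n <oo) (mu n)%:E)%E.
have mus M : \sum_(m < M) mu m <= s.
  rewrite -lee_fin /s fineK; last first.
    rewrite ge0_fin_numE // nneseries_ge0 // => n _ _; rewrite lee_fin //.
  rewrite -(big_mkord xpredT) -sumEFin.
  by apply: nneseries_lim_ge => n _ _; rewrite lee_fin.
exists (expR s) => N.
pose F M := \matrix_(i < N, m < M) <<f m, e i>>.
pose G M := \matrix_(i < N, m < M) <<g m, e i>>.
pose Q M := F M *m diag_mx (\row_(m < M) rc (mu m)) *m (G M)^t*.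
have Qlim k l : ((fun M => Q M k l) : nat -> R[i]^o) @ \oo
    --> (trunc_mx (matcoef D) N k l : R[i]^o).
  rewrite mxE.
  have -> : (fun M => Q M k l) = (fun M => <<series (fun n =>
      (rc (mu n) * <<e l, g n>>) *: f n) M, e k>>).
    apply/funext => M; rewrite /Q mul_mx_diag mxE /series /= in_sum big_mkord.
    apply: eq_bigr => m _; rewrite !mxE inZ [<<e l, _>>]in_conj.
    by rewrite mulrC mulrA [in RHS]mulrAC mulrC [_ * <<f m, e k>>]mulrC mulrA mulrAC.
  by apply: in_cvg; exact: Dlim.
have bound M : \sum_(S : {set 'I_N}) cmod (pminor (Q M) S) <= expR s.
  apply: le_trans (_ : expR (\sum_(m < M) mu m) <= _); last by rewrite ler_expR.
  apply: sum_pminor_factor => [m|m|m] //.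
    under eq_bigr do rewrite mxE.
    apply: le_trans (bessel eo (f m) N) _.
    by rewrite expr_le1 ?nrm_ge0 // orthonormal_nrm_le1.
  under eq_bigr do rewrite mxE.
  apply: le_trans (bessel eo (g m) N) _.
  by rewrite expr_le1 ?nrm_ge0 // orthonormal_nrm_le1.
have lim : (fun M => \sum_(S : {set 'I_N}) cmod (pminor (Q M) S)) @ \oo
    --> abs_minors (matcoef D) N.
  apply: (cvgr_sum _ (h := fun S M => cmod (pminor (Q M) S))) => S.
  apply: cvg_cmod; apply: (cvgc_det (A := fun M => mxsub _ _ (Q M))) => k l.
  by rewrite mxE; under eq_fun do rewrite mxE; exact: Qlim.
apply: (cvgr_to_le lim); near=> M; exact: bound.
Unshelve. all: by end_near. Qed.

Lemma trace_class_det (D : H -> H) : trace_class D ->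
  ((fun N => \det (1%:M + trunc_mx (matcoef D) N) *
             cexp (- \sum_(n < N) matcoef D n n)) : nat -> R[i]^o) @ \oo
    --> (det1p D * cexp (- trace D) : R[i]^o).
Proof.
move=> /trace_class_minors[K DK].
have minorE k : trace_exterior D k = limn (minors_of_order (matcoef D) k : nat -> R[i]^o).
  rewrite /trace_exterior; congr (limn (_ : nat -> R[i]^o)).
  apply/funext => N; apply: eq_bigr => S _; congr (\det _).
  by apply/matrixP => k' l; rewrite !mxE.
have [L detL serL] := det_1D_trunc_cvg DK.
have -> : det1p D = L.
  apply: (cvg_lim (@norm_hausdorff _ R[i]^o)).
  by have -> : trace_exterior D = (fun k => limn (minors_of_order (matcoef D) k : nat -> R[i]^o)) by apply/funext.
apply: (cvgcM detL); apply: cvg_cexp; apply: cvgcN.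
have tr1 : ((fun N => \sum_(n < N) matcoef D n n) : nat -> R[i]^o) =
    minors_of_order (matcoef D) 1.
  by apply/funext => N; rewrite minors_of_order1.
have c1 := @minors_of_order_cvg _ (matcoef D) 1 _ DK.
rewrite tr1; have -> : trace D = limn (minors_of_order (matcoef D) 1 : nat -> R[i]^o).
  rewrite -tr1 /trace; congr (limn (_ : nat -> R[i]^o)).
  by apply/funext => N; rewrite /series /= big_mkord.
exact: c1.
Qed.

End TraceClass.

(** * The modified determinant near a diagonal operator *)

Section NonnegativeSeries.
Context (R : realType).

Lemma nneseries_le (a : nat -> R) (K : R) : (forall n, 0 <= a n) ->
  (forall N, \sum_(n < N) a n <= K) -> (\sum_(0 <= n <oo) (a n)%:E <= K%:E)%E.
Proof.
move=> a0 aK; apply: lime_le.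
  by apply: is_cvg_nneseries => n _ _; rewrite lee_fin.
by apply: nearW => N; rewrite sumEFin lee_fin big_mkord.
Qed.

Lemma nneseries_partial_le (a : nat -> R) (K : R) N : (forall n, 0 <= a n) ->
  (\sum_(0 <= n <oo) (a n)%:E <= K%:E)%E -> \sum_(n < N) a n <= K.
Proof.
move=> a0; rewrite -lee_fin => /(le_trans _); apply.
rewrite -(big_mkord xpredT) -sumEFin.
by apply: nneseries_lim_ge => n _ _; rewrite lee_fin.
Qed.

End NonnegativeSeries.

Section RegularizedDeterminant.
Context (R : realType).
Local Notation rc := (real_complex R).

Definition regdet n (T : 'M[R[i]]_n) : R[i] := \det (1%:M + T) * cexp (- \tr T).

Lemma regdet_near1 n (K : 'M[R[i]]_n) (k : R) : 0 <= k -> k <= 4^-1 ->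
  \sum_i \sum_j cmod (K i j) ^+ 2 <= k ^+ 2 -> cmod (regdet K - 1) <= 7 * k.
Proof.
move=> k0 k4 Kk; have [t [dK tK]] := det_1D_schur K.
have -> : \sum_i \sum_j `|K i j| ^+ 2 = rc (\sum_i \sum_j cmod (K i j) ^+ 2).
  rewrite rmorph_sum; apply: eq_bigr => a _; rewrite rmorph_sum.
  by apply: eq_bigr => b _; rewrite cmodE rmorphXn.
have -> : \sum_i `|t i| ^+ 2 = rc (\sum_i cmod (t i) ^+ 2).
  by rewrite rmorph_sum; apply: eq_bigr => a _; rewrite cmodE rmorphXn.
rewrite lecR => /le_trans/(_ Kk) tk.
have t1 a : cmod (t a) <= 2^-1.
  have : cmod (t a) ^+ 2 <= k ^+ 2.
    apply: le_trans tk; rewrite (bigD1 a) //= lerDl sumr_ge0 // => b _.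
    exact: sqr_ge0.
  by rewrite ler_pXn2r ?nnegrE ?cmod_ge0 //; lra.
rewrite /regdet dK tK -sumrN cexp_sum -big_split /=.
apply: le_trans (prod_near1 _ _ _) _.
have hs : \sum_a cmod ((1 + t a) * cexp (- t a) - 1) <= 7 * k ^+ 2.
  apply: le_trans (_ : \sum_a 7 * cmod (t a) ^+ 2 <= _); last first.
    by rewrite -mulr_sumr ler_pM2l.
  by apply: ler_sum => a _; exact: regularized_factor.
set s := \sum_a _ in hs *; have s0 : 0 <= s by rewrite sumr_ge0 // => a _; exact: cmod_ge0.
have k2 : k ^+ 2 <= k * 4^-1 by rewrite expr2 ler_wpM2l.
by apply: le_trans (expR_le_lin s0 _) _; lra.
Qed.

Lemma regdet_perturb n (T : 'M[R[i]]_n) (c : 'I_n -> R[i]) (kap g eps : R) :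
  0 < g -> 0 < eps ->
  (forall k, 1 + c k != 0) -> (forall k, cmod (1 + c k)^-1 <= kap) ->
  \sum_k cmod (c k) ^+ 2 <= g ^+ 2 ->
  \sum_k \sum_l cmod (T k l - (k == l)%:R * c k) ^+ 2 <= eps ^+ 2 ->
  0 <= kap -> kap * eps <= 4^-1 -> kap * g * eps <= 2^-1 ->
  cmod (regdet T - \prod_k ((1 + c k) * cexp (- c k)))
    <= cmod (\prod_k ((1 + c k) * cexp (- c k))) * ((18 + 3 * g) * kap * eps).
Proof.
move=> g0 e0 c1 ck cg Te k0 k4 kg.
have [D DE] : exists D : 'M[R[i]]_n, forall k l, D k l = T k l - (k == l)%:R * c k.
  by exists (\matrix_(k, l) (T k l - (k == l)%:R * c k)) => k l; rewrite mxE.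
have [K KE] : exists K : 'M[R[i]]_n, forall k l, K k l = (1 + c k)^-1 * D k l.
  by exists (\matrix_(k, l) ((1 + c k)^-1 * D k l)) => k l; rewrite mxE.
have detT : \det (1%:M + T) = (\prod_k (1 + c k)) * \det (1%:M + K).
  have -> : 1%:M + T = diag_mx (\row_k (1 + c k)) *m (1%:M + K).
    apply/matrixP => k l; rewrite mul_diag_mx !mxE KE mulrDr mulVKf // DE.
    by case: (k == l) => /=; ring.
  rewrite det_mulmx det_diag; congr (_ * _).
  by apply: eq_bigr => k _; rewrite mxE.
pose s := \tr K - \tr D.
have trT : - \tr T = - \sum_k c k - \tr K + s.
  have -> : \tr T = \tr D + \sum_k c k.
    rewrite /mxtrace -big_split /=; apply: eq_bigr => k _.
    by rewrite DE eqxx mul1r subrK.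
  by rewrite /s; ring.
have -> : regdet T = (\prod_k ((1 + c k) * cexp (- c k))) * (regdet K * cexp s).
  by rewrite /regdet detT trT 2!cexpD -sumrN cexp_sum big_split /=; ring.
rewrite -[X in _ - X]mulr1 -mulrBr cmodM ler_wpM2l ?cmod_ge0 //.
have hK : cmod (regdet K - 1) <= 7 * (kap * eps).
  apply: regdet_near1 => //; first by rewrite mulr_ge0 // ltW.
  rewrite exprMn (le_trans _ (ler_wpM2l (sqr_ge0 kap) Te)) // mulr_sumr.
  apply: ler_sum => k _; rewrite mulr_sumr; apply: ler_sum => l _.
  rewrite KE DE cmodM exprMn ler_wpM2r ?sqr_ge0 //.
  by rewrite ler_pXn2r ?nnegrE ?cmod_ge0.
have hs : cmod s <= kap * g * eps.
  have -> : s = \sum_k - ((1 + c k)^-1 * c k * D k k).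
    rewrite /s /mxtrace -sumrB; apply: eq_bigr => k _; rewrite KE.
    by field.
  apply: le_trans (cmod_sum _ _ _) _.
  have hD : \sum_k cmod (D k k) ^+ 2 <= eps ^+ 2.
    apply: le_trans Te; apply: ler_sum => k _; rewrite (bigD1 k) //= DE lerDl.
    by apply: sumr_ge0 => l _; exact: sqr_ge0.
  apply: le_trans (_ : \sum_k kap *
      ((eps / g) / 2 * cmod (c k) ^+ 2 + (g / eps) / 2 * cmod (D k k) ^+ 2) <= _).
    apply: ler_sum => k _; rewrite cmodN !cmodM -mulrA ler_pM ?mulr_ge0 ?cmod_ge0 //.
    set x := cmod (c k); set y := cmod (D k k).
    have : 0 <= (eps * x - g * y) ^+ 2 / (2 * g * eps).
      by rewrite divr_ge0 ?sqr_ge0 // !mulr_ge0 ?ltW.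
    have -> : (eps * x - g * y) ^+ 2 / (2 * g * eps) =
        eps / g / 2 * x ^+ 2 + g / eps / 2 * y ^+ 2 - x * y.
      by field; rewrite !gt_eqF.
    by rewrite subr_ge0.
  rewrite -mulr_sumr -[leRHS]mulrA ler_wpM2l // big_split /= -!mulr_sumr.
  have h1 : eps / g / 2 * \sum_k cmod (c k) ^+ 2 <= eps / g / 2 * g ^+ 2.
    by rewrite ler_wpM2l // !divr_ge0 // ltW.
  have h2 : g / eps / 2 * \sum_k cmod (D k k) ^+ 2 <= g / eps / 2 * eps ^+ 2.
    by rewrite ler_wpM2l // !divr_ge0 // ltW.
  apply: le_trans (lerD h1 h2) _.
  have -> : eps / g / 2 * g ^+ 2 + g / eps / 2 * eps ^+ 2 = g * eps; last by [].
  by field; rewrite !gt_eqF.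
have hc := cexp_lin (le_trans hs kg).
have -> : regdet K * cexp s - 1 =
    (regdet K - 1) * (cexp s - 1) + (regdet K - 1) + (cexp s - 1) by ring.
apply: le_trans (cmodD _ _) _; apply: le_trans (lerD (cmodD _ _) (lexx _)) _.
rewrite cmodM; set x := cmod (regdet K - 1) in hK *; set y := cmod (cexp s - 1) in hc *.
have y1 : y <= 3 / 2 by lra.
have xy : x * y <= x * (3 / 2) by rewrite ler_wpM2l ?cmod_ge0.
have ke : 0 <= kap * eps by rewrite mulr_ge0 // ltW.
have -> : (18 + 3 * g) * kap * eps = 18 * (kap * eps) + 3 * (kap * g * eps) by ring.
by lra.
Qed.

End RegularizedDeterminant.

Section RegularizedProduct.
Context (R : realType).
Variables (c : nat -> R[i]) (g : R).
Hypothesis g0 : 0 < g.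
Hypothesis cg : forall N, \sum_(n < N) cmod (c n) ^+ 2 <= g ^+ 2.

Definition regprod N := \prod_(n < N) ((1 + c n) * cexp (- c n)).

Lemma square_summable_le n : cmod (c n) <= g.
Proof.
rewrite -(@ler_pXn2r _ 2) ?nnegrE ?cmod_ge0 ?(ltW g0) //.
apply: (le_trans _ (cg n.+1)); rewrite big_ord_recr /= lerDr sumr_ge0 // => k _.
exact: sqr_ge0.
Qed.

Let kap := 7 + 4 * ((1 + g) * expR g + 1).

Let kap0 : 0 <= kap.
Proof. by rewrite addr_ge0 // mulr_ge0 // addr_ge0 // mulr_ge0 ?expR_ge0 // addr_ge0 // ltW. Qed.

Let factor_bound n : cmod ((1 + c n) * cexp (- c n) - 1) <= kap * cmod (c n) ^+ 2.
Proof.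
have E0 := expR_ge0 g; have gE : 0 <= g * expR g by rewrite mulr_ge0 // ltW.
have sq := sqr_ge0 (cmod (c n)).
have [h|h] := leP (cmod (c n)) 2^-1.
  by apply: le_trans (regularized_factor h) _; rewrite ler_wpM2r // /kap; lra.
apply: le_trans (cmodB _ _) _; rewrite cmodM cmod1 cmod_cexp.
have h1 : cmod (1 + c n) <= 1 + g.
  by apply: le_trans (cmodD _ _) _; rewrite cmod1 lerD2l square_summable_le.
have h2 : expR (complex.Re (- c n)) <= expR g.
  rewrite ler_expR (le_trans (ler_norm _)) // (le_trans (Re_le_cmod _)) // cmodN.
  exact: square_summable_le.
have h3 : 1 <= 4 * cmod (c n) ^+ 2 by nra.
have h4 : cmod (1 + c n) * expR (complex.Re (- c n)) <= (1 + g) * expR g.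
  by rewrite ler_pM ?cmod_ge0 ?expR_ge0.
apply: le_trans (_ : ((1 + g) * expR g + 1) * (4 * cmod (c n) ^+ 2) <= _).
  by apply: le_trans (_ : ((1 + g) * expR g + 1) * 1 <= _); [lra|rewrite ler_wpM2l //; lra].
by rewrite /kap; nra.
Qed.

Lemma regprod_bounded : exists2 B : R, 0 <= B & forall N, cmod (regprod N) <= B.
Proof.
exists (expR (kap * g ^+ 2)); first exact: expR_ge0.
move=> N; have := prod_near1 (index_enum 'I_N) xpredT
  (fun n => (1 + c n) * cexp (- c n)).
rewrite -/(regprod N) => h.
have : cmod (regprod N) <= cmod (regprod N - 1) + 1.
  by have := cmodD (regprod N - 1) 1; rewrite subrK cmod1.
move=> /le_trans; apply; rewrite -lerBrDr (le_trans h) // lerD2r ler_expR.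
apply: (le_trans _ (ler_wpM2l kap0 (cg N))); rewrite mulr_sumr.
by apply: ler_sum => n _; exact: factor_bound.
Qed.

Lemma regprod_cvg : cvgn (regprod : nat -> R[i]^o).
Proof.
have [B B0 regB] := regprod_bounded.
pose A N := B * kap * \sum_(n < N) cmod (c n) ^+ 2.
have step n : cmod (regprod n.+1 - regprod n) <= A n.+1 - A n.
  rewrite /regprod /A !big_ord_recr /= -/(regprod n) mulrDr addrAC subrr add0r.
  have -> : regprod n * ((1 + c n) * cexp (- c n)) - regprod n =
    regprod n * ((1 + c n) * cexp (- c n) - 1) by ring.
  by rewrite cmodM -mulrA ler_pM ?cmod_ge0.
apply: (@complex_cvg_dominated _ _ A).
  apply: nondecreasing_is_cvgn.
    apply/nondecreasing_seqP => n; rewrite -subr_ge0 (le_trans _ (step n)) //.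
    exact: cmod_ge0.
  exists (B * kap * g ^+ 2) => _ [n _ <-].
  by rewrite ler_wpM2l // mulr_ge0.
move=> m n; elim: n => [|n IH]; first by rewrite leqn0 => /eqP ->; rewrite !subrr cmod0.
rewrite leq_eqVlt => /predU1P[->|]; first by rewrite !subrr cmod0.
rewrite ltnS => /IH {}IH.
have -> : regprod n.+1 - regprod m = (regprod n.+1 - regprod n) + (regprod n - regprod m).
  by rewrite addrA subrK.
apply: le_trans (cmodD _ _) _; apply: le_trans (lerD (step n) IH) _.
by rewrite addrA subrK.
Qed.

End RegularizedProduct.

Section HilbertSchmidtNbhs.
Context (R : realType) (H : hilbert_space R).
Local Notation e := (hbasis H).

Lemma hs_norm2E (C : H -> H) :
  hs_norm2 C = (\sum_(0 <= n <oo) (nrm (C (e n)) ^+ 2)%:E)%E.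
Proof. by []. Qed.

Lemma hs_nbhs_filter (C : H -> H) : Filter (hs_nbhs C).
Proof.
apply: filter_from_filter; first by exists 1; exact: ltr01.
move=> x y /= x0 y0; exists (Num.min x y); first by rewrite /= lt_min x0.
move=> D /= h; have m0 : 0 < Num.min x y by rewrite lt_min x0.
split; apply: (lt_le_trans h); rewrite lee_fin ler_pXn2r ?nnegrE ?(ltW m0) ?(ltW x0) ?(ltW y0) //.
  by rewrite ge_min lexx.
by rewrite ge_min lexx orbT.
Qed.

End HilbertSchmidtNbhs.

Section Det2Diagonal.
Context (R : realType) (H : hilbert_space R).
Local Notation rc := (real_complex R).
Local Notation "<< u , v >>" := (inner H u v).
Local Notation e := (hbasis H).
Hypothesis eb : orthonormal_basis e.
Variables (c : nat -> R[i]) (g : R).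
Hypothesis g0 : 0 < g.
Hypothesis cg : forall N, \sum_(n < N) cmod (c n) ^+ 2 <= g ^+ 2.
Hypothesis cnull : forall n, c n * nonnull e n = c n.

Let eo : orthonormal_seq e := eb.1.

Let c_bounded : bounded_seq c.
Proof. by exists g; exact: square_summable_le cg. Qed.

Lemma matcoef_diag i j : matcoef (diag e c) i j = (i == j)%:R * c i.
Proof.
rewrite /matcoef coef_diag //; have [->|ij] := eqVneq i j.
  by rewrite eo_diag // cnull mul1r.
by rewrite eo_off 1?eq_sym // mulr0 mul0r.
Qed.

Lemma hs_near_matcoef (D : H -> H) (eps : R) N :
  (hs_norm2 (fun u => D u - diag e c u)%R < (eps ^+ 2)%:E)%E ->
  \sum_(k < N) \sum_(l < N) cmod (matcoef D k l - (k == l)%:R * c k) ^+ 2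
    <= eps ^+ 2.
Proof.
rewrite hs_norm2E => /ltW h.
apply: (le_trans _ (nneseries_partial_le N _ h)) => [|n]; last exact: sqr_ge0.
rewrite exchange_big /=; apply: ler_sum => l _.
apply: (le_trans _ (bessel eo _ N)); apply: ler_sum => k _.
by rewrite inB -[<<diag e c (e l), e k>>]/(matcoef _ k l) matcoef_diag.
Qed.

Definition cut (M : nat) n : R[i] := if (n < M)%N then c n else 0.

Let cut_bounded M : bounded_seq (cut M).
Proof.
exists g => n; rewrite /cut; case: ifP => _; first exact: square_summable_le cg n.
by rewrite cmod0 ltW.
Qed.

Lemma trace_class_cut M : trace_class (diag e (cut M)).
Proof.
pose f n := (cut M n / rc (cmod (cut M n))) *: e n.
have phase n : cut M n / rc (cmod (cut M n)) * nonnull e n = cut M n / rc (cmod (cut M n)).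
  rewrite mulrAC; congr (_ / _); rewrite /cut; case: ifP => _; last by rewrite mul0r.
  exact: cnull.
exists (fun n => cmod (cut M n)), f, e; split.
- by move=> n; exact: cmod_ge0.
- apply: le_lt_trans (ltry (\sum_(n < M) cmod (c n))).
  apply: nneseries_le => [n|N]; first exact: cmod_ge0.
  have posc n : 0 <= cmod (cut M n) by exact: cmod_ge0.
  have [NM|/ltnW MN] := leqP N M.
    rewrite -(big_mkord xpredT (fun n => cmod (cut M n))).
    rewrite -(big_mkord xpredT (fun n => cmod (c n))) (big_cat_nat (leq0n N) NM) /=.
    rewrite -[leLHS]addr0 lerD //.
      rewrite !big_mkord; apply: ler_sum => n _.
      by rewrite /cut (leq_trans (ltn_ord n) NM).
    by apply: sumr_ge0 => n _; exact: cmod_ge0.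
  rewrite -(big_mkord xpredT (fun n => cmod (cut M n))).
  rewrite -(big_mkord xpredT (fun n => cmod (c n))) (big_cat_nat (leq0n M) MN) /=.
  rewrite [X in _ + X]big1_seq ?addr0.
    rewrite !big_mkord; apply: ler_sum => n _.
    by rewrite /cut ltn_ord.
  move=> n; rewrite mem_index_iota => /andP[_ /andP[Mn _]].
  by rewrite /cut ltnNge Mn cmod0.
- move=> k l; rewrite inZ inZr.
  have [<-|kl] := eqVneq k l; last by rewrite eo_off // !mulr0.
  rewrite eo_diag // /f /=; have [c0|c0] := eqVneq (cut M k) 0.
    by rewrite c0 mul0r scale0r eqxx mul0r.
  have p0 : cmod (cut M k) != 0 by rewrite cmod_eq0.
  have rp0 : rc (cmod (cut M k)) != 0 by rewrite (inj_eq (@complexI _) _ 0).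
  have n1 : nonnull e k = 1.
    have : cut M k * nonnull e k = cut M k.
      by rewrite /cut; case: ifP => _; rewrite ?mul0r.
    by rewrite -[RHS]mulr1 => /(mulfI c0).
  have en : e k != 0.
    by move: n1; rewrite /nonnull; case: (e k != 0) => // /eqP; rewrite eq_sym oner_eq0.
  rewrite n1 mulr1 mul_conj_sqr cmodM cmodV cmod_rc ger0_norm ?cmod_ge0 // divff //.
  by rewrite expr1n scaler_eq0 mulf_eq0 invr_eq0 (negPf c0) (negPf rp0) (negPf en).
- exact: eo.
move=> u; have -> : series (fun n => (rc (cmod (cut M n)) * <<u, e n>>) *: f n) =
    series (fun n => (cut M n * <<u, e n>>) *: e n).
  apply/funext => N; apply: eq_bigr => n _; rewrite /f scalerA; congr (_ *: _).
  have [->|c0] := eqVneq (cut M n) 0; first by rewrite !mul0r mulr0.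
  have rp0 : rc (cmod (cut M n)) != 0 by rewrite (inj_eq (@complexI _) _ 0) cmod_eq0.
  by rewrite mulrC -mulrA mulKf // mulrC.
apply: riesz_fischer => //; have [K cK] := cut_bounded M.
by exists ((K * nrm u) ^+ 2); exact: square_summable_diag.
Qed.

Lemma hs_norm2_cut (eps : R) : 0 < eps ->
  exists M, (hs_norm2 (fun u => diag e (cut M) u - diag e c u)%R < (eps ^+ 2)%:E)%E.
Proof.
move=> eps0; pose A N := \sum_(n < N) cmod (c n) ^+ 2.
have ndA : nondecreasing_seq A.
  by apply/nondecreasing_seqP => n; rewrite /A big_ord_recr /= lerDl sqr_ge0.
have cA : cvgn A.
  apply: nondecreasing_is_cvgn => //; exists (g ^+ 2) => _ [n _ <-].
  exact: cg.
have leA n : A n <= limn A by exact: nondecreasing_cvgn_le.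
have /cvgrPdist_lt/(_ _ (exprn_gt0 2 eps0))[M _ /(_ M (leqnn M))] := cA.
move=> /= lt; exists M.
apply: le_lt_trans (_ : ((limn A - A M)%:E < _)%E); last first.
  by rewrite lte_fin (le_lt_trans (ler_norm _)).
rewrite hs_norm2E; apply: nneseries_le => [n|N]; first exact: sqr_ge0.
have term n : nrm (diag e (cut M) (e n) - diag e c (e n)) ^+ 2 <=
    if (n < M)%N then 0 else cmod (c n) ^+ 2.
  rewrite !diag_e // -scalerBl nrmZ /cut; case: ifP => _.
    by rewrite subrr cmod0 mul0r expr0n.
  rewrite sub0r cmodN exprMn ler_piMr ?sqr_ge0 // expr_le1 ?nrm_ge0 //.
  exact: orthonormal_nrm_le1.
apply: (@le_trans _ _ (\sum_(n < N) if (n < M)%N then 0 else cmod (c n) ^+ 2)).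
  by apply: ler_sum => n _; exact: term.
have [NM|/ltnW MN] := leqP N M.
  rewrite big1 ?subr_ge0 // => n _.
  by rewrite (leq_trans (ltn_ord n) NM).
apply: (le_trans _ (lerB (leA N) (lexx _))).
rewrite /A -!(big_mkord xpredT (fun n => cmod (c n) ^+ 2)).
rewrite -(big_mkord xpredT (fun n => if (n < M)%N then 0 else cmod (c n) ^+ 2)).
rewrite (big_cat_nat (leq0n M) MN) [in leRHS](big_cat_nat (leq0n M) MN) /=.
rewrite [X in X + _ <= _]big1_seq => [|n]; last first.
  by rewrite mem_index_iota => /andP[_ /andP[_ ->]].
rewrite add0r addrAC subrr add0r; apply: ler_sum_nat => n /andP[Mn _].
by rewrite ltnNge Mn.
Qed.

Lemma det2_diag (kap : R) :
  (forall n, 1 + c n != 0) -> (forall n, cmod (1 + c n)^-1 <= kap) ->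
  (regprod c : nat -> R[i]^o) @ \oo --> (det2_1p (diag e c) : R[i]^o).
Proof.
move=> c1 ck; have kap0 : 0 <= kap by rewrite (le_trans (cmod_ge0 _) (ck 0%N)).
have cr := regprod_cvg g0 cg; set L := limn (regprod c : nat -> R[i]^o).
suff -> : det2_1p (diag e c) = L by exact: cr.
have FF := hs_nbhs_filter (diag e c).
have PF : ProperFilter (within (@trace_class R H) (hs_nbhs (diag e c))).
  apply: Build_ProperFilter_ex => P [x x0 xP].
  have [M hM] := hs_norm2_cut x0.
  exists (diag e (cut M)); apply: xP => //; exact: trace_class_cut.
apply: (cvg_lim (@norm_hausdorff _ R[i]^o)).
apply/cvg_cmodP => d d0.
have [B B0 regB] := regprod_bounded g0 cg.
pose C := B * ((18 + 3 * g) * kap) + 4 * kap + 2 * kap * g + 1.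
have s1 : 0 <= B * ((18 + 3 * g) * kap).
  by rewrite !mulr_ge0 // addr_ge0 // mulr_ge0 // ltW.
have s2 : 0 <= kap * g by rewrite mulr_ge0 // ltW.
have C0 : 0 < C by rewrite /C; lra.
pose eps := Num.min 1 (d / 2) / C.
have m0 : 0 < Num.min 1 (d / 2) by rewrite lt_min ltr01 divr_gt0.
have eps0 : 0 < eps by rewrite divr_gt0.
have epsC : C * eps = Num.min 1 (d / 2) by rewrite /eps mulrC divfK // gt_eqF.
have eps1 : C * eps <= 1 by rewrite epsC ge_min lexx.
have epsd : C * eps <= d / 2 by rewrite epsC ge_min lexx orbT.
have mono x : x <= C -> x * eps <= C * eps by move=> xC; rewrite ler_wpM2r // ltW.
exists eps => // D /= hD tD.
have near N : cmod (\det (1%:M + trunc_mx (matcoef D) N) *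
    cexp (- \sum_(n < N) matcoef D n n) - regprod c N) <= d / 2.
  have tE : \sum_(n < N) matcoef D n n = \tr (trunc_mx (matcoef D) N).
    by apply: eq_bigr => n _; rewrite mxE.
  rewrite tE -/(regdet _).
  apply: le_trans (regdet_perturb (kap := kap) g0 eps0 _ _ (cg N) _ kap0 _ _) _ => //.
  - apply: (le_trans _ (hs_near_matcoef N hD)).
    by apply: ler_sum => k _; apply: ler_sum => l _; rewrite mxE.
  - have : 4 * kap * eps <= C * eps by apply: mono; rewrite /C; lra.
    by lra.
  - have : 2 * kap * g * eps <= C * eps by apply: mono; rewrite /C; lra.
    by lra.
  apply: le_trans (_ : B * ((18 + 3 * g) * kap * eps) <= _).
    have cc : 0 <= (18 + 3 * g) * kap * eps.
      have g18 : 0 <= 18 + 3 * g by move: (ltW g0) => ?; lra.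
      exact: mulr_ge0 (mulr_ge0 g18 kap0) (ltW eps0).
    by rewrite ler_wpM2r //; exact: regB.
  rewrite mulrA (le_trans _ epsd) //; apply: mono; rewrite /C; lra.
have lim := trace_class_det eo tD.
have lim' : ((fun N => cmod (\det (1%:M + trunc_mx (matcoef D) N) *
    cexp (- \sum_(n < N) matcoef D n n) - regprod c N)) @ \oo) -->
    cmod (det1p D * cexp (- trace D) - L).
  by apply: cvg_cmod; apply: cvgcB lim _; exact: cr.
rewrite cmodC (le_lt_trans (y := d / 2)) //; last by rewrite ltr_pdivrMr // ltr_pMr // ltr1n.
by apply: (cvgr_to_le lim'); near=> N; exact: near.
Unshelve. all: by end_near. Qed.

End Det2Diagonal.

(** * The Hilbert space of square-summable sequences *)

Section SquareSummable.
Context (R : realType).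

Definition l2_pred : {pred nat -> R[i]} :=
  mem [set f : nat -> R[i] | square_summable f].

Lemma l2_submod_closed : submod_closed l2_pred.
Proof.
split; first by rewrite inE; exists 0 => N; rewrite big1 // => k _; rewrite cmod0 expr0n.
move=> a f h; rewrite !inE => -[K fK] [L hL].
exists (2 * (cmod a ^+ 2 * K) + 2 * L) => N.
apply: le_trans (_ : 2 * (cmod a ^+ 2 * \sum_(n < N) cmod (f n) ^+ 2)
    + 2 * \sum_(n < N) cmod (h n) ^+ 2 <= _); last first.
  by rewrite lerD ?ler_wpM2l ?sqr_ge0.
rewrite !mulr_sumr -big_split /=; apply: ler_sum => n _.
have : cmod ((a *: f + h) n) <= cmod a * cmod (f n) + cmod (h n).
  by rewrite (le_trans (cmodD _ _)) // cmodM.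
have := cmod_ge0 ((a *: f + h) n); have := cmod_ge0 a; have := cmod_ge0 (f n).
set x := cmod _ => x0; set y := cmod _ => y0; set z := cmod _ => z0.
set w := cmod _ => h1; have := sqr_ge0 (y * x - w); nra.
Qed.

HB.instance Definition _ := GRing.isSubmodClosed.Build _ _ l2_pred l2_submod_closed.

Record l2 := L2 { l2val :> nat -> R[i]; l2valP : l2val \in l2_pred }.
HB.instance Definition _ := [isSub for l2val].
HB.instance Definition _ := [Choice of l2 by <:].
HB.instance Definition _ := [SubChoice_isSubLmodule of l2 by <:].

Implicit Types (f h : l2) (a : R[i]).

Lemma l2D f h n : (f + h) n = f n + h n. Proof. by []. Qed.
Lemma l2Z a f n : (a *: f) n = a * f n. Proof. by []. Qed.
Lemma l2_ext f h : (forall n, f n = h n) -> f = h.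
Proof. by move=> fh; apply/val_inj/funext. Qed.

Lemma l2_summable f : square_summable f.
Proof. by have := l2valP f; rewrite inE. Qed.

Definition partial2 f N : R := \sum_(n < N) cmod (f n) ^+ 2.

Lemma partial2_nd f : nondecreasing_seq (partial2 f).
Proof.
by apply/nondecreasing_seqP => n; rewrite /partial2 big_ord_recr /= lerDl sqr_ge0.
Qed.

Lemma partial2_cvg f : cvgn (partial2 f).
Proof.
have [K fK] := l2_summable f; apply: nondecreasing_is_cvgn; first exact: partial2_nd.
by exists K => _ [n _ <-]; exact: fK.
Qed.

Definition sum2 f : R := limn (partial2 f).

Lemma partial2_le f N : partial2 f N <= sum2 f.
Proof. by apply: nondecreasing_cvgn_le; [exact: partial2_nd|exact: partial2_cvg]. Qed.

Lemma sum2_le f (K : R) : (forall N, partial2 f N <= K) -> sum2 f <= K.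
Proof. by move=> fK; apply: limr_le; [exact: partial2_cvg|exact: nearW]. Qed.

Lemma sum2_ge0 f : 0 <= sum2 f.
Proof. by rewrite (le_trans _ (partial2_le f 0)) // /partial2 big_ord0. Qed.

Lemma sum2_eq0 f : sum2 f = 0 -> f = 0.
Proof.
move=> f0; apply: l2_ext => n; apply/eqP; rewrite -cmod_eq0 -sqrf_eq0.
rewrite eq_le sqr_ge0 andbT -f0 (le_trans _ (partial2_le f n.+1)) //.
by rewrite /partial2 big_ord_recr /= lerDr sumr_ge0 // => k _; exact: sqr_ge0.
Qed.

Definition l2_norm f : R[i] := real_complex R (Num.sqrt (sum2 f)).

Lemma l2_normD f h : l2_norm (f + h) <= l2_norm f + l2_norm h.
Proof.
rewrite /l2_norm -rmorphD lecR; set x := Num.sqrt _; set y := Num.sqrt (sum2 h).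
have x0 : 0 <= y by exact: sqrtr_ge0.
have y0 : 0 <= Num.sqrt (sum2 f) by exact: sqrtr_ge0.
rewrite -[leRHS]ger0_norm ?addr_ge0 // -sqrtr_sqr /x ler_sqrt ?sqr_ge0 //.
have [f0|f0] := eqVneq (sum2 f) 0.
  rewrite {1}(sum2_eq0 f0) add0r -{1}(sqr_sqrtr (sum2_ge0 h)).
  by rewrite ler_pXn2r ?nnegrE ?addr_ge0 // lerDr.
have [h0|h0] := eqVneq (sum2 h) 0.
  rewrite {1}(sum2_eq0 h0) addr0 -{1}(sqr_sqrtr (sum2_ge0 f)).
  by rewrite ler_pXn2r ?nnegrE ?addr_ge0 // lerDl.
set p := Num.sqrt (sum2 f); have p0 : 0 < p by rewrite sqrtr_gt0 lt_def f0 sum2_ge0.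
have q0 : 0 < y by rewrite sqrtr_gt0 lt_def h0 sum2_ge0.
have pE : sum2 f = p ^+ 2 by rewrite sqr_sqrtr ?sum2_ge0.
have yE : sum2 h = y ^+ 2 by rewrite sqr_sqrtr ?sum2_ge0.
apply: sum2_le => N.
apply: le_trans (_ : (1 + y / p) * partial2 f N + (1 + p / y) * partial2 h N <= _).
  rewrite /partial2 !mulr_sumr -big_split /=; apply: ler_sum => n _.
  have : cmod ((f + h) n) <= cmod (f n) + cmod (h n) by exact: cmodD.
  have := cmod_ge0 ((f + h) n); set w := cmod _ => w0.
  set a := cmod (f n); set b := cmod (h n) => wab.
  apply: le_trans (_ : (a + b) ^+ 2 <= _).
    by rewrite ler_pXn2r ?nnegrE // (le_trans w0).
  rewrite -subr_ge0.
  have -> : (1 + y / p) * a ^+ 2 + (1 + p / y) * b ^+ 2 - (a + b) ^+ 2 =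
      (y * a - p * b) ^+ 2 / (p * y) by field; rewrite !gt_eqF.
  by rewrite divr_ge0 ?sqr_ge0 // mulr_ge0.
apply: le_trans (_ : (1 + y / p) * sum2 f + (1 + p / y) * sum2 h <= _).
  by rewrite lerD // ler_wpM2l ?partial2_le // addr_ge0 // divr_ge0 // ltW.
have -> : (1 + y / p) * sum2 f + (1 + p / y) * sum2 h = (p + y) ^+ 2; last by [].
by rewrite pE yE; field; rewrite !gt_eqF.
Qed.

Lemma l2_normZ a f : l2_norm (a *: f) = `|a| * l2_norm f.
Proof.
rewrite /l2_norm cmodE -rmorphM; congr (real_complex _ _).
have -> : sum2 (a *: f) = cmod a ^+ 2 * sum2 f.
  rewrite /sum2; have -> : partial2 (a *: f) = (fun N => cmod a ^+ 2 * partial2 f N).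
    apply/funext => N; rewrite /partial2 mulr_sumr; apply: eq_bigr => n _.
    by rewrite l2Z cmodM exprMn.
  by apply/cvg_lim => //; apply: cvgM; [exact: cvg_cst|exact: partial2_cvg].
by rewrite sqrtrM ?sqr_ge0 // sqrtr_sqr ger0_norm // cmod_ge0.
Qed.

Lemma l2_norm0_eq0 f : l2_norm f = 0 -> f = 0.
Proof.
move=> /eqP; rewrite /l2_norm (inj_eq (@complexI _) _ 0) sqrtr_eq0 => f0.
by apply: sum2_eq0; apply/eqP; rewrite eq_le f0 sum2_ge0.
Qed.

HB.instance Definition _ :=
  @Lmodule_isNormed.Build R[i] l2 l2_norm l2_normD l2_normZ l2_norm0_eq0.

Lemma nrm_l2 f : nrm f = Num.sqrt (sum2 f).
Proof. by []. Qed.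

Lemma nrm_l2_sqr f : nrm f ^+ 2 = sum2 f.
Proof. by rewrite nrm_l2 sqr_sqrtr ?sum2_ge0. Qed.

Lemma cmod_le_nrm f n : cmod (f n) <= nrm f.
Proof.
rewrite -(@ler_pXn2r _ 2) ?nnegrE ?cmod_ge0 ?nrm_ge0 // nrm_l2_sqr.
rewrite (le_trans _ (partial2_le f n.+1)) // /partial2 big_ord_recr /=.
by rewrite lerDr sumr_ge0 // => k _; exact: sqr_ge0.
Qed.

Definition l2_partial f h N : R[i] := \sum_(n < N) f n * (h n)^*.

Lemma l2_partial_cvg f h : cvgn (l2_partial f h : nat -> R[i]^o).
Proof.
apply: (@complex_cvg_dominated _ _ (partial2 f \+ partial2 h)).
  by apply: is_cvgD; exact: partial2_cvg.
move=> m n mn; rewrite /l2_partial /partial2 /=.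
rewrite -!(big_mkord xpredT (fun n => f n * (h n)^*)).
rewrite -!(big_mkord xpredT (fun n => cmod (f n) ^+ 2)).
rewrite -!(big_mkord xpredT (fun n => cmod (h n) ^+ 2)).
rewrite !(big_cat_nat (leq0n m) mn) /= addrAC subrr add0r.
rewrite opprD addrACA [X in X + _]addrAC [X in _ + X]addrAC !subrr !add0r.
rewrite -big_split /=; apply: le_trans (cmod_sum _ _ _) _; apply: ler_sum => k _.
rewrite cmodM cmod_conj; have := sqr_ge0 (cmod (f k) - cmod (h k)).
by have := sqr_ge0 (cmod (f k) + cmod (h k)); nra.
Qed.

Definition l2_inner f h : R[i] := limn (l2_partial f h : nat -> R[i]^o).

Lemma l2_innerP f h (l : R[i]) :
  (l2_partial f h : nat -> R[i]^o) @ \oo --> (l : R[i]^o) -> l2_inner f h = l.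
Proof. by move=> hl; exact: (cvgc_unique (@l2_partial_cvg f h) hl). Qed.

Lemma l2_inner_linear h a f1 f2 :
  l2_inner (a *: f1 + f2) h = a * l2_inner f1 h + l2_inner f2 h.
Proof.
apply: l2_innerP.
have -> : l2_partial (a *: f1 + f2) h = (fun N => a * l2_partial f1 h N + l2_partial f2 h N).
  apply/funext => N; rewrite /l2_partial mulr_sumr -big_split; apply: eq_bigr => n _.
  by rewrite l2D l2Z mulrDl mulrA.
apply: cvgcD; last exact: l2_partial_cvg.
by apply: cvgcM; [exact: cvgc_cst|exact: l2_partial_cvg].
Qed.

Lemma l2_inner_conj f h : l2_inner f h = (l2_inner h f)^*.
Proof.
apply: l2_innerP; apply/cvg_cmodP => d d0.
have /cvg_cmodP/(_ d d0) := @l2_partial_cvg h f; apply: filterS => N.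
have -> : l2_partial f h N = (l2_partial h f N)^*.
  rewrite /l2_partial rmorph_sum; apply: eq_bigr => n _.
  by rewrite rmorphM /= conjCK mulrC.
by rewrite -rmorphB cmod_conj.
Qed.

Lemma l2_inner_bilinear : bilinear_for (GRing.Scale.Law.clone _ _ ( *%R ) _)
  (GRing.Scale.Law.clone _ _ (Num.conj \; *%R ) _) l2_inner.
Proof.
split=> [h|f] a h1 h2 /=; first exact: l2_inner_linear.
by rewrite l2_inner_conj l2_inner_linear rmorphD rmorphM /= -!l2_inner_conj.
Qed.

HB.instance Definition _ := bilinear_isBilinear.Build R[i] l2 l2 R[i]
  (GRing.Scale.Law.clone _ _ ( *%R ) _) (GRing.Scale.Law.clone _ _ (Num.conj \; *%R ) _)
  l2_inner l2_inner_bilinear.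

Lemma l2_inner_hermitian f h : l2_inner f h = (-1) ^+ false * (l2_inner h f)^*.
Proof. by rewrite expr0 mul1r -l2_inner_conj. Qed.

HB.instance Definition _ := isHermitianSesquilinear.Build R[i] l2 false Num.conj
  l2_inner l2_inner_hermitian.

Lemma l2_inner_norm f : l2_inner f f = `|f| ^+ 2.
Proof.
rewrite nrmE -rmorphXn /= nrm_l2_sqr; apply: l2_innerP.
have -> : l2_partial f f = (fun N => real_complex R (partial2 f N)).
  apply/funext => N; rewrite /partial2 rmorph_sum; apply: eq_bigr => n _.
  exact: mul_conj_sqr.
apply/cvg_cmodP => d d0.
have /cvgrPdist_lt/(_ d d0) := @partial2_cvg f; apply: filterS => N.
by rewrite -rmorphB cmod_rc.
Qed.

Lemma l2_inner_gt0 f : f != 0 -> 0 < l2_inner f f.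
Proof. by move=> f0; rewrite l2_inner_norm exprn_gt0 // normr_gt0. Qed.

HB.instance Definition _ := isDotProduct.Build R[i] l2 l2_inner l2_inner_gt0.

Definition l2_dot : {dot l2 for Num.conj} := l2_inner.

Lemma geom_cvg : (fun k => - (4 / 2 ^+ k) : R) @ \oo --> (0 : R).
Proof.
rewrite -oppr0; apply: cvgN; rewrite -(mulr0 4).
apply: cvgM; first exact: cvg_cst.
have -> : (fun k => (2 ^+ k)^-1 : R) = (fun k => 2^-1 ^+ k).
  by apply/funext => k; rewrite exprVn.
by apply: cvg_expr; rewrite ger0_norm // invf_lt1 // ltr1n.
Qed.

Lemma l2_complete (F : set_system l2) : ProperFilter F -> cauchy F -> cvg F.
Proof.
move=> PF /cauchyP cF.
have /choice[x xF] : forall k, exists y : l2, F (ball y (real_complex R (2 ^+ k)^-1)).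
  by move=> k; apply: cF; rewrite ltcR invr_gt0 exprn_gt0.
have ballE (y z : l2) k : ball y (real_complex R (2 ^+ k)^-1) z = (nrm (y - z) < (2 ^+ k)^-1).
  by rewrite -ball_normE /= nrmE ltcR.
pose A k : R := - (4 / 2 ^+ k).
have step k : nrm (x k.+1 - x k) <= A k.+1 - A k.
  have [z [z1 z2]] := filter_ex (filterI (xF k) (xF k.+1)).
  rewrite ballE in z1; rewrite ballE nrmC in z2.
  have -> : x k.+1 - x k = (x k.+1 - z) + (z - x k) by rewrite addrA subrK.
  apply: le_trans (nrmD _ _) _; rewrite nrmC in z1; rewrite nrmC in z2.
  have -> : A k.+1 - A k = 2 * (2 ^+ k)^-1.
    by rewrite /A exprS; field; rewrite expf_neq0.
  have : (2 ^+ k.+1)^-1 <= (2 ^+ k)^-1 :> R.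
    by rewrite lef_pV2 ?posrE ?exprn_gt0 // ler_eXn2l ?ltr1n.
  by lra.
have xA m n : (m <= n)%N -> nrm (x n - x m) <= A n - A m.
  elim: n => [|n IH]; first by rewrite leqn0 => /eqP ->; rewrite !subrr nrm0.
  rewrite leq_eqVlt => /predU1P[->|]; first by rewrite !subrr nrm0.
  rewrite ltnS => /IH {}IH.
  have -> : x n.+1 - x m = (x n.+1 - x n) + (x n - x m) by rewrite addrA subrK.
  by apply: le_trans (nrmD _ _) _; have := step n; lra.
have cA : cvgn A by apply/cvg_ex; exists 0; exact: geom_cvg.
have cx j : cvgn ((fun k => x k j) : nat -> R[i]^o).
  apply: (complex_cvg_dominated cA) => m n mn; apply: le_trans (xA m n mn).
  exact: (cmod_le_nrm (x n - x m)).
pose f j : R[i] := limn ((fun k => x k j) : nat -> R[i]^o).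
have fx k N : \sum_(j < N) cmod (f j - x k j) ^+ 2 <= A k ^+ 2.
  have lim : (fun n => \sum_(j < N) cmod (x n j - x k j) ^+ 2) @ \oo -->
      \sum_(j < N) cmod (f j - x k j) ^+ 2.
    apply: (@cvgr_sum R nat \oo _ 'I_N _ (fun j n => cmod (x n j - x k j) ^+ 2)
      (fun j => cmod (f j - x k j) ^+ 2)) => j.
    have c1 : (fun n => cmod (x n j - x k j)) @ \oo --> cmod (f j - x k j).
      by apply: cvg_cmod; apply: (cvgcB (cx j)); exact: cvgc_cst.
    exact: (cvg_comp (fun n => cmod (x n j - x k j)) (fun y : R => y ^+ 2) c1 (@exprn_continuous R 2 _)).
  apply: (cvgr_to_le lim); near=> n; have kn : (k <= n)%N by near: n; exact: nbhs_infty_ge.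
  apply: le_trans (partial2_le (x n - x k) N) _; rewrite -nrm_l2_sqr.
  rewrite -[leRHS]sqrrN ler_pXn2r ?nnegrE ?nrm_ge0 ?opprK ?divr_ge0 ?exprn_ge0 //.
  apply: le_trans (xA k n kn) _; rewrite /A opprK gerDr oppr_le0.
  by rewrite divr_ge0 ?exprn_ge0.
have fl2 : f \in l2_pred.
  have fx0 : (fun j => f j - x 0%N j) \in l2_pred.
    by rewrite inE; exists (A 0%N ^+ 2); exact: fx.
  have -> : f = (fun j => f j - x 0%N j) + l2val (x 0%N).
    by apply/funext => j; rewrite [RHS]subrK.
  by rewrite rpredD // l2valP.
pose fl := L2 fl2.
have flx k : nrm (fl - x k) <= 4 / 2 ^+ k.
  rewrite -(@ler_pXn2r _ 2) ?nnegrE ?nrm_ge0 ?divr_ge0 ?exprn_ge0 //.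
  rewrite nrm_l2_sqr; apply: sum2_le => N; rewrite -sqrrN; exact: fx.
apply/cvg_ex; exists fl; apply/cvg_nrmP => d d0.
have /cvgrPdist_lt/(_ _ (divr_gt0 d0 (@ltr0n R 2))) := geom_cvg.
move=> [k _ /(_ k (leqnn k))]; rewrite /= opprK add0r ger0_norm ?divr_ge0 ?exprn_ge0 // => kd.
apply: filterS (xF k) => y; rewrite ballE => xy.
have -> : fl - y = (fl - x k) + (x k - y) by rewrite addrA subrK.
rewrite (le_lt_trans (nrmD _ _)) //; have := flx k.
have k0 : 0 < (2 ^+ k)^-1 :> R by rewrite invr_gt0 exprn_gt0.
by lra.
Unshelve. all: by end_near. Qed.

HB.instance Definition _ := Uniform_isComplete.Build l2 l2_complete.

Definition l2_space : hilbert_space R := @HilbertSpace R l2 l2_dot l2_inner_norm.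

End SquareSummable.

Section Dimension.
Context (R : realType) (H : hilbert_space R).
Local Notation rc := (real_complex R).
Local Notation "<< u , v >>" := (inner H u v).

Lemma parseval_finite (e : nat -> H) u N : orthonormal_basis e ->
  (forall n, (N <= n)%N -> e n = 0) ->
  nrm u ^+ 2 = \sum_(n < N) cmod <<u, e n>> ^+ 2.
Proof.
move=> eb eN; apply: (@complexI R); rewrite -in_sqr.
have c1 := @in_expansion _ _ _ eb u u; apply: (cvgc_unique c1).
apply/cvg_cmodP => d d0; exists N => // M /= NM.
have tail : \sum_(N <= n < M) <<u, e n>> * (<<u, e n>>)^* = 0.
  apply: big1_seq => n; rewrite mem_index_iota => /andP[_ /andP[Nn _]].
  by rewrite eN // in0r mul0r.
rewrite /series /= (big_cat_nat (leq0n N) NM) /= tail addr0.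
rewrite big_mkord rmorph_sum -sumrB big1 ?cmod0 // => n _.
by rewrite mul_conj_sqr subrr.
Qed.

(* Double counting of the squared inner products between the two families. *)
Lemma basis_nonnull_infinite (d e : nat -> H) :
  (forall k l, inner H (d k) (d l) = (k == l)%:R) -> orthonormal_basis e ->
  forall N, exists2 n, (N <= n)%N & e n != 0.
Proof.
move=> dd eb N; apply: contrapT => nE.
have eN n : (N <= n)%N -> e n = 0.
  by move=> Nn; apply/eqP; apply: contra_notT nE => en; exists n.
have d1 i : nrm (d i) ^+ 2 = 1.
  by apply: (@complexI R); rewrite -in_sqr dd eqxx.
have od : orthonormal_seq d.
  move=> i j; rewrite dd; congr (_%:R); case: (i == j) => //=.
  by rewrite -nrm_eq0 -sqrf_eq0 d1 oner_eq0.
have : \sum_(i < N.+1) nrm (d i) ^+ 2 <= N%:R.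
  under eq_bigr do rewrite (parseval_finite _ eb eN).
  have -> : N%:R = \sum_(n < N) (1 : R) by rewrite sumr_const card_ord.
  rewrite exchange_big /=.
  apply: ler_sum => n _; apply: le_trans (_ : nrm (e n) ^+ 2 <= _).
    apply: (le_trans _ (bessel od (e n) N.+1)); apply: ler_sum => i _.
    by rewrite in_conj cmod_conj.
  by rewrite expr_le1 ?nrm_ge0 // orthonormal_nrm_le1 //; exact: eb.1.
under eq_bigr do rewrite d1.
by rewrite sumr_const card_ord ler_nat ltnn.
Qed.

Lemma separable_basis (e : nat -> H) : orthonormal_basis e -> separable H.
Proof.
move=> eb; have eo : orthonormal_seq e := eb.1.
pose q (p : rat * rat) : R[i] := Complex (ratr p.1) (ratr p.2).
pose F (s : seq (rat * rat)) : H := \sum_(n < size s) q (nth (0, 0) s n) *: e n.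
exists (range F); first by apply: sub_countable (card_image_le _ _) _; exact: countableP.
move=> O [u Ou] oO.
have : nbhs u O by apply: open_nbhs_nbhs.
move=> /nbhs_ballP[_ /ltc_eq[r r0 ->] /= rO].
have r2 : 0 < r / 2 by rewrite divr_gt0.
have /cvg_nrmP/(_ _ r2)[N _ /(_ N (leqnn N)) /= uN] := @expansion _ _ _ eb u.
have rN : 0 < r / 2 / N.+1%:R / 2 by rewrite !divr_gt0.
have approx (z : R[i]) : exists p : rat * rat, cmod (z - q p) < r / 2 / N.+1%:R.
  case: z => a b.
  have la x : x < x + r / 2 / N.+1%:R / 2 by rewrite ltrDl.
  have [p1] := rat_in_itvoo (la a); rewrite in_itv /= => /andP[a1 a2].
  have [p2] := rat_in_itvoo (la b); rewrite in_itv /= => /andP[b1 b2].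
  exists (p1, p2); apply: le_lt_trans (cmod_le_ReIm _) _ => /=.
  rewrite [ltRHS]splitr; move: (r / 2 / N.+1%:R / 2) rN a1 a2 b1 b2 => t t0 a1 a2 b1 b2.
  by rewrite ltrD // ltr_norml; apply/andP; split; lra.
have /choice[p pP] : forall n, exists p : rat * rat, cmod (<<u, e n>> - q p) < r / 2 / N.+1%:R.
  by move=> n; exact: approx.
pose s := mkseq p N.
exists (F s); split; last by exists s.
apply: rO; rewrite -ball_normE /= nrmE ltcR.
have -> : u - F s = (u - series (fun n => <<u, e n>> *: e n) N)
    + (series (fun n => <<u, e n>> *: e n) N - F s) by rewrite addrA subrK.
apply: le_lt_trans (nrmD _ _) _; rewrite [ltRHS](splitr r) ltrD //.
have -> : series (fun n => <<u, e n>> *: e n) N - F s =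
    \sum_(n < N) (<<u, e n>> - q (p n)) *: e n.
  rewrite /series /= big_mkord /F size_mkseq -sumrB; apply: eq_bigr => n _.
  by rewrite nth_mkseq // scalerBl.
apply: le_lt_trans (nrm_sum _ _ _) _.
apply: le_lt_trans (_ : \sum_(n < N) r / 2 / N.+1%:R < _).
  apply: ler_sum => n _; rewrite nrmZ -[leRHS]mulr1 ler_pM ?cmod_ge0 ?nrm_ge0 //.
    exact/ltW.
  exact: orthonormal_nrm_le1.
rewrite sumr_const card_ord -[_ *+ N]mulr_natr mulrAC ltr_pdivrMr //.
by rewrite ltr_pM2l // ltr_nat.
Qed.

End Dimension.

Section L2Basis.
Context (R : realType).
Local Notation "<< u , v >>" := (inner (l2_space R) u v).

Lemma l2_delta_subproof n : (fun m => (m == n)%:R : R[i]) \in @l2_pred R.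
Proof.
rewrite inE; exists 1 => N; apply: le_trans (_ : \sum_(m < N) (m == n :> nat)%:R <= _).
  apply: ler_sum => m _; case: (m == n :> nat); first by rewrite cmod1 expr1n.
  by rewrite cmod0 expr0n.
have [nN|Nn] := ltnP n N.
  rewrite (bigD1 (Ordinal nN)) //= eqxx big1 ?addr0 // => m.
  by rewrite -val_eqE /= => /negPf ->.
rewrite big1 // => m _; case: eqP => // mn.
by have := ltn_ord m; rewrite mn ltnNge Nn.
Qed.

Definition l2_delta n : l2_space R := L2 (l2_delta_subproof n).

Lemma inner_delta (f : l2_space R) n : <<f, l2_delta n>> = (f : l2 R) n.
Proof.
apply: l2_innerP; apply/cvg_cmodP => d d0; exists n.+1 => // N /= nN.
rewrite /l2_partial (bigD1 (Ordinal nN)) //= eqxx rmorph1 mulr1 big1 ?addr0.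
  by rewrite subrr cmod0.
by move=> m; rewrite -val_eqE /= => /negPf ->; rewrite rmorph0 mulr0.
Qed.

Lemma inner_delta2 i j : << l2_delta i, l2_delta j>> = (i == j)%:R.
Proof. by rewrite inner_delta /= eq_sym. Qed.

Lemma l2_delta_basis : orthonormal_basis l2_delta.
Proof.
split=> [i j|f f0]; last by apply: l2_ext => n; rewrite -inner_delta f0.
have -> : l2_delta i != 0; last by rewrite andbT inner_delta2.
apply/eqP => d0; have := inner_delta2 i i; rewrite d0 in0 eqxx.
by move/eqP; rewrite eq_sym oner_eq0.
Qed.

Lemma hbasis_l2 : orthonormal_basis (hbasis (l2_space R)).
Proof.
by apply: (@xgetPex _ (fun=> 0) [set e | orthonormal_basis e]); exists l2_delta; exact: l2_delta_basis.
Qed.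

Lemma hbasis_l2_nonnull N : exists2 n, (N <= n)%N & hbasis (l2_space R) n != 0.
Proof. exact: basis_nonnull_infinite inner_delta2 hbasis_l2 N. Qed.

End L2Basis.

(** * One stage of eigenvalues *)

Section Stage.
Context (R : realType).
Local Notation rc := (real_complex R).
Implicit Types (p : R * R) (z : R[i]) (s t : seq (R * R)).

(* A point p = (b, x) stands for the eigenvalue b of B, moved to b + x by X. *)
Definition point_coef p z : R[i] := rc p.2 / (rc p.1 - z).
Definition point_factor p z : R :=
  cmod ((1 + point_coef p z) * cexp (- point_coef p z)).
Definition points_factor s z : R := \prod_(p <- s) point_factor p z.
Definition points_sqr s : R := \sum_(p <- s) p.2 ^+ 2.

Lemma Im_sub_rc (b : R) z : complex.Im (rc b - z) = - complex.Im z.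
Proof. by case: z => [u v] /=; rewrite sub0r. Qed.

Lemma Re_sub_rc (b : R) z : complex.Re (rc b - z) = b - complex.Re z.
Proof. by case: z. Qed.

Lemma sub_rc_neq0 (b : R) z : 0 < complex.Im z -> rc b - z != 0.
Proof.
move=> z0; apply/eqP => /(congr1 (@complex.Im R)); rewrite Im_sub_rc /=.
by move/eqP; rewrite oppr_eq0 gt_eqF.
Qed.

Lemma Im_le_sub_rc (b : R) z : complex.Im z <= cmod (rc b - z).
Proof.
have := Im_le_cmod (rc b - z); rewrite Im_sub_rc normrN.
exact: le_trans (ler_norm _).
Qed.

Lemma cmod_point_coef p z : 0 < complex.Im z ->
  cmod (point_coef p z) <= `|p.2| / complex.Im z.
Proof.
move=> z0; rewrite /point_coef cmodM cmodV cmod_rc ler_wpM2l //.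
have h := Im_le_sub_rc p.1 z.
by rewrite lef_pV2 ?posrE // (lt_le_trans z0).
Qed.

(* e^(-u) (1 + u) >= e^(-2 u^2) follows from e^(2 u^2 - u) >= 1 + 2 u^2 - u. *)
Lemma expR_quad_lower (u : R) : - 2^-1 <= u ->
  expR (- (2 * u ^+ 2)) <= (1 + u) * expR (- u).
Proof.
move=> u1; set q := 2 * u ^+ 2; have h := expR_ge1Dx (q - u).
have h2 : 1 <= (1 + u) * expR (q - u).
  apply: le_trans (_ : (1 + u) * (1 + (q - u)) <= _); last first.
    by rewrite ler_wpM2l //; lra.
  have : 0 <= u ^+ 2 * (1 + 2 * u) by rewrite mulr_ge0 ?sqr_ge0 //; lra.
  by rewrite /q expr2; lra.
have := ler_wpM2l (expR_ge0 (- q)) h2.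
by rewrite mulr1 mulrCA -expRD addrA addNr add0r.
Qed.

Lemma factor_lower (w : R[i]) : - 2^-1 <= complex.Re w ->
  expR (- (2 * complex.Re w ^+ 2)) <= cmod ((1 + w) * cexp (- w)).
Proof.
move=> u1; apply: le_trans (expR_quad_lower u1) _.
rewrite cmodM cmod_cexp; have -> : complex.Re (- w) = - complex.Re w by case: w {u1}.
rewrite ler_wpM2r ?expR_ge0 // (le_trans _ (Re_le_cmod _)) //.
by rewrite ReD /= ler_norm.
Qed.

Lemma points_factor_small s z (y : R) : complex.Im z = y -> 0 < y ->
  32 * points_sqr s <= y ^+ 2 -> 2^-1 <= points_factor s z.
Proof.
move=> zy y0 sy.
have small : {in s, forall p, expR (- (2 * (p.2 ^+ 2 / y ^+ 2))) <= point_factor p z}.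
  move=> p ps; have h : `|complex.Re (point_coef p z)| <= `|p.2| / y.
    by rewrite (le_trans (Re_le_cmod _)) // -zy cmod_point_coef // zy.
  have p2 : p.2 ^+ 2 <= points_sqr s.
    rewrite /points_sqr (big_rem p) //= lerDl sumr_ge0 // => q _; exact: sqr_ge0.
  have hp : `|p.2| / y <= 2^-1.
    rewrite ler_pdivrMr // -(@ler_pXn2r _ 2) ?nnegrE ?mulr_ge0 ?(ltW y0) //.
    by rewrite real_normK ?num_real // exprMn; have := sqr_ge0 y; have -> : (2^-1 : R) ^+ 2 = 4^-1 by [field]; lra.
  have hr : - 2^-1 <= complex.Re (point_coef p z).
    by move: (le_trans h hp); rewrite ler_norml => /andP[].
  apply: le_trans (factor_lower hr); rewrite ler_expR lerN2 ler_pM2l // -expr_div_n.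
  rewrite -real_normK ?num_real // -[leRHS]real_normK ?num_real //.
  by rewrite ler_pXn2r ?nnegrE // normrM normfV (gtr0_norm y0).
apply: le_trans (_ : expR (- (2 * (points_sqr s / y ^+ 2))) <= _).
  have y2 : 0 < y ^+ 2 by rewrite exprn_gt0.
  have h1 : points_sqr s / y ^+ 2 <= 32^-1.
    by rewrite ler_pdivrMr // mulrC ler_pdivlMr // mulrC.
  apply: le_trans (expR_ge1Dx _); lra.
rewrite /points_factor /points_sqr mulr_suml mulr_sumr -sumrN expR_sum.
rewrite big_seq [leRHS]big_seq; apply: ler_prod => p ps.
by rewrite expR_ge0 small.
Qed.

Lemma points_factor_old s (eta : R) : 0 < eta -> {in s, forall p, 0 <= p.1 <= 1} ->
  exists2 K : R, 0 < K & forall (lam : R) z, 0 <= lam <= 1 ->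
    {in s, forall p, eta <= `|lam - p.1| /\ eta <= `|lam - (p.1 + p.2)|} ->
    0 < complex.Im z -> cmod (rc lam - z) <= eta / 2 -> cmod (rc lam - z) <= 1 ->
    K <= points_factor s z.
Proof.
move=> eta0; elim: s => [|p s IH] sb.
  by exists 1 => // lam z _ _ _ _ _; rewrite /points_factor big_nil.
have [K K0 IHK] : exists2 K : R, 0 < K & forall (lam : R) z, 0 <= lam <= 1 ->
    {in s, forall p, eta <= `|lam - p.1| /\ eta <= `|lam - (p.1 + p.2)|} ->
    0 < complex.Im z -> cmod (rc lam - z) <= eta / 2 -> cmod (rc lam - z) <= 1 ->
    K <= points_factor s z.
  by apply: IH => q qs; apply: sb; rewrite inE qs orbT.
pose k := (eta / 2 / 2) * expR (- (`|p.2| / (eta / 2))).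
have k0 : 0 < k by rewrite mulr_gt0 ?expR_gt0 // !divr_gt0.
exists (k * K); first exact: mulr_gt0.
move=> lam z lam01 far z0 zl zl1; rewrite /points_factor big_cons ler_pM ?(ltW k0) ?(ltW K0) //; last first.
  by apply: (IHK lam) => // q qs; apply: far; rewrite inE qs orbT.
have [f1 f2] := far p (mem_head _ _); have b01 := sb p (mem_head _ _).
have dist b : eta <= `|lam - b| -> eta / 2 <= cmod (rc b - z).
  move=> h; have -> : rc b - z = (rc b - rc lam) + (rc lam - z) by rewrite addrA subrK.
  have := cmodBB (rc b - rc lam) (- (rc lam - z)); rewrite opprK cmodN.
  by rewrite -rmorphB cmod_rc distrC; lra.
have bz2 : cmod (rc p.1 - z) <= 2.
  have -> : rc p.1 - z = (rc p.1 - rc lam) + (rc lam - z) by rewrite addrA subrK.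
  rewrite (le_trans (cmodD _ _)) // -rmorphB cmod_rc.
  have : `|p.1 - lam| <= 1 by rewrite ler_norml; lra.
  by lra.
have bz0 : rc p.1 - z != 0 by exact: sub_rc_neq0.
have bzp : 0 < cmod (rc p.1 - z) by rewrite cmod_gt0.
have e2 : 0 < eta / 2 by rewrite divr_gt0.
rewrite /point_factor cmodM cmod_cexp ler_pM ?expR_ge0 //; first by rewrite !divr_ge0 // ltW.
  have -> : 1 + point_coef p z = (rc (p.1 + p.2) - z) / (rc p.1 - z).
    by rewrite /point_coef rmorphD /=; field.
  rewrite cmodM cmodV ler_pdivlMr // (le_trans _ (dist _ f2)) //.
  have e4 : 0 <= eta / 2 / 2 by rewrite !divr_ge0 // ltW.
  by apply: le_trans (ler_wpM2l e4 bz2) _; lra.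
rewrite ler_expR; have -> : complex.Re (- point_coef p z) = - complex.Re (point_coef p z).
  by case: (point_coef p z).
rewrite lerN2 (le_trans (ler_norm _)) // (le_trans (Re_le_cmod _)) //.
rewrite /point_coef cmodM cmodV cmod_rc ler_wpM2l // lef_pV2 ?posrE //.
exact: dist.
Qed.

Lemma sum_inv_sqr n : \sum_(j < n) (j.+1%:R ^+ 2)^-1 <= 2 :> R.
Proof.
case: n => [|n]; first by rewrite big_ord0.
suff: \sum_(j < n.+1) (j.+1%:R ^+ 2)^-1 <= 2 - n.+1%:R^-1 :> R.
  by move=> /le_trans; apply; rewrite gerBl invr_ge0.
elim: n => [|n IH]; first by rewrite big_ord_recr big_ord0 /= expr1n invr1; lra.
rewrite big_ord_recr /=; apply: le_trans (lerD IH (lexx _)) _.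
set a : R := n.+1%:R; have a0 : 0 < a by rewrite ltr0n.
have -> : n.+2%:R = a + 1 :> R by rewrite /a -natr1.
rewrite -subr_ge0.
have -> : 2 - (a + 1)^-1 - (2 - a^-1 + ((a + 1) ^+ 2)^-1) = (a * (a + 1) ^+ 2)^-1.
  by field; rewrite !gt_eqF // addr_gt0.
by rewrite invr_ge0 mulr_ge0 ?sqr_ge0 // ltW.
Qed.

Definition grid (N : nat) : seq (R * R) :=
  [seq (j%:R / N%:R, 10^-1 / N%:R) | j <- iota 0 N.+1].

Lemma grid_coef N (j j0 : nat) : (0 < N)%N ->
  let m : R := j%:R - j0%:R in
  point_coef (j%:R / N%:R, 10^-1 / N%:R) (Complex (j0%:R / N%:R) (10^-1 / N%:R)) =
  Complex (10^-1 * m / (m ^+ 2 + 100^-1)) (100^-1 / (m ^+ 2 + 100^-1)).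
Proof.
move=> N0 m; have N0' : (N%:R : R) != 0 by rewrite pnatr_eq0 -lt0n.
have pos (x : R) : x ^+ 2 * 100 + 1 != 0.
  have x2 := sqr_ge0 x; suff : 0 < x ^+ 2 * 100 + 1 by move/gt_eqF => ->.
  by lra.
have d0 := pos m.
have z0 : 0 < complex.Im (Complex (j0%:R / N%:R) (10^-1 / N%:R) : R[i]).
  by rewrite /= divr_gt0 // ltr0n.
apply: (mulIf (sub_rc_neq0 (j%:R / N%:R) z0)).
rewrite /point_coef divfK ?sub_rc_neq0 //.
apply/eqP; rewrite eq_complex /= /m.
by apply/andP; split; apply/eqP; field; rewrite N0'; exact: d0.
Qed.

Lemma grid_factor N (j0 : nat) : (0 < N)%N -> (j0 <= N)%N ->
  5 / 4 <= points_factor (grid N) (Complex (j0%:R / N%:R) (10^-1 / N%:R)).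
Proof.
move=> N0 jN; set z := Complex _ _.
pose F j := point_factor (j%:R / N%:R, 10^-1 / N%:R) z.
have -> : points_factor (grid N) z = \prod_(0 <= j < N.+1) F j.
  by rewrite /points_factor big_map /index_iota subn0.
pose c (n : nat) : R := - (2 * (100^-1 * (n.+1%:R ^+ 2)^-1)).
have bound (j n : nat) : ((j + n.+1 = j0) \/ (j = j0 + n.+1))%N ->
    expR (c n) <= point_factor (j%:R / N%:R, 10^-1 / N%:R) z.
  move=> jn; rewrite /point_factor grid_coef //; set m := _ - _.
  have m2 : m ^+ 2 = n.+1%:R ^+ 2.
    by rewrite /m; case: jn => [<-|->]; rewrite natrD;
      [rewrite opprD addrA subrr sub0r sqrrN|rewrite addrAC subrr add0r].
  have m1 : 1 <= m ^+ 2 by rewrite m2 exprn_ege1 // ler1n.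
  set u := 10^-1 * m / (m ^+ 2 + 100^-1).
  have u2 : u ^+ 2 <= 100^-1 * (m ^+ 2)^-1.
    have -> : u ^+ 2 = 100^-1 * (m ^+ 2 / (m ^+ 2 + 100^-1) ^+ 2).
      by rewrite /u; field; rewrite gt_eqF //; lra.
    rewrite ler_pM2l ?invr_gt0 // ler_pdivrMr; last by rewrite exprn_gt0 //; lra.
    rewrite mulrC ler_pdivlMr; last by lra.
    by rewrite -expr2 ler_pXn2r ?nnegrE //; lra.
  have u3 : u ^+ 2 <= 4^-1.
    apply: le_trans u2 _; have : (m ^+ 2)^-1 <= 1 by rewrite invf_le1 //; lra.
    by lra.
  have u1 : - 2^-1 <= u by nra.
  apply: le_trans (factor_lower (w := Complex u _) u1).
  by rewrite ler_expR lerN2 ler_pM2l //= -m2.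
have center : 141 / 100 <= point_factor (j0%:R / N%:R, 10^-1 / N%:R) z.
  rewrite /point_factor grid_coef // subrr mulr0 mul0r expr0n /= add0r divff //.
  rewrite cmodM cmod_cexp /= oppr0 expR0 mulr1.
  rewrite -(@ler_pXn2r _ 2) ?nnegrE ?cmod_ge0 // cmod_sqr /=; lra.
have side (G : nat -> nat) n : (forall k, (k < n)%N -> (G k + k.+1 = j0) \/ (G k = j0 + k.+1))%N ->
    24 / 25 <= \prod_(k < n) F (G k).
  move=> GE; apply: le_trans (_ : \prod_(k < n) expR (c k) <= _); last first.
    by apply: ler_prod => k _; rewrite expR_ge0 bound //; exact: GE.
  rewrite -expR_sum; apply: le_trans (expR_ge1Dx _).
  have -> : \sum_(k < n) c k = - (50^-1 * \sum_(k < n) (k.+1%:R ^+ 2)^-1).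
    rewrite mulr_sumr -sumrN; apply: eq_bigr => k _; rewrite /c.
    by move: (_ ^+ 2)^-1 => x; lra.
  by have := sum_inv_sqr n; lra.
have left : 24 / 25 <= \prod_(0 <= j < j0) F j.
  rewrite big_nat_rev big_mkord; apply: (side (fun k => (0 + j0 - k.+1)%N)) => k kj; left.
  by rewrite add0n subnK.
have right : 24 / 25 <= \prod_(j0.+1 <= j < N.+1) F j.
  rewrite -{1}[j0.+1]add0n big_addn big_mkord; apply: (side (fun k => k + j0.+1)%N) => k _.
  by right; rewrite addnS addnC addnS.
have mid : \prod_(j0 <= j < N.+1) F j = F j0 * \prod_(j0.+1 <= j < N.+1) F j.
  by rewrite big_ltn.
rewrite (big_cat_nat (leq0n j0) (leqW jN)) /= mid.
have a1 : 0 <= 24 / 25 :> R by lra.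
have a2 : 0 <= 141 / 100 * (24 / 25) :> R by lra.
have a3 : 0 <= 141 / 100 :> R by lra.
by apply: le_trans (ler_pM a1 a2 left (ler_pM a3 a1 center right)); lra.
Qed.

Lemma points_factor_cat s t z :
  points_factor (s ++ t) z = points_factor s z * points_factor t z.
Proof. exact: big_cat. Qed.

Lemma points_sqr_cat s t : points_sqr (s ++ t) = points_sqr s + points_sqr t.
Proof. exact: big_cat. Qed.

Lemma points_sqr_ge0 s : 0 <= points_sqr s.
Proof. by apply: sumr_ge0 => p _; exact: sqr_ge0. Qed.

Lemma points_factor_ge0 s z : 0 <= points_factor s z.
Proof. by apply: prodr_ge0 => p _; exact: cmod_ge0. Qed.

Definition stage (r N : nat) : seq (R * R) := flatten (nseq r (grid N)).

Lemma stageS r N : stage r.+1 N = grid N ++ stage r N. Proof. by []. Qed.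

Lemma points_factor_stage r N z :
  points_factor (stage r N) z = points_factor (grid N) z ^+ r.
Proof.
elim: r => [|r IH]; first by rewrite /points_factor big_nil expr0.
by rewrite stageS points_factor_cat exprS IH.
Qed.

Lemma points_sqr_stage r N : (0 < N)%N ->
  points_sqr (stage r N) <= r%:R * 50^-1 / N%:R.
Proof.
move=> N0; have n0 : 0 < N%:R :> R by rewrite ltr0n.
elim: r => [|r IH]; first by rewrite /points_sqr big_nil mul0r mul0r.
rewrite stageS points_sqr_cat -natr1 !mulrDl [leRHS]addrC lerD // mul1r.
rewrite /points_sqr big_map.
have -> : \sum_(j <- iota 0 N.+1) (j%:R / N%:R, 10^-1 / N%:R : R).2 ^+ 2 =
    N.+1%:R * (100^-1 / N%:R ^+ 2) :> R.
  transitivity (\sum_(j <- iota 0 N.+1) (10^-1 / N%:R : R) ^+ 2); first by apply: eq_bigr.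
  rewrite big_const_seq count_predT size_iota iter_addr_0 mulr_natl.
  by congr (_ *+ _); field; rewrite gt_eqF.
have : N.+1%:R <= 2 * N%:R :> R by rewrite -natrM ler_nat mul2n -addnn -addn1 leq_add2l.
move=> h; apply: le_trans (_ : (2 * N%:R) * (100^-1 / N%:R ^+ 2) <= _).
  by rewrite ler_wpM2r // divr_ge0 // exprn_ge0 // ltW.
by rewrite le_eqVlt; apply/orP; left; apply/eqP; field; rewrite gt_eqF.
Qed.

Lemma mem_stage r N p : p \in stage r N -> exists2 j, (j <= N)%N & p.1 = j%:R / N%:R.
Proof.
move=> /flattenP[g /nseqP[-> _]] /mapP[j]; rewrite mem_iota add0n ltnS => jN ->.
by exists j.
Qed.

Lemma stage_mem r N j : (0 < r)%N -> (j <= N)%N ->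
  (j%:R / N%:R, 10^-1 / N%:R) \in stage r N.
Proof.
case: r => // r _ jN; rewrite stageS mem_cat; apply/orP; left.
by apply/mapP; exists j; rewrite // mem_iota add0n ltnS.
Qed.

Lemma expr_unbounded (a M : R) : 1 < a -> exists r, (0 < r)%N /\ M <= a ^+ r.
Proof.
move=> a1; have am : 0 < a - 1 by rewrite subr_gt0.
pose r := (Num.truncn (`|M| / (a - 1))).+1; exists r; split => //.
have hr : M <= r%:R * (a - 1).
  rewrite (le_trans (ler_norm M)) // -ler_pdivrMr // ltW //.
  exact: truncnS_gt.
apply: le_trans hr _; elim: r => [|r IH]; first by rewrite mul0r expr0.
rewrite -natr1 mulrDl mul1r exprS.
have : 1 <= a ^+ r by rewrite exprn_ege1 // ltW.
by nra.
Qed.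

Lemma stage_step s (eta M eps : R) : 0 < eta -> 0 < eps ->
  {in s, forall p, 0 <= p.1 <= 1} ->
  exists t (y : R), [/\ 0 < y < eps, {in t, forall p, 0 <= p.1 <= 1},
    points_sqr t <= eps,
    forall lam : R, 0 <= lam <= 1 -> exists2 p, p \in t & `|p.1 - lam| < eps
  & forall lam : R, 0 <= lam <= 1 ->
    {in s, forall p, eta <= `|lam - p.1| /\ eta <= `|lam - (p.1 + p.2)|} ->
    exists z, [/\ complex.Im z = y, `|complex.Re z - lam| < 20 * y
      & M <= points_factor (s ++ t) z]].
Proof.
move=> eta0 eps0 sb; have [K K0 old] := points_factor_old eta0 sb.
have [r [r0 rM]] := @expr_unbounded (5 / 4) (M / K) ltac:(lra).
pose m : R := Num.min 1 (Num.min eps (eta / 2)).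
have m0 : 0 < m by rewrite !lt_min ltr01 eps0 divr_gt0.
pose N := (Num.truncn (2 * r%:R / m)).+1.
have n0 : 0 < N%:R :> R by rewrite ltr0n.
have r1 : 1 <= r%:R :> R by rewrite ler1n.
have Nr : 2 * r%:R / N%:R < m.
  by rewrite ltr_pdivrMr // [m * _]mulrC -ltr_pdivrMr //; exact: truncnS_gt.
have N2 : 2 / N%:R < m.
  by apply: le_lt_trans Nr; rewrite ler_pM2r ?invr_gt0 //; lra.
have [m1 [m2 m3]] : m <= 1 /\ m <= eps /\ m <= eta / 2.
  by rewrite /m !ge_min !lexx !orbT.
have iN : 0 < N%:R^-1 :> R by rewrite invr_gt0.
have near (lam : R) : 0 <= lam <= 1 ->
    exists2 j, (j <= N)%N & 0 <= lam - j%:R / N%:R < N%:R^-1.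
  move=> /andP[l0 l1]; have lN : 0 <= lam * N%:R by rewrite mulr_ge0 // ltW.
  have /andP[tl tu] := truncn_itv lN.
  exists (Num.truncn (lam * N%:R)).
    by rewrite -(ler_nat R) (le_trans tl) // ler_piMl // ltW.
  rewrite subr_ge0 ler_pdivrMr // tl ltrBlDr -[X in X + _]mul1r -mulrDl.
  by rewrite ltr_pdivlMr // addrC natr1.
exists (stage r N), (10^-1 / N%:R); split.
- rewrite divr_gt0 //=; apply: lt_le_trans m2; apply: lt_trans N2.
  by rewrite ltr_pM2r //; lra.
- move=> p /mem_stage[j jN ->]; rewrite divr_ge0 //= ler_pdivrMr // mul1r.
  by rewrite ler_nat.
- apply: le_trans (points_sqr_stage r (ltn0Sn _)) _; rewrite -/N.
  by move: Nr; lra.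
- move=> lam /near[j jN /andP[j1 j2]].
  exists (j%:R / N%:R, 10^-1 / N%:R); first exact: stage_mem.
  by rewrite /= distrC ger0_norm //; lra.
move=> lam lam01 far; have [j jN /andP[j1 j2]] := near _ lam01.
exists (Complex (j%:R / N%:R) (10^-1 / N%:R)); split => //=.
  by rewrite distrC ger0_norm //; lra.
set z := Complex _ _.
have zl : cmod (rc lam - z) <= 2 / N%:R.
  apply: le_trans (cmod_le_ReIm _) _; rewrite Re_sub_rc Im_sub_rc /= normrN.
  by rewrite !ger0_norm ?divr_ge0 ?(ltW n0) //; lra.
have z0 : 0 < complex.Im z by rewrite /= divr_gt0.
rewrite points_factor_cat points_factor_stage.
have Kz : K <= points_factor s z by apply: old lam01 far z0 _ _; lra.
have gz : (5 / 4) ^+ r <= points_factor (grid N) z ^+ r.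
  by rewrite ler_pXn2r ?nnegrE ?points_factor_ge0 ?grid_factor //; lra.
have -> : M = K * (M / K) by rewrite mulrC divfK // gt_eqF.
apply: le_trans (ler_wpM2l (ltW K0) (le_trans rM gz)) _.
by rewrite ler_wpM2r // exprn_ge0 // points_factor_ge0.
Qed.

End Stage.

(** * The sequence of eigenvalues *)

Section Construction.
Context (R : realType).
Implicit Types (s t : seq (R * R)).

Definition exclusion_radius s (k : nat) : R := ((4 * (size s).+1%:R) * 2 ^+ k)^-1.

Lemma exclusion_radius_gt0 s k : 0 < exclusion_radius s k.
Proof. by rewrite invr_gt0 mulr_gt0 ?exprn_gt0 ?mulr_gt0 ?ltr0n. Qed.

Definition near_points s (eta : R) : set R :=
  \big[setU/set0]_(p <- s) (`]p.1 - eta, p.1 + eta[%classic `|`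
    `]p.1 + p.2 - eta, p.1 + p.2 + eta[%classic).

Lemma not_near_points s (eta lam : R) : ~ near_points s eta lam ->
  {in s, forall p, eta <= `|lam - p.1| /\ eta <= `|lam - (p.1 + p.2)|}.
Proof.
move=> nb p ps; have ball_in (b : R) : `|lam - b| < eta -> `]b - eta, b + eta[%classic lam.
  by rewrite ltr_distl /= in_itv /=.
have np : ~ (`]p.1 - eta, p.1 + eta[%classic `|`
    `]p.1 + p.2 - eta, p.1 + p.2 + eta[%classic) lam.
  by move=> pl; apply: nb; rewrite /near_points -bigcup_seq; exists p.
split; rewrite leNgt; apply/negP => /ball_in h; apply: np; [by left|by right].
Qed.

Lemma measurable_near_points s (eta : R) : measurable (near_points s eta).
Proof.
apply: bigsetU_measurable => p _; exact: measurableU.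
Qed.

Lemma near_points_measure s (eta : R) : 0 <= eta ->
  (lebesgue_measure (near_points s eta) <= ((4 * eta) *+ size s)%:E)%E.
Proof.
move=> eta0; elim: s => [|p s IH].
  by rewrite /near_points big_nil measure0.
rewrite /near_points big_cons -/(near_points s eta) /= mulrS EFinD.
pose I (b : R) : set R := `]b - eta, b + eta[%classic.
have itv_m (b : R) : (lebesgue_measure (I b) <= (2 * eta)%:E)%E.
  rewrite lebesgue_measure_itv /= lte_fin; case: ifPn => h.
    by rewrite -EFinB lee_fin; lra.
  by rewrite lee_fin mulr_ge0.
apply: le_trans (measureU2 _ _ _) _.
- exact: measurableU.
- exact: measurable_near_points.
apply: leeD IH; apply: le_trans (measureU2 _ _ _) _ => //.
apply: le_trans (leeD (itv_m _) (itv_m _)) _.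
by rewrite -EFinD lee_fin; lra.
Qed.

Lemma near_points_radius s k :
  (lebesgue_measure (near_points s (exclusion_radius s k)) <= ((2 ^+ k)^-1)%:E)%E.
Proof.
apply: le_trans (near_points_measure _ (ltW (exclusion_radius_gt0 _ _))) _.
rewrite lee_fin -mulr_natl /exclusion_radius.
have k0 : 0 < 2 ^+ k :> R by rewrite exprn_gt0.
have n0 : 0 < (size s).+1%:R :> R by rewrite ltr0n.
have -> : (size s)%:R * (4 * ((4 * (size s).+1%:R) * 2 ^+ k)^-1) =
    (size s)%:R / (size s).+1%:R * (2 ^+ k)^-1 :> R.
  by field; rewrite ?gt_eqF // nat1r.
rewrite ler_piMl ?invr_ge0 ?(ltW k0) // ler_pdivrMr // mul1r ler_nat.
exact: leqnSn.
Qed.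

Section Limit.
Variables (S t : nat -> seq (R * R)) (E y : nat -> R).
Hypothesis S0 : S 0%N = [::].
Hypothesis SS : forall k, S k.+1 = S k ++ t k.
Hypothesis E0 : E 0%N = 4^-1.
Hypothesis ES : forall k, E k.+1 = Num.min (E k / 2) (y k ^+ 2 / 64).
Hypothesis y_itv : forall k, 0 < y k < E k.
Hypothesis t_itv : forall k, {in t k, forall p, 0 <= p.1 <= 1}.
Hypothesis t_sqr : forall k, points_sqr (t k) <= E k.
Hypothesis t_dense : forall k lam, 0 <= lam <= 1 ->
  exists2 p, p \in t k & `|p.1 - lam| < E k.
Hypothesis t_large : forall k lam, 0 <= lam <= 1 ->
  ~ near_points (S k) (exclusion_radius (S k) k) lam ->
  exists z, [/\ complex.Im z = y k, `|complex.Re z - lam| < 20 * y k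
    & 2 * k%:R <= points_factor (S k.+1) z].

Let p n := nth (0, 0) (S n.+1) n.

Let E_gt0 k : 0 < E k.
Proof. by have /andP[y0 yE] := y_itv k; exact: lt_trans yE. Qed.

Let E_half k : E k.+1 <= E k / 2.
Proof. by rewrite ES ge_min lexx. Qed.

Let E_sqr k : 64 * E k.+1 <= y k ^+ 2.
Proof. by rewrite -ler_pdivlMl // mulrC ES ge_min lexx orbT. Qed.

Let E_le k : E k <= (2 ^+ k)^-1.
Proof.
elim: k => [|k IH]; first by rewrite E0 expr0 invr1; lra.
apply: le_trans (E_half k) _; rewrite exprS invfM mulrC ler_pM2l ?invr_gt0 //.
Qed.

Let size_S k : (k <= size (S k))%N.
Proof.
elim: k => [//|k IH]; rewrite SS size_cat -addn1 leq_add //.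
have [|q qt _] := @t_dense k 0; first by rewrite lexx ler01.
by case: (t k) qt.
Qed.

Let prefix j k : (k <= j)%N ->
  exists2 u, S j = S k ++ u & points_sqr u + 2 * E j <= 2 * E k.
Proof.
elim: j => [|j IH].
  rewrite leqn0 => /eqP ->; exists [::]; first by rewrite cats0.
  by rewrite /points_sqr big_nil add0r.
rewrite leq_eqVlt => /predU1P[->|].
  exists [::]; first by rewrite cats0.
  by rewrite /points_sqr big_nil add0r.
rewrite ltnS => /IH[u Sj us]; exists (u ++ t j); first by rewrite SS Sj catA.
rewrite points_sqr_cat; have := t_sqr j; have := E_half j; lra.
Qed.

Let pE n j : (n <= j)%N -> mkseq p n = take n (S j).
Proof.
move=> nj; have szj : (n <= size (S j))%N := leq_trans nj (size_S j).
apply: (@eq_from_nth _ (0, 0)); first by rewrite size_mkseq size_takel.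
move=> k; rewrite size_mkseq => kn; rewrite nth_mkseq // nth_take //.
have [u -> _] := prefix (leq_trans kn nj).
by rewrite nth_cat size_S.
Qed.

Let points_sqr_take n s : points_sqr (take n s) <= points_sqr s.
Proof. by rewrite -{2}(cat_take_drop n s) points_sqr_cat lerDl points_sqr_ge0. Qed.

Let sqr_p N : \sum_(n < N) (p n).2 ^+ 2 <= 1.
Proof.
have -> : \sum_(n < N) (p n).2 ^+ 2 = points_sqr (mkseq p N).
  by rewrite /points_sqr big_map -(big_mkord xpredT (fun n => (p n).2 ^+ 2)) /index_iota subn0.
rewrite (pE (leqnn N)); have [u Su us] := prefix (leq0n N).
rewrite (le_trans (points_sqr_take _ _)) // Su S0 /=.
have := E_gt0 N; rewrite E0 in us; lra.
Qed.

Let S_itv k : {in S k, forall q, 0 <= q.1 <= 1}.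
Proof.
elim: k => [|k IH]; first by rewrite S0.
by move=> q; rewrite SS mem_cat => /orP[/IH//|/t_itv].
Qed.

Let mem_p n : p n \in S n.+1.
Proof. by rewrite mem_nth // size_S. Qed.

Let mem_S k q : q \in S k -> exists n, p n = q.
Proof.
move=> qS; have i_lt : (index q (S k) < size (S k))%N by rewrite index_mem.
exists (index q (S k)).
have [u1 S1 _] := prefix (leq_maxl k (index q (S k)).+1).
have [u2 S2 _] := prefix (leq_maxr k (index q (S k)).+1).
have : nth (0, 0) (S (maxn k (index q (S k)).+1)) (index q (S k)) = q.
  by rewrite S1 nth_cat i_lt nth_index.
by rewrite S2 nth_cat size_S.
Qed.

Let factor_p k z n : complex.Im z = y k -> (size (S k.+1) <= n)%N ->
  2 * k%:R <= points_factor (S k.+1) z ->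
  k%:R <= \prod_(i < n) point_factor (p i) z.
Proof.
move=> zy Sn large.
have -> : \prod_(i < n) point_factor (p i) z = points_factor (mkseq p n) z.
  rewrite /points_factor big_map -(big_mkord xpredT (fun i => point_factor (p i) z)).
  by rewrite /index_iota subn0.
rewrite (pE (leq_maxl n k.+1)).
have [u -> us] := prefix (leq_maxr n k.+1).
rewrite take_cat ltnNge Sn /= points_factor_cat.
have /andP[y0 _] := y_itv k.
have small : 2^-1 <= points_factor (take (n - size (S k.+1)) u) z.
  apply: points_factor_small zy y0 _.
  have h1 := points_sqr_take (n - size (S k.+1)) u; have h2 := E_gt0 (maxn n k.+1).
  have := E_sqr k; lra.
have k0 : 0 <= k%:R :> R by rewrite ler0n.
have -> : k%:R = 2 * k%:R * 2^-1 :> R by field.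
by rewrite ler_pM ?mulr_ge0.
Qed.

Let exceptional_null : lebesgue_measure.-negligible [set lam : R |
  exists K, forall k, (K <= k)%N -> near_points (S k) (exclusion_radius (S k) k) lam].
Proof.
pose B k := near_points (S k) (exclusion_radius (S k) k).
have -> : [set lam : R | exists K, forall k, (K <= k)%N -> B k lam] =
    \bigcup_K \bigcap_(k in [set k | (K <= k)%N]) B k.
  by apply/seteqP; split=> [lam [K h]|lam [K _ h]]; exists K.
apply: negligible_bigcup => K.
have mB : measurable (\bigcap_(k in [set k | (K <= k)%N]) B k).
  by apply: bigcap_measurable => [|k _]; [exists K => /=|exact: measurable_near_points].
apply/negligibleP; first exact: mB.
apply/eqP; rewrite eq_le measure_ge0 andbT.
apply/lee_addgt0Pr => e e0; rewrite add0e.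
have /cvgrPdist_lt/(_ _ e0)[N _ hN] : (fun k => (2^-1 : R) ^+ k) @ \oo --> 0.
  by apply: cvg_expr; rewrite ger0_norm // invf_lt1 // ltr1n.
pose k := maxn N K.
apply: le_trans (_ : (lebesgue_measure (B k) <= _)%E); last first.
  apply: le_trans (near_points_radius _ _) _; rewrite lee_fin -exprVn.
  have := hN k (leq_maxl _ _); rewrite /= sub0r normrN ger0_norm ?exprn_ge0 //.
  exact: ltW.
apply: le_measure; rewrite ?inE //; first exact: measurable_near_points.
by apply: bigcap_inf; rewrite /= leq_maxr.
Qed.

Lemma limit_points : exists p : nat -> R * R,
  [/\ forall n, 0 <= (p n).1 <= 1, forall N, \sum_(n < N) (p n).2 ^+ 2 <= 1,
      forall lam eps : R, 0 <= lam <= 1 -> 0 < eps -> exists n, `|(p n).1 - lam| < eps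
    & {ae lebesgue_measure, forall lam : R, 0 <= lam <= 1 ->
        forall M eps : R, 0 < eps -> exists z, [/\ 0 < complex.Im z < eps,
          `|complex.Re z - lam| < 20 * complex.Im z
        & exists n0, forall n, (n0 <= n)%N -> M <= \prod_(i < n) point_factor (p i) z]}].
Proof.
have geom (eps : R) : 0 < eps -> exists N, forall k, (N <= k)%N -> (2 ^+ k)^-1 < eps.
  move=> e0; have /cvgrPdist_lt/(_ _ e0)[N _ hN] : (fun k => (2^-1 : R) ^+ k) @ \oo --> 0.
    by apply: cvg_expr; rewrite ger0_norm // invf_lt1 // ltr1n.
  exists N => k Nk; have := hN k Nk.
  by rewrite /= sub0r normrN ger0_norm ?exprn_ge0 // exprVn.
exists p; split.
- by move=> n; exact: S_itv (mem_p n).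
- exact: sqr_p.
- move=> lam eps lam01 /geom[N /(_ N (leqnn N)) hN].
  have [q qt ql] := t_dense N lam01.
  have qS : q \in S N.+1 by rewrite SS mem_cat qt orbT.
  have [n nq] := mem_S qS; exists n; rewrite nq.
  exact: lt_trans ql (le_lt_trans (E_le N) hN).
apply: negligibleS exceptional_null => lam /= /not_implyP[lam01 h].
apply: contrapT => nexc; apply: h => M eps e0.
have [N hN] := geom _ e0.
pose K := maxn N (Num.truncn `|M|).+1.
have [k Kk nB] : exists2 k, (K <= k)%N & ~ near_points (S k) (exclusion_radius (S k) k) lam.
  apply: contrapT => nk; apply: nexc; exists K => k Kk; apply: contrapT => nB.
  by apply: nk; exists k.
have [z [zy zl large]] := t_large lam01 nB.
have /andP[y0 yE] := y_itv k.
exists z; rewrite zy; split => //.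
  rewrite y0 (lt_trans yE) // (le_lt_trans (E_le k)) // hN //.
  by rewrite (leq_trans _ Kk) // leq_maxl.
exists (size (S k.+1)) => n nS; apply: le_trans (factor_p zy nS large).
apply: le_trans (ler_norm M) _; apply: le_trans (ltW (truncnS_gt _)) _.
by rewrite ler_nat (leq_trans _ Kk) // leq_maxr.
Qed.

End Limit.

Lemma exists_points : exists p : nat -> R * R,
  [/\ forall n, 0 <= (p n).1 <= 1, forall N, \sum_(n < N) (p n).2 ^+ 2 <= 1,
      forall lam eps : R, 0 <= lam <= 1 -> 0 < eps -> exists n, `|(p n).1 - lam| < eps
    & {ae lebesgue_measure, forall lam : R, 0 <= lam <= 1 ->
        forall M eps : R, 0 < eps -> exists z, [/\ 0 < complex.Im z < eps,
          `|complex.Re z - lam| < 20 * complex.Im z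
        & exists n0, forall n, (n0 <= n)%N -> M <= \prod_(i < n) point_factor (p i) z]}].
Proof.
pose good (st : seq (R * R) * R * nat) (ty : seq (R * R) * R) :=
  let: (s, eps, k) := st in
  0 < eps -> {in s, forall q, 0 <= q.1 <= 1} ->
  [/\ 0 < ty.2 < eps, {in ty.1, forall q, 0 <= q.1 <= 1}, points_sqr ty.1 <= eps,
    forall lam : R, 0 <= lam <= 1 -> exists2 q, q \in ty.1 & `|q.1 - lam| < eps
  & forall lam : R, 0 <= lam <= 1 ->
    ~ near_points s (exclusion_radius s k) lam ->
    exists z, [/\ complex.Im z = ty.2, `|complex.Re z - lam| < 20 * ty.2
      & 2 * k%:R <= points_factor (s ++ ty.1) z]].
have /choice[f fP] : forall st, exists ty, good st ty.
  move=> [[s eps] k]; have [e0|e0] := boolP (0 < eps); last by exists ([::], 0) => /=; rewrite (negPf e0).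
  have [sb|sb] := pselect {in s, forall q, 0 <= q.1 <= 1}; last by exists ([::], 0).
  have [t [y [h1 h2 h3 h4 h5]]] :=
    stage_step (2 * k%:R) (exclusion_radius_gt0 s k) e0 sb.
  exists (t, y) => _ _; split => // lam lam01 /not_near_points; exact: h5.
pose next k (st : seq (R * R) * R) := let ty := f (st, k) in
  (st.1 ++ ty.1, Num.min (st.2 / 2) (ty.2 ^+ 2 / 64)).
pose st := fix st k := if k is k'.+1 then next k' (st k') else ([::], 4^-1 : R).
have fE k : f (st k, k) = f ((st k).1, (st k).2, k) by rewrite -surjective_pairing.
have stP k : 0 < (st k).2 /\ {in (st k).1, forall q, 0 <= q.1 <= 1}.
  elim: k => [|k [e0 sb]]; first by split => //=; rewrite invr_gt0.
  have [/andP[y0 _] tb _ _ _] := fP ((st k).1, (st k).2, k) e0 sb.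
  rewrite /= /next fE; split => /=.
    by rewrite lt_min !divr_gt0 // exprn_gt0.
  by move=> q; rewrite mem_cat => /orP[/sb//|/tb].
have stG k := let: conj e0 sb := stP k in fP ((st k).1, (st k).2, k) e0 sb.
apply: (@limit_points (fun k => (st k).1) (fun k => (f (st k, k)).1)
  (fun k => (st k).2) (fun k => (f (st k, k)).2)) => //.
- by move=> k; have [] := stG k; rewrite fE.
- by move=> k; have [] := stG k; rewrite fE.
- by move=> k; have [] := stG k; rewrite fE.
- by move=> k; have [] := stG k; rewrite fE.
by move=> k; have [_ _ _ _] := stG k; rewrite -fE.
Qed.

End Construction.

(** * The operators *)

Section Assembly.
Context (R : realType) (H : hilbert_space R).
Local Notation rc := (real_complex R).
Local Notation e := (hbasis H).
Hypothesis eb : orthonormal_basis e.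
Hypothesis e_infinite : forall N, exists2 n, (N <= n)%N & e n != 0.
Variable p : nat -> R * R.
Hypothesis p_itv : forall n, 0 <= (p n).1 <= 1.
Hypothesis p_sqr : forall N, \sum_(n < N) (p n).2 ^+ 2 <= 1.
Hypothesis p_dense : forall lam eps : R, 0 <= lam <= 1 -> 0 < eps ->
  exists n, `|(p n).1 - lam| < eps.

(* The basis may contain null vectors: the eigenvalues are attached in order to
   the others. *)
Definition rank_nonnull n : nat := (\sum_(k < n) (e k != 0%R))%N.

Lemma rank_nonnullS n : rank_nonnull n.+1 = (rank_nonnull n + (e n != 0%R))%N.
Proof. by rewrite /rank_nonnull big_ord_recr. Qed.

Lemma rank_nonnull_nd i j : (i <= j)%N -> (rank_nonnull i <= rank_nonnull j)%N.
Proof.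
elim: j => [|j IH]; first by rewrite leqn0 => /eqP ->.
rewrite leq_eqVlt => /predU1P[->//|/IH le].
by rewrite rank_nonnullS (leq_trans le) // leq_addr.
Qed.

Lemma rank_nonnull_unbounded m : exists n, (m <= rank_nonnull n)%N.
Proof.
elim: m => [|m [n mn]]; first by exists 0%N.
have [k nk ek] := e_infinite n; exists k.+1.
by rewrite rank_nonnullS ek addn1 ltnS (leq_trans mn) // rank_nonnull_nd.
Qed.

Lemma rank_nonnull_onto m : exists2 n, e n != 0 & rank_nonnull n = m.
Proof.
have [n0 hn0] := rank_nonnull_unbounded m.+1.
have ex : exists n, (m < rank_nonnull n)%N by exists n0.
case: (ex_minnP ex) => -[|n] mn minn; first by rewrite /rank_nonnull big_ord0 in mn.
have nm : (rank_nonnull n <= m)%N.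
  by rewrite leqNgt; apply/negP => /minn; rewrite ltnn.
move: mn; rewrite rank_nonnullS; case: (boolP (e n != 0)) => en /=.
  by rewrite addn1 ltnS => mn; exists n => //; apply/eqP; rewrite eqn_leq nm.
by rewrite addn0 ltnNge nm.
Qed.

Lemma big_rank_nonnull T (idx : T) (op : Monoid.law idx) (phi : nat -> T) N :
  \big[op/idx]_(n < N) (if e n == 0 then idx else phi (rank_nonnull n)) =
  \big[op/idx]_(m < rank_nonnull N) phi m.
Proof.
elim: N => [|N IH]; first by rewrite /rank_nonnull !big_ord0.
rewrite big_ord_recr /= IH rank_nonnullS; case: (e N == 0) => /=.
  by rewrite addn0 Monoid.mulm1.
by rewrite addn1 big_ord_recr.
Qed.

Definition eigB n : R := if e n == 0 then 0 else (p (rank_nonnull n)).1.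
Definition eigX n : R := if e n == 0 then 0 else (p (rank_nonnull n)).2.

Lemma eigB_itv n : 0 <= eigB n <= 1.
Proof. by rewrite /eigB; case: ifP => _; [rewrite lexx ler01|exact: p_itv]. Qed.

Lemma eigX_sqr N : \sum_(n < N) eigX n ^+ 2 <= 1.
Proof.
have -> : \sum_(n < N) eigX n ^+ 2 =
    \sum_(n < N) (if e n == 0 then 0 else (p (rank_nonnull n)).2 ^+ 2).
  by apply: eq_bigr => n _; rewrite /eigX; case: ifP => _ //; rewrite expr0n.
by rewrite (big_rank_nonnull _ (fun m => (p m).2 ^+ 2)).
Qed.

Lemma eigX_le1 n : `|eigX n| <= 1.
Proof.
rewrite -(@ler_pXn2r _ 2) ?nnegrE // expr1n real_normK ?num_real //.
rewrite (le_trans _ (eigX_sqr n.+1)) // big_ord_recr /= lerDr sumr_ge0 // => k _.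
exact: sqr_ge0.
Qed.

Lemma bounded_eigB : bounded_seq (fun n => rc (eigB n)).
Proof. by exists 1 => n; rewrite cmod_rc; have /andP[b0 b1] := eigB_itv n; rewrite ger0_norm. Qed.

Lemma bounded_eigX : bounded_seq (fun n => rc (eigX n)).
Proof. by exists 1 => n; rewrite cmod_rc eigX_le1. Qed.

Lemma bounded_eigA : bounded_seq (fun n => rc (eigB n + eigX n)).
Proof.
have [M hM] := bounded_eigB; have [N hN] := bounded_eigX.
by exists (M + N) => n; rewrite rmorphD /= (le_trans (cmodD _ _)) // lerD.
Qed.

Definition opB : operator H := diag_op eb bounded_eigB.
Definition opA : operator H := diag_op eb bounded_eigA.
Definition opX : H -> H := diag e (fun n => rc (eigX n)).

Lemma opA_self_adjoint : self_adjoint opA.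
Proof. by apply: diag_self_adjoint => n; exact: conj_rc. Qed.

Lemma opB_self_adjoint : self_adjoint opB.
Proof. by apply: diag_self_adjoint => n; exact: conj_rc. Qed.

Lemma is_difference_opX : is_difference opA opB opX.
Proof.
split=> // u _; apply: (hilb_ext eb) => n; rewrite inB.
rewrite (coef_diag eb _ _ bounded_eigX) (coef_diag eb _ _ bounded_eigA).
by rewrite (coef_diag eb _ _ bounded_eigB) -mulrBl rmorphD /= addrAC subrr add0r.
Qed.

Lemma hilbert_schmidt_opX : hilbert_schmidt opX.
Proof.
split.
- by move=> a u v; exact: (diag_linear eb _ _ _ bounded_eigX).
- exact: (diag_continuous eb bounded_eigX).
apply: le_lt_trans (ltry 1); apply: nneseries_le => [n|N]; first exact: sqr_ge0.
apply: le_trans (eigX_sqr N); apply: ler_sum => n _.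
rewrite -/(nrm (opX (e n))) /opX (diag_e eb _ bounded_eigX) nrmZ cmod_rc exprMn.
rewrite real_normK ?num_real // ler_piMr ?sqr_ge0 // expr_le1 ?nrm_ge0 //.
exact: orthonormal_nrm_le1 eb.1.
Qed.

Lemma resolvent_set_gap (z : R[i]) (delta : R) : 0 < delta ->
  (forall n, delta <= cmod (rc (eigB n) - z)) -> resolvent_set opB z.
Proof.
move=> d0 dz; have bz n : rc (eigB n) - z != 0.
  by rewrite -cmod_gt0 (lt_le_trans d0).
apply: diag_resolvent_set => //; exists delta^-1 => n.
by rewrite cmodV lef_pV2 ?posrE // cmod_gt0.
Qed.

Lemma spectrum_opB : spectrum opB = rc @` [set x | 0 <= x <= 1].
Proof.
apply/seteqP; split=> [z sz|_ [lam lam01 <-]]; last first.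
  apply: diag_spectrum => x x0; have [m pm] := p_dense lam01 x0.
  have [n en nm] := rank_nonnull_onto m; exists n; split => //.
  by rewrite -rmorphB cmod_rc /eigB (negPf en) nm.
apply: contrapT => nz; apply: sz.
have [z0|z0] := eqVneq (complex.Im z) 0; last first.
  apply: (@resolvent_set_gap z `|complex.Im z|); first by rewrite normr_gt0.
  by move=> n; have := Im_le_cmod (rc (eigB n) - z); rewrite Im_sub_rc normrN.
have zE : z = rc (complex.Re z) by case: z z0 {nz} => a b /= ->.
have gap n : `|eigB n - complex.Re z| <= cmod (rc (eigB n) - z).
  by rewrite -Re_sub_rc Re_le_cmod.
have [zneg|zpos] := ltP (complex.Re z) 0.
  apply: (@resolvent_set_gap z (- complex.Re z)); first by rewrite oppr_gt0.
  move=> n; apply: le_trans (gap n); apply: le_trans (ler_norm _).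
  by have /andP[b0 _] := eigB_itv n; lra.
have [z1|z1] := leP (complex.Re z) 1.
  by case: nz; exists (complex.Re z); rewrite //= zpos.
apply: (@resolvent_set_gap z (complex.Re z - 1)); first by rewrite subr_gt0.
move=> n; apply: le_trans (gap n); rewrite distrC; apply: le_trans (ler_norm _).
by have /andP[_ b1] := eigB_itv n; lra.
Qed.

Section UpperHalfPlane.
Variables (z : R[i]) (z0 : 0 < complex.Im z).

Definition eigC n : R[i] := rc (eigX n) / (rc (eigB n) - z).

Lemma opX_resolvent : (fun u => opX (resolvent opB z u)) = diag e eigC.
Proof.
have bi : bounded_seq (fun n => (rc (eigB n) - z)^-1).
  exists (complex.Im z)^-1 => n; rewrite cmodV.
  by rewrite lef_pV2 ?posrE ?Im_le_sub_rc // cmod_gt0 sub_rc_neq0.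
apply/funext => u; rewrite resolvent_diag //; last by move=> n; exact: sub_rc_neq0.
exact: (diag_comp eb u bounded_eigX bi).
Qed.

Lemma eigC_null n : e n = 0 -> eigC n = 0.
Proof. by move=> en; rewrite /eigC /eigX en eqxx mul0r. Qed.

Lemma eigC_sqr N : \sum_(n < N) cmod (eigC n) ^+ 2 <= ((complex.Im z)^-1) ^+ 2.
Proof.
apply: le_trans (_ : \sum_(n < N) eigX n ^+ 2 * (complex.Im z)^-1 ^+ 2 <= _).
  apply: ler_sum => n _; rewrite -[eigX n ^+ 2]real_normK ?num_real // -exprMn.
  rewrite ler_pXn2r ?nnegrE ?cmod_ge0 ?mulr_ge0 ?invr_ge0 ?(ltW z0) //.
  exact: (@cmod_point_coef _ (eigB n, eigX n) z z0).
by rewrite -mulr_suml ler_piMl ?sqr_ge0 ?eigX_sqr.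
Qed.

Lemma det2_opX :
  (regprod eigC : nat -> R[i]^o) @ \oo
    --> (det2_1p (fun u => opX (resolvent opB z u)) : R[i]^o).
Proof.
have bz n : rc (eigB n) - z != 0 by exact: sub_rc_neq0.
have az n : rc (eigB n + eigX n) - z != 0 by exact: sub_rc_neq0.
have E n : 1 + eigC n = (rc (eigB n + eigX n) - z) / (rc (eigB n) - z).
  apply: (mulIf (bz n)); rewrite divfK // mulrDl mul1r divfK // rmorphD /=.
  by rewrite addrAC.
rewrite opX_resolvent.
apply: (@det2_diag R H eb eigC (complex.Im z)^-1 _ eigC_sqr _
  ((1 + cmod z) / complex.Im z)).
- by rewrite invr_gt0.
- move=> n; rewrite /nonnull; have [en|en] := eqVneq (e n) 0; last by rewrite mulr1.
  by rewrite eigC_null // mul0r.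
- by move=> n; rewrite E mulf_neq0 // invr_eq0.
move=> n; rewrite E invf_div cmodM cmodV ler_pM ?cmod_ge0 ?invr_ge0 ?cmod_ge0 //.
  rewrite (le_trans (cmodB _ _)) // lerD2r cmod_rc.
  by have /andP[b0 b1] := eigB_itv n; rewrite ger0_norm.
by rewrite lef_pV2 ?posrE ?Im_le_sub_rc // cmod_gt0.
Qed.

Lemma det2_opX_lower (M : R) n0 :
  (forall n, (n0 <= n)%N -> M <= \prod_(m < n) point_factor (p m) z) ->
  M <= cmod (det2_1p (fun u => opX (resolvent opB z u))).
Proof.
move=> large; have [N hN] := rank_nonnull_unbounded n0.
apply: (cvgr_to_ge (cvg_cmod det2_opX)); exists N => // n /= Nn.
rewrite /regprod cmod_prod.
have -> : \prod_(k < n) cmod ((1 + eigC k) * cexp (- eigC k)) =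
    \prod_(k < n) (if e k == 0 then 1 else point_factor (p (rank_nonnull k)) z).
  apply: eq_bigr => k _; case: ifPn => [/eqP ek|ek].
    by rewrite eigC_null // addr0 mul1r oppr0 cexp0 cmod1.
  by rewrite /point_factor /point_coef /eigC /eigX /eigB (negPf ek).
rewrite (big_rank_nonnull _ (fun m => point_factor (p m) z)); apply: large.
exact: leq_trans hN (rank_nonnull_nd Nn).
Qed.

End UpperHalfPlane.

Lemma no_nontangential_limit (lam : R) :
  (forall M eps : R, 0 < eps -> exists z, [/\ 0 < complex.Im z < eps,
    `|complex.Re z - lam| < 20 * complex.Im z
    & exists n0, forall n, (n0 <= n)%N -> M <= \prod_(i < n) point_factor (p i) z]) ->
  ~ exists l : R[i], nontangential_limit
      (fun z => det2_1p (fun u => opX (resolvent opB z u))) lam l.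
Proof.
move=> large [l /(_ 20 (ltr0n _ _))/cvg_cmodP/(_ 1 ltr01)].
move=> /nbhs_ballP[_ /ltc_eq[r r0 ->] /= near_lam].
have r21 : 0 < r / 21 by rewrite divr_gt0.
have [z [/andP[z0 zr] zl [n0 hn0]]] := large (cmod l + 1) (r / 21) r21.
have zball : ball (rc lam : R[i]^o) (rc r) (z : R[i]^o).
  rewrite -ball_normE /= cmodE ltcR (le_lt_trans (cmod_le_ReIm _)) //.
  rewrite Re_sub_rc Im_sub_rc normrN distrC (gtr0_norm z0); lra.
have := near_lam z zball (conj z0 zl).
have := det2_opX_lower z0 hn0; set w := det2_1p _ => h1 h2.
have : cmod w <= cmod l + cmod (l - w).
  by have := cmodB l (l - w); rewrite opprB addrC subrK.
by lra.
Qed.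

End Assembly.

Theorem theorem8p1 (R : realType) :
  exists (H : hilbert_space R) (A B : operator H) (X : H -> H) (J : set R),
    [/\ separable H, self_adjoint A & self_adjoint B] /\
    [/\ is_difference A B X, hilbert_schmidt X,
        spectrum B = real_complex R @` J,
        is_interval J /\ (exists a b : R, [/\ J a, J b & a < b])
      & {ae lebesgue_measure, forall x : R, J x ->
          ~ exists l : R[i], nontangential_limit
              (fun z => det2_1p (fun u => X (resolvent B z u))) x l}].
Proof.
have [p [p_itv p_sqr p_dense p_ae]] := exists_points R.
have eb := hbasis_l2 R; have e_inf := hbasis_l2_nonnull R.
exists (l2_space R), (opA eb p_itv p_sqr), (opB eb p_itv), (opX p).
exists [set x | 0 <= x <= 1]; split; split.
- exact: separable_basis eb.
- exact: opA_self_adjoint.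
- exact: opB_self_adjoint.
- exact: is_difference_opX.
- exact: hilbert_schmidt_opX.
- exact: spectrum_opB.
- split=> [x y /= /andP[x0 x1] /andP[y0 y1] w /andP[xw wy]|].
    by rewrite (le_trans x0 xw) (le_trans wy y1).
  by exists 0, 1; split; rewrite /= ?lexx ?ler01 ?ltr01.
apply: negligibleS p_ae => x /= nlim large; apply: nlim => x01.
by apply: no_nontangential_limit => //; exact: large.
Qed.
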